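(* Let $\Omega\subset\mathbb{R}^n$, $n\ge1$, be an open bounded set, $X:=L^2(\Omega)$ (real) with its usual norm $\|\cdot\|$, and $T>0$. Let $f\colon[0,+\infty)\times\Omega\times\mathbb{R}\to\mathbb{R}$ be a continuous mapping such that: (a) there is $m>0$ with $|f(t,x,y)|\le m$ for $t\in[0,+\infty)$, $x\in\Omega$, $y\in\mathbb{R}$; (b) there is $L>0$ with $|f(t,x,y_1)-f(t,x,y_2)|\le L|y_1-y_2|$ for $t\in[0,+\infty)$, $x\in\Omega$, $y_1,y_2\in\mathbb{R}$; (c) $f(t,x,y)=f(t+T,x,y)$ for $t\in[0,+\infty)$, $x\in\Omega$, $y\in\mathbb{R}$; (d) there are continuous functions $f_+,f_-\colon[0,+\infty)\times\Omega\to\mathbb{R}$ with $f_+(t,x)=\lim_{y\to+\infty}f(t,x,y)$ and $f_-(t,x)=\lim_{y\to-\infty}f(t,x,y)$ for $t\in[0,+\infty)$, $x\in\Omega$. Let $A\colon D(A)\to X$ be a linear operator such that $-A$ generates a compact $C_0$ semigroup $\{S_A(t)\}_{t\ge0}$ of bounded linear operators on $X$, and let $\lambda$ be a real eigenvalue of $A$ such that (A3) $\mathrm{Ker}\,(A-\lambda I)=\mathrm{Ker}\,(A^*-\lambda I)=\mathrm{Ker}\,(I-e^{\lambda T}S_A(T))$. Put $N_\lambda:=\mathrm{Ker}\,(\lambda I-A)$ and $F(t,u)(x):=f(t,x,u(x))$ for $u\in X$, $t\in[0,+\infty)$, $x\in\Omega$. Suppose that one of the following Landesman--Lazer type conditions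 is satisfied: either $$\int_0^T\!\!\int_{\{u>0\}}f_+(t,x)u(x)\,dx\,dt+\int_0^T\!\!\int_{\{u<0\}}f_-(t,x)u(x)\,dx\,dt>0\quad\text{for any }u\in N_\lambda\text{ with }\|u\|=1,$$ or $$\int_0^T\!\!\int_{\{u>0\}}f_+(t,x)u(x)\,dx\,dt+\int_0^T\!\!\int_{\{u<0\}}f_-(t,x)u(x)\,dx\,dt<0\quad\text{for any }u\in N_\lambda\text{ with }\|u\|=1.$$ Then the problem $$\dot u(t)=-Au(t)+\lambda u(t)+F(t,u(t)),\ t>0,\qquad u(t)=u(t+T),\ t\ge0,$$ admits a $T$-periodic mild solution.
   Context: A $C_0$ semigroup $\{S(t)\}_{t\ge0}$ on $X$ is compact if $S(t)B$ is relatively compact for every bounded $B\subset X$ and $t>0$. $A^*$ is the Hilbert space adjoint of $A$. $\{u>0\}:=\{x\in\Omega\mid u(x)>0\}$ and $\{u<0\}:=\{x\in\Omega\mid u(x)<0\}$. A mild solution of $\dot u(t)=-Au(t)+\lambda u(t)+F(t,u(t))$ is a continuous $u\colon[0,+\infty)\to X$ with $u(t)=e^{\lambda t}S_A(t)u(0)+\int_0^te^{\lambda(t-s)}S_A(t-s)F(s,u(s))\,ds$ for $t\ge0$; it is $T$-periodic if $u(t)=u(t+T)$ for all $t\ge0$. *)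

(* Defs.v *)
From HB Require Import structures.
From mathcomp Require Import all_boot all_order all_algebra.
From mathcomp Require Import all_classical all_reals all_analysis.
From mathcomp Require Import measurable_realfun ess_sup_inf.

Set Implicit Arguments.
Unset Strict Implicit.
Unset Printing Implicit Defensive.

Import Order.TTheory GRing.Theory Num.Theory.
Import numFieldNormedType.Exports.

Local Open Scope classical_set_scope.
Local Open Scope ring_scope.

(* LspaceType mu p1 (almost everywhere classes of functions with finite p-norm)
   has no algebraic structure in MathComp-Analysis; the operations below are the
   classes of the pointwise operations on representatives, and the norm is the
   L^p norm. *)
Section Lspace_class.
Context d (T : measurableType d) (R : realType).
Variables (mu : {measure set T -> \bar R}) (p : \bar R) (p1 : (1 <= p)%E).
Local Notation ty := (LspaceType mu p1).
Local Notation funty := (LfunType mu p1).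

Lemma ae_eq_Lnorm (f g : T -> R) :
  measurable_fun setT f -> measurable_fun setT g -> f = g %[ae mu] ->
  'N[mu]_p[EFin \o f]%E = 'N[mu]_p[EFin \o g]%E.
Proof.
move=> mf mg fg; rewrite unlock; case: p p1 => [r r1| |//].
  congr (_ `^ _)%E; apply: ae_eq_integral => //.
  - apply/measurable_EFinP.
    apply: (measurableT_comp (measurable_powR _)) => //.
    exact: measurableT_comp.
  - apply/measurable_EFinP.
    apply: (measurableT_comp (measurable_powR _)) => //.
    exact: measurableT_comp.
  - by apply: filterS fg => x /= h /h ->.
move=> _; case: ifP => // _; apply: eq_ess_sup.
by apply: filterS fg => x /= ->.
Qed.

Lemma Lspace_eqP (f g : ty) : f = g <-> (f : T -> R) = g %[ae mu].
Proof.
split=> [->|fg]; first exact: ae_eq_refl.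
case: f g fg => [f [[cf]]] [g [[cg]]] fg.
have e : f = g.
  by rewrite -[f]reprK -[g]reprK; apply/eqP; rewrite eqmodE; exact/asboolP.
by move: cf cg fg; rewrite e => cf cg _; congr (LebesgueSpace.Pack _);
  congr (LebesgueSpace.Class _); congr (isFinLebesgue.Axioms_ _ _ _ _ _ _ _);
  exact: Prop_irrelevance.
Qed.

Lemma mfun_repr_pi (f : {mfun T >-> measurableTypeR R}) :
  (repr (\pi_({mfun_ mu, T >-> measurableTypeR R})%qT f) : T -> R)
  = f %[ae mu].
Proof.
set q := \pi_(_)%qT f.
have /eqP : (\pi_({mfun_ mu, T >-> measurableTypeR R}) (repr q) = q)%qT.
  exact: reprK.
by rewrite eqmodE => /asboolP. Qed.

Definition mfun_of_Lfun (f : funty) : {mfun T >-> measurableTypeR R} :=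
  MeasurableFun.Pack (MeasurableFun.Class
    (isMeasurableFun.Build _ _ T (measurableTypeR R)
       (f : T -> measurableTypeR R) (measurable_funP f))).

Definition mfun_class (f : funty) : {mfun_ mu, T >-> measurableTypeR R} :=
  (\pi_({mfun_ mu, T >-> measurableTypeR R}) (mfun_of_Lfun f))%qT.

Lemma Lclass_subproof (f : funty) : finite_norm mu p (mfun_class f).
Proof.
rewrite /finite_norm (@ae_eq_Lnorm _ f) //.
- exact: Lfunction_finite.
- exact: (measurable_funP (repr (mfun_class f))).
- exact: (mfun_repr_pi (mfun_of_Lfun f)).
Qed.

Definition Lclass (f : funty) : ty :=
  LebesgueSpace.Pack (LebesgueSpace.Class
    (@isFinLebesgue.Axioms_ _ _ _ _ _ p1 _ (Lclass_subproof f))).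

Lemma LclassE (f : funty) : (Lclass f : T -> R) = f %[ae mu].
Proof. exact: (mfun_repr_pi (mfun_of_Lfun f)). Qed.

Lemma Lspace_Lfun_subproof (f : ty) : (f : T -> R) \in Lfun mu p.
Proof.
rewrite inE; apply/andP; split; rewrite inE.
  exact: (@measurable_funP _ _ _ _ _ (repr (LebesgueSpace.sort f))).
exact: Lebesgue_finite.
Qed.

Definition Lrepr (f : ty) : funty := Lfun_Sub p1 (Lspace_Lfun_subproof f).

End Lspace_class.

Section Lspace_normedModType.
Context d (T : measurableType d) (R : realType).
Variables (mu : {measure set T -> \bar R}) (p : \bar R) (p1 : (1 <= p)%E).
Local Notation ty := (LspaceType mu p1).

HB.instance Definition _ := gen_eqMixin ty.
HB.instance Definition _ := gen_choiceMixin ty.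

Definition Lspace_zero : ty := Lclass 0.
Definition Lspace_add (f g : ty) : ty := Lclass (Lrepr f + Lrepr g).
Definition Lspace_opp (f : ty) : ty := Lclass (- Lrepr f).
Definition Lspace_scale (a : R) (f : ty) : ty := Lclass (a *: Lrepr f).
Definition Lspace_norm (f : ty) : R := fine ('N[mu]_p[EFin \o f]%E).

Lemma Lspace_addE (f g : ty) :
  (Lspace_add f g : T -> R) = (fun x => f x + g x) %[ae mu].
Proof. exact: LclassE. Qed.

Lemma Lspace_oppE (f : ty) :
  (Lspace_opp f : T -> R) = (fun x => - f x) %[ae mu].
Proof. exact: LclassE. Qed.

Lemma Lspace_scaleE a (f : ty) :
  (Lspace_scale a f : T -> R) = (fun x => a * f x) %[ae mu].
Proof. exact: LclassE. Qed.

Lemma Lspace_zeroE : (Lspace_zero : T -> R) = (fun=> 0) %[ae mu].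
Proof. exact: LclassE. Qed.

Lemma Lspace_addrA : associative Lspace_add.
Proof.
move=> f g h; apply/Lspace_eqP.
apply: filterS (filterI (filterI (Lspace_addE f (Lspace_add g h))
  (Lspace_addE g h)) (filterI (Lspace_addE (Lspace_add f g) h)
  (Lspace_addE f g))) => x /= [[e1 e2] [e3 e4]] _.
by rewrite e1// e2// e3// e4// addrA.
Qed.

Lemma Lspace_addrC : commutative Lspace_add.
Proof.
move=> f g; apply/Lspace_eqP.
apply: filterS2 (Lspace_addE f g) (Lspace_addE g f) => x e1 e2 _.
by rewrite e1// e2// addrC.
Qed.

Lemma Lspace_add0r : left_id Lspace_zero Lspace_add.
Proof.
move=> f; apply/Lspace_eqP.
apply: filterS2 (Lspace_addE Lspace_zero f) Lspace_zeroE => x e1 e2 _.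
by rewrite e1// e2// add0r.
Qed.

Lemma Lspace_addNr : left_inverse Lspace_zero Lspace_opp Lspace_add.
Proof.
move=> f; apply/Lspace_eqP.
apply: filterS3 (Lspace_addE (Lspace_opp f) f) (Lspace_oppE f) Lspace_zeroE.
by move=> x e1 e2 e3 _; rewrite e1// e2// e3// addNr.
Qed.

HB.instance Definition _ := GRing.isZmodule.Build ty
  Lspace_addrA Lspace_addrC Lspace_add0r Lspace_addNr.

Lemma Lspace_scalerA a b (f : ty) :
  Lspace_scale a (Lspace_scale b f) = Lspace_scale (a * b) f.
Proof.
apply/Lspace_eqP.
apply: filterS3 (Lspace_scaleE a (Lspace_scale b f)) (Lspace_scaleE b f)
  (Lspace_scaleE (a * b) f).
by move=> x e1 e2 e3 _; rewrite e1// e2// e3// mulrA.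
Qed.

Lemma Lspace_scale1r : left_id 1 Lspace_scale.
Proof.
move=> f; apply/Lspace_eqP.
by apply: filterS (Lspace_scaleE 1 f) => x e1 _; rewrite e1// mul1r.
Qed.

Lemma Lspace_scalerDr : right_distributive Lspace_scale +%R.
Proof.
move=> a f g; apply/Lspace_eqP.
apply: filterS (filterI (filterI (Lspace_scaleE a (f + g))
  (Lspace_addE f g)) (filterI (Lspace_addE (Lspace_scale a f)
  (Lspace_scale a g)) (filterI (Lspace_scaleE a f) (Lspace_scaleE a g)))).
move=> x /= [[e1 e2] [e3 [e4 e5]]] _.
by rewrite e1// e2// e3// e4// e5// mulrDr.
Qed.

Lemma Lspace_scalerDl (f : ty) :
  {morph Lspace_scale^~ f : a b / a + b}.
Proof.
move=> a b; apply/Lspace_eqP.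
apply: filterS (filterI (Lspace_scaleE (a + b) f)
  (filterI (Lspace_addE (Lspace_scale a f) (Lspace_scale b f))
  (filterI (Lspace_scaleE a f) (Lspace_scaleE b f)))).
move=> x /= [e1 [e2 [e3 e4]]] _.
by rewrite e1// e2// e3// e4// mulrDl.
Qed.

HB.instance Definition _ := GRing.Zmodule_isLmodule.Build R ty
  Lspace_scalerA Lspace_scale1r Lspace_scalerDr Lspace_scalerDl.

Lemma Lspace_normE (f : ty) (g : T -> R) :
  measurable_fun setT g -> (f : T -> R) = g %[ae mu] ->
  Lspace_norm f = fine ('N[mu]_p[EFin \o g]%E).
Proof.
move=> mg fg; congr fine; apply: ae_eq_Lnorm => //.
exact: (measurable_funP (Lrepr f)).
Qed.

Lemma Lspace_ler_normD (f g : ty) :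
  Lspace_norm (f + g) <= Lspace_norm f + Lspace_norm g.
Proof.
rewrite (Lspace_normE _ (Lspace_addE f g)).
  exact: (ler_LnormD (Lrepr f) (Lrepr g)).
exact: (measurable_funP (Lrepr f + Lrepr g)).
Qed.

Lemma Lspace_normrZ (a : R) (f : ty) :
  Lspace_norm (a *: f) = `|a| * Lspace_norm f.
Proof.
rewrite (Lspace_normE _ (Lspace_scaleE a f)).
  apply: EFin_inj; rewrite EFinM.
  rewrite (finite_norm_fine (Lrepr f)) -(LnormZ (Lrepr f)).
  exact: (finite_norm_fine (a *: Lrepr f)).
exact: (measurable_funP (a *: Lrepr f)).
Qed.

Lemma Lspace_normr0_eq0 (f : ty) : Lspace_norm f = 0 -> f = 0.
Proof.
move=> /(@fine_Lnormr_eq0 _ _ _ _ _ p1 (Lrepr f)) f0; apply/Lspace_eqP.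
apply: filterS2 f0 Lspace_zeroE => x e1 e2 _.
by rewrite [RHS]e2//; exact: e1.
Qed.

HB.instance Definition _ := Lmodule_isNormed.Build R ty
  Lspace_ler_normD Lspace_normrZ Lspace_normr0_eq0.

End Lspace_normedModType.


Section lebesgue_tuple.
Variable R : realType.
Local Notation T1 := (measurableTypeR R).
Local Open Scope ereal_scope.

Definition tcons n (x : T1 * n.-tuple T1) : n.+1.-tuple T1 :=
  [tuple of x.1 :: x.2].

Definition tuncons n (t : n.+1.-tuple T1) : T1 * n.-tuple T1 :=
  (tnth t ord0, [tuple of behead t]).

Lemma tconsK n : cancel (@tcons n) (@tuncons n).
Proof. by case=> x t; congr pair; exact/val_inj. Qed.

Lemma measurable_tcons n : measurable_fun setT (@tcons n).
Proof. exact: measurable_cons. Qed.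

Lemma measurable_tuncons n : measurable_fun setT (@tuncons n).
Proof.
apply: measurable_fun_pair; first exact: measurable_tnth.
exact: measurable_behead.
Qed.

Section cons.
Variables (n : nat) (m : {sigma_finite_measure set (n.-tuple T1) -> \bar R}).

Definition lebesgue_cons : set (n.+1.-tuple T1) -> \bar R :=
  pushforward (@lebesgue_measure R \x m) (@tcons n).

Let P : {measure set (n.+1.-tuple T1) -> \bar R} :=
  measure_function_pushforward__canonical__measure_function_Measure
    (@lebesgue_measure R \x m) (@measurable_tcons n).

HB.instance Definition _ := isMeasure.Build _ _ _ lebesgue_cons
  (measure0 P) (measure_ge0 P) (@measure_semi_sigma_additive _ _ _ P).

Let lebesgue_cons_sigma_finite : sigma_finite setT lebesgue_cons.
Proof.
have /sigma_finiteP[F [TF ndF Foo]] := sigma_finiteT (@lebesgue_measure R).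
have /sigma_finiteP[G [TG ndG Goo]] := sigma_finiteT m.
exists (fun k => @tuncons n @^-1` (F k `*` G k)) => [|k].
  apply/seteqP; split=> // t _.
  have : (\bigcup_i F i) (tuncons t).1 by rewrite -TF.
  have : (\bigcup_i G i) (tuncons t).2 by rewrite -TG.
  move=> [j _ Gj] [i _ Fi]; exists (maxn i j) => //; split.
    by move: Fi; exact/subsetPset/ndF/leq_maxl.
  by move: Gj; exact/subsetPset/ndG/leq_maxr.
have [mF Fk] := Foo k; have [mG Gk] := Goo k; split.
  rewrite -[X in measurable X]setTI; apply: measurable_tuncons => //.
  exact: measurableX.
rewrite /lebesgue_cons /pushforward -comp_preimage.
rewrite (_ : _ \o _ = id); last by apply/funext => x; exact: tconsK.
by rewrite preimage_id product_measure1E// lte_mul_pinfty// ge0_fin_numE.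
Qed.

HB.instance Definition _ := Measure_isSigmaFinite.Build _ _ _ lebesgue_cons
  lebesgue_cons_sigma_finite.

End cons.

(* The n-fold product of the Lebesgue measure on R, see [lebesgue_tuple_box]. *)
Fixpoint lebesgue_tuple n :
    {sigma_finite_measure set (n.-tuple T1) -> \bar R} :=
  match n with
  | 0 => dirac [tuple]
  | k.+1 => lebesgue_cons (lebesgue_tuple k)
  end.

Lemma lebesgue_tuple_box n (A : 'I_n -> set T1) :
  (forall i, measurable (A i)) ->
  lebesgue_tuple n [set t | forall i, A i (tnth t i)] =
  \prod_(i < n) lebesgue_measure (A i).
Proof.
elim: n A => [|n IH] A mA.
  rewrite big_ord0 /= /dirac indicE (_ : _ \in _)//.
  by apply/mem_set; case.
rewrite big_ord_recl -IH; last by move=> i; exact: mA.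
rewrite /= /lebesgue_cons /pushforward -product_measure1E//; last first.
  rewrite (_ : [set t | _] = \bigcap_(i in [set: 'I_n])
    ((fun t : n.-tuple T1 => tnth t i) @^-1` A (lift ord0 i))); last first.
    by apply/seteqP; split => t /= h i => [_|]; exact: h.
  apply: fin_bigcap_measurable; first exact: finite_finset.
  by move=> i _; rewrite -[X in measurable X]setTI; exact: measurable_tnth.
congr (_ \x _); apply/seteqP; split => [[x t] /= h|[x t] /= [h0 h] i].
  split; first exact: (h ord0).
  by move=> i; have := h (lift ord0 i); rewrite tnthS.
by case: (unliftP ord0 i) => [j ->|->]; rewrite ?tnthS//=; exact: h.
Qed.

End lebesgue_tuple.

Section lebesgue_rV.
Variables (R : realType) (n : nat).
Local Notation T1 := (measurableTypeR R).

Definition borel_rV := g_sigma_algebraType (@open 'rV[R]_n).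

Definition rV_of_tuple (t : n.-tuple T1) : borel_rV := \row_i tnth t i.

Lemma measurable_rV_of_tuple : measurable_fun setT rV_of_tuple.
Proof.
apply: (@measurability _ _ _ borel_rV setT rV_of_tuple (@open 'rV[R]_n)) => //.
move=> _ [U oU <-]; rewrite setTI.
pose box (c : n.-tuple rat * nat) : set 'rV[R]_n :=
  [set x | forall i, `|x ord0 i - ratr (tnth c.1 i)| < c.2.+1%:R^-1].
pose B c := if `[< box c `<=` U >] then box c else set0.
have -> : rV_of_tuple @^-1` U = \bigcup_c (rV_of_tuple @^-1` B c).
  apply/seteqP; split => [t Ut|t [c _]]; last first.
    by rewrite /B; case: ifPn => // /asboolP; exact.
  have /nbhs_ballP[e /= e0 eU] : nbhs (rV_of_tuple t : 'rV[R]_n) U.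
    exact: open_nbhs_nbhs.
  have [k _ ke] : \forall k \near \oo, (k.+1%:R^-1 < e / 2).
    have e2 : 0 < e / 2 by rewrite divr_gt0.
    exact: (near_infty_natSinv_lt (PosNum e2)).
  have {}ke : k.+1%:R^-1 < e / 2 by apply: ke => /=.
  have /choice[q qt] : forall i : 'I_n, exists q : rat,
      `|tnth t i - ratr q| < k.+1%:R^-1.
    move=> i; have : tnth t i - k.+1%:R^-1 < tnth t i + k.+1%:R^-1.
      by rewrite ltrBlDr -addrA ltrDl addr_gt0 ?invr_gt0.
    move=> /rat_in_itvoo[q]; rewrite in_itv/= => /andP[q1 q2]; exists q.
    by rewrite distrC ltr_distl q1 q2.
  exists ([tuple q i | i < n], k) => //; rewrite /B asboolT /=.
    by move=> i; rewrite mxE tnth_mktuple.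
  move=> x /= xq; apply: eU; split=> // i j; rewrite ord1 mxE /ball /=.
  rewrite (splitr e) -(subrK (ratr (q j)) (tnth t j)) -addrA.
  rewrite (le_lt_trans (ler_normD _ _))// ltrD ?(lt_trans (qt _))//.
  by rewrite distrC (lt_trans _ ke)//; have := xq j; rewrite tnth_mktuple.
apply: countable_bigcupT_measurable => // c.
rewrite /B; case: ifPn => _; last by rewrite preimage_set0.
rewrite (_ : _ @^-1` _ = \bigcap_(i in [set: 'I_n])
  ((fun t : n.-tuple T1 => tnth t i) @^-1`
     ball (ratr (tnth c.1 i) : R) c.2.+1%:R^-1)); last first.
  apply/seteqP; split => t /= h i => [_|].
    by have := h i; rewrite mxE distrC.
  by rewrite mxE distrC; exact: h.
apply: fin_bigcap_measurable; first exact: finite_finset.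
move=> i _; rewrite -[X in measurable X]setTI; apply: measurable_tnth => //.
exact: measurable_ball.
Qed.

(* Lebesgue measure on the Borel sets of R^n. *)
Definition lebesgue_measure_rV : set borel_rV -> \bar R :=
  pushforward (lebesgue_tuple R n) rV_of_tuple.

Let P : {measure set borel_rV -> \bar R} :=
  measure_function_pushforward__canonical__measure_function_Measure
    (lebesgue_tuple R n) measurable_rV_of_tuple.

HB.instance Definition _ := isMeasure.Build _ _ _ lebesgue_measure_rV
  (measure0 P) (measure_ge0 P) (@measure_semi_sigma_additive _ _ _ P).

Lemma lebesgue_measure_rV_box (A : 'I_n -> set T1) :
  (forall i, measurable (A i)) ->
  (lebesgue_measure_rV [set x : 'rV[R]_n | forall i, A i (x ord0 i)] =
   \prod_(i < n) lebesgue_measure (A i))%E.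
Proof.
move=> mA; rewrite -lebesgue_tuple_box//; congr (lebesgue_tuple R n _).
by apply/seteqP; split => t /= h i; have := h i; rewrite mxE.
Qed.

Lemma open_measurable_rV (U : set 'rV[R]_n) : open U ->
  measurable (U : set borel_rV).
Proof. exact: sub_sigma_algebra. Qed.

End lebesgue_rV.

Section unbounded_operators.
Variables (R : realType) (X : normedModType R).

(* A partially defined operator: only the values on its domain matter, so every
   definition below restricts them to [dom]. *)
Record operator := Operator { dom : set X ; op_fun :> X -> X }.

Definition linear_operator (A : operator) :=
  dom A 0 /\ forall (a : R) x y, dom A x -> dom A y ->
    dom A (a *: x + y) /\ A (a *: x + y) = a *: A x + A y.

Definition total_op (g : X -> X) : operator := Operator setT g.

Definition scalar_op (a : R) : operator := total_op (fun x => a *: x).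

Definition opp_op (A : operator) : operator :=
  Operator (dom A) (fun x => - A x).

Definition sub_op (A B : operator) : operator :=
  Operator (dom A `&` dom B) (fun x => A x - B x).

Definition ker (A : operator) : set X := [set x | dom A x /\ A x = 0].

Definition eigenvalue_op (A : operator) (lambda : R) :=
  exists2 x, x != 0 & ker (sub_op A (scalar_op lambda)) x.

(* [S] is only constrained at nonnegative times. *)
Definition C0_semigroup (S : R -> X -> X) :=
  [/\ forall t, 0 <= t ->
        linear (S t) /\ exists C, forall x, `|S t x| <= C * `|x|,
      forall x, S 0 x = x,
      forall s t x, 0 <= s -> 0 <= t -> S (s + t) x = S s (S t x)
    & forall x, S h x @[h --> 0^'+] --> x].

Definition compact_semigroup (S : R -> X -> X) :=
  forall (B : set X) t, bounded_set B -> 0 < t -> precompact (S t @` B).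

Definition generator (S : R -> X -> X) : operator :=
  Operator [set x | cvg (h^-1 *: (S h x - x) @[h --> 0^'+])]
           (fun x => lim (h^-1 *: (S h x - x) @[h --> 0^'+])).

Definition generates (B : operator) (S : R -> X -> X) :=
  dom B = dom (generator S) /\ forall x, dom B x -> B x = generator S x.

End unbounded_operators.
Arguments scalar_op {R X} a.

Section bochner_integral.
Context d (T : measurableType d) (R : realType) (X : normedModType R).
Variable mu : {measure set T -> \bar R}.

Record simple := Simple {
  simple_size : nat ;
  simple_set : 'I_simple_size -> set T ;
  simple_vec : 'I_simple_size -> X }.

Definition simple_fun (s : simple) (x : T) : X :=
  \sum_(i < simple_size s) \1_(simple_set i) x *: simple_vec i.

Definition integrable_simple (D : set T) (s : simple) :=
  forall i, measurable (@simple_set s i) /\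
    (mu (D `&` @simple_set s i) < +oo)%E.

Definition integral_simple (D : set T) (s : simple) : X :=
  \sum_(i < simple_size s) fine (mu (D `&` simple_set i)) *: simple_vec i.

(* [g] is Bochner integrable over [D], with integral [v]. *)
Definition has_bochner_integral (D : set T) (g : T -> X) (v : X) :=
  exists s : nat -> simple,
    [/\ forall k, integrable_simple D (s k),
        \forall x \ae mu, D x -> simple_fun (s k) x @[k --> \oo] --> g x,
        (\int[mu]_(x in D) `|g x - simple_fun (s k) x|%:E)%E
          @[k --> \oo] --> 0%E
      & integral_simple D (s k) @[k --> \oo] --> v].

End bochner_integral.

Section L2.
Context d (T : measurableType d) (R : realType).
Variable mu : {measure set T -> \bar R}.
Local Notation L2 := (LspaceType2 mu).

Definition inner (u v : L2) : R := \int[mu]_x (u x * v x).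

(* The adjoint is single-valued when [dom A] is dense, which holds for the
   generator of a C0 semigroup; otherwise the choice of [w] is arbitrary. *)
Definition is_adjoint_at (A : operator L2) (v w : L2) :=
  forall u, dom A u -> inner (A u) v = inner u w.

Definition adjoint (A : operator L2) : operator L2 :=
  Operator [set v | exists w, is_adjoint_at A v w]
           (fun v => xget 0 [set w | is_adjoint_at A v w]).

(* The class of a function which is a.e. equal to a square integrable one. *)
Definition L2_of (g : T -> R) : L2 :=
  xget 0 [set v : L2 | (v : T -> R) = g %[ae mu]].

Lemma L2_ofE (g : T -> R) (v : L2) :
  (v : T -> R) = g %[ae mu] -> L2_of g = v.
Proof.
move=> vg; apply/Lspace_eqP.
have /(xgetPex 0) : exists w : L2, (w : T -> R) = g %[ae mu] by exists v.
rewrite -/(L2_of g) => wg; apply: filterS2 wg vg => x /= wg vg _.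
by rewrite wg// vg.
Qed.

End L2.

Section Omega.
Variables (R : realType) (n : nat) (Omega : set 'rV[R]_n) (oOmega : open Omega).

(* L^2(Omega) is realized as classes of functions on R^n modulo equality almost
   everywhere on Omega: the measure vanishes outside of Omega. *)
Definition lebesgue_on : {measure set (borel_rV R n) -> \bar R} :=
  mrestr (@lebesgue_measure_rV R n) (open_measurable_rV oOmega).

Definition L2_on := LspaceType2 lebesgue_on.

Definition nemytskii (f : R -> 'rV[R]_n -> R -> R) (t : R) (u : L2_on) :
    L2_on :=
  L2_of lebesgue_on (fun x => f t x (u x)).

Definition landesman_lazer_integral (T : R) (fp fm : R -> 'rV[R]_n -> R)
    (u : L2_on) : R :=
  \int[@lebesgue_measure R]_(t in `[0, T])
    \int[@lebesgue_measure_rV R n]_(x in Omega `&` [set x | 0 < u x])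
      (fp t x * u x) +
  \int[@lebesgue_measure R]_(t in `[0, T])
    \int[@lebesgue_measure_rV R n]_(x in Omega `&` [set x | u x < 0])
      (fm t x * u x).

End Omega.

Section mild_solution.
Variables (R : realType) (X : normedModType R).

(* Mild solutions on [0, +oo[ of u' = - A u + lambda u + F(t, u), where S is the
   semigroup generated by - A. *)
Definition mild_solution (S : R -> X -> X) (lambda : R) (F : R -> X -> X)
    (u : R -> X) :=
  {within `[0, +oo[, continuous u} /\
  forall t, 0 <= t -> exists2 v,
    has_bochner_integral (@lebesgue_measure R) `[0, t]
      (fun s => expR (lambda * (t - s)) *: S (t - s) (F s (u s))) v &
    u t = expR (lambda * t) *: S t (u 0) + v.

End mild_solution.

(* Main.v *)
(** Put K(t) = e^(lambda t) S(t). A mild solution u is T-periodic iff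
    (I - K(T)) u(0) = int_0^T K(T - s) F(s, u(s)) ds. By (A3), the kernel N of I - K(T) is
    orthogonal to its range, and K(t) is the identity on N and preserves the orthogonal
    complement of N, on which I - K(T) is invertible since K(T) is compact. Hence periodic
    solutions are fixed points of a Lyapunov-Schmidt map on continuous paths, whose
    N-component is v - sigma eps Q int_0^T F(s, u(s)) ds, where Q is the orthogonal
    projection on N, v = Q u(0), and sigma = 1 or -1 is the sign in the Landesman-Lazer
    condition. This condition bounds sigma int_0^T <F(s, u(s)), v> ds from below by
    delta |v| for large v when u stays at bounded distance from v, so that for small eps
    the map preserves a bounded convex set, and Schauder's theorem applies. The latter is
    obtained from Sperner's lemma, proved by algebraic barycentric subdivision modulo 2. *)

From HB Require Import structures.
From mathcomp Require Import finmap.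
Require Import Defs.
From mathcomp Require Import all_boot all_order all_algebra.
From mathcomp Require Import all_classical all_reals all_analysis.
From mathcomp Require Import measurable_realfun lra ring.
Set Implicit Arguments.
Unset Strict Implicit.
Unset Printing Implicit Defensive.
Import Order.TTheory GRing.Theory Num.Theory.
Import numFieldNormedType.Exports.
Local Open Scope classical_set_scope.
Local Open Scope ring_scope.

(** * Sperner's lemma and approximate fixed points *)

(** The obstacle is the resonant part: with b = int_0^T K(T - s) F(s, u(s)) ds, the equation (I -
    K(T)) w = b is solvable only if Q b = 0, which fails along general paths. The map therefore
    solves it for b - Q b. At a fixed point the equation for the N-component forces Q int_0^T F(s,
    u(s)) ds = 0; since K(t) does not change pairings with N, this gives Q b = 0, so the correction
    disappears and u(T) = u(0). The Landesman-Lazer functional is about pointwise limits of f at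
    infinity, while paths are controlled only in norm. Rescaled sequences are therefore made to
    converge at the rate 4^-k, which is fast enough for almost everywhere convergence and hence for
    pointwise divergence where the limit is nonzero. K(t) is compact only for t > 0, so compactness
    of an integral up to t is obtained by stopping shortly before t. *)

Lemma odd_count_perm_iota q (l : seq nat) : all (fun x => x <= q)%N l ->
  odd (count (fun x => perm_eq l (x :: iota 0 q)) l) = perm_eq l (iota 0 q.+1).
Proof.
move=> lq.
have iotaS : perm_eq (iota 0 q.+1) (q :: iota 0 q).
  by rewrite -addn1 iotaD /= add0n cats1 perm_rcons.
have [[x0 x0l lx0]|nox] := pselect (exists2 x, x \in l & perm_eq l (x :: iota 0 q)).
  (* The qualifying entries are the occurrences of [x0]: one if [x0 = q], two if [x0 < q], because
     [x0] then also occurs in [iota 0 q]. *)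
  have -> : count (fun x => perm_eq l (x :: iota 0 q)) l = count_mem x0 l.
    apply: eq_count => x /=; rewrite (permPl lx0); apply/idP/eqP => [h|->//].
    have /permP/(_ (pred1 x)) := h; rewrite /= eqxx => /eqP.
    by rewrite eqn_add2r; case: (x0 =P x).
  rewrite (permP lx0) /= eqxx (permPl lx0) (permPr iotaS).
  have x0q : (x0 <= q)%N by exact: (allP lq).
  rewrite count_uniq_mem ?iota_uniq// mem_iota /= !add0n.
  rewrite ?add0n; case: ltngtP x0q => // [x0q|->] _.
    apply/esym/negP => /permP/(_ (pred1 x0)) /eqP.
    by rewrite /= eqxx eqn_add2r (gtn_eqF x0q).
  by rewrite perm_refl.
rewrite (@eq_in_count _ _ pred0) ?count_pred0 => [/=|x xl]; last first.
  by apply/negP => h; apply: nox; exists x.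
apply/esym/negP => h; apply: nox; have {}h : perm_eq l (q :: iota 0 q).
  exact: perm_trans h iotaS.
by exists q; rewrite ?(perm_mem h) ?mem_head.
Qed.

(** * Barycentric subdivision on cochains modulo 2 *)

Section subdivision.
Variables (P : Type) (b : seq P -> P).
Implicit Types (s t : seq P) (psi chi : seq P -> bool).

(* The mod 2 coboundary: the parity of the number of positions whose deletion
   from [s] yields a list satisfying [psi]. *)
Fixpoint coboundary psi s : bool :=
  if s is x :: t then psi t (+) coboundary (fun u => psi (x :: u)) t else false.

(* Pullback of [psi] along barycentric subdivision: the simplices subdividing a
   face flag start with the barycenter of [s] and go on inside a facet. *)
Fixpoint subdiv_rec n psi s : bool :=
  if n is m.+1 then coboundary (subdiv_rec m (fun t => psi (b s :: t))) s
  else psi [::].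

Definition subdiv psi s := subdiv_rec (size s) psi s.

Lemma coboundary_eq psi chi s :
  (forall s1 x s2, s = s1 ++ x :: s2 -> psi (s1 ++ s2) = chi (s1 ++ s2)) ->
  coboundary psi s = coboundary chi s.
Proof.
elim: s psi chi => //= x t IH psi chi h.
rewrite (h [::] x t erefl); congr addb; apply: IH => s1 y s2 e.
by apply: (h (x :: s1) y s2); rewrite e.
Qed.

Lemma coboundary_false psi s :
  (forall s1 x s2, s = s1 ++ x :: s2 -> psi (s1 ++ s2) = false) ->
  coboundary psi s = false.
Proof.
move=> h; rewrite (@coboundary_eq _ (fun=> false)) //.
by elim: s {h} => //= x t ->.
Qed.

Lemma coboundaryD psi chi s :
  coboundary (fun t => psi t (+) chi t) s = coboundary psi s (+) coboundary chi s.
Proof. by elim: s psi chi => //= x t IH psi chi; rewrite IH addbACA. Qed.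

Lemma coboundaryK psi s : coboundary (coboundary psi) s = false.
Proof.
elim: s psi => //= x t IH psi.
by rewrite coboundaryD IH addbF addbb.
Qed.

Lemma coboundary_rcons psi s x : coboundary psi (rcons s x) =
  coboundary (fun t => psi (rcons t x)) s (+) psi s.
Proof. by elim: s psi => [|y s IH] psi /=; rewrite ?addbF// IH addbA. Qed.

Lemma subdiv_recD n psi chi s :
  subdiv_rec n (fun t => psi t (+) chi t) s =
  subdiv_rec n psi s (+) subdiv_rec n chi s.
Proof.
elim: n psi chi s => //= n IH psi chi s.
rewrite -coboundaryD; apply: coboundary_eq => s1 x s2 _; exact: IH.
Qed.

(** Dual of the cone formula: deleting the barycenter from [b s :: t] leaves [t], which gives the
    right-hand side; deletions inside [t] give, by induction, a coboundary of a coboundary. *)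
Lemma subdiv_rec_coboundary n psi s : size s = n ->
  subdiv_rec n (coboundary psi) s = coboundary (subdiv_rec n.-1 psi) s.
Proof.
elim: n psi s => [|n IH] psi s; first by case: s.
move=> sn /=.
transitivity (coboundary (subdiv_rec n psi) s (+)
    coboundary (coboundary (subdiv_rec n.-1 (fun t => psi (b s :: t)))) s).
  rewrite -coboundaryD; apply: coboundary_eq => s1 x s2 e.
  rewrite subdiv_recD; congr addb; apply: IH.
  by move: sn; rewrite e !size_cat /= addnS => -[].
by rewrite coboundaryK addbF.
Qed.

Lemma subdiv_coboundary psi s :
  subdiv (coboundary psi) s = coboundary (subdiv psi) s.
Proof.
rewrite /subdiv subdiv_rec_coboundary//; apply: coboundary_eq => s1 x s2 e.
by congr subdiv_rec; rewrite e !size_cat /= addnS.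
Qed.

Lemma iter_subdiv_coboundary N psi s :
  iter N subdiv (coboundary psi) s = coboundary (iter N subdiv psi) s.
Proof.
elim: N s => //= N IH s; rewrite -subdiv_coboundary.
by congr subdiv; apply/funext => t; exact: IH.
Qed.

(** A weak form of convexity, sufficient because every vertex created by subdivision is a barycenter
    of earlier ones. *)
Definition bary_closed (Q : P -> Prop) :=
  forall s, s <> [::] -> List.Forall Q s -> Q (b s).

Lemma Forall_cat (Q : P -> Prop) s t :
  List.Forall Q (s ++ t) <-> List.Forall Q s /\ List.Forall Q t.
Proof. exact: List.Forall_app. Qed.

Lemma Forall_del (Q : P -> Prop) s1 x s2 :
  List.Forall Q (s1 ++ x :: s2) -> List.Forall Q (s1 ++ s2).
Proof.
by move=> /Forall_cat[h1 h2]; apply/Forall_cat; split=> //; inversion h2.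
Qed.

(** Carrier argument: subdividing points of [Q] creates only points of [Q], so the parity sees [psi]
    on such lists only. *)
Lemma subdiv_rec_eq (Q : P -> Prop) n psi chi s : bary_closed Q ->
  size s = n -> List.Forall Q s ->
  (forall t, size t = n -> List.Forall Q t -> psi t = chi t) ->
  subdiv_rec n psi s = subdiv_rec n chi s.
Proof.
move=> Qb; elim: n psi chi s => [|n IH] psi chi s sn Qs h /=; first exact: h.
apply: coboundary_eq => s1 x s2 e; apply: IH.
- by move: sn; rewrite e !size_cat /= addnS => -[].
- by apply: (@Forall_del _ _ x); rewrite -e.
- move=> t tn Qt; apply: h; first by rewrite /= tn.
  by constructor => //; apply: Qb => //; case: (s) sn.
Qed.

Lemma iter_subdiv_eq (Q : P -> Prop) N psi chi s : bary_closed Q ->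
  List.Forall Q s ->
  (forall t, size t = size s -> List.Forall Q t -> psi t = chi t) ->
  iter N subdiv psi s = iter N subdiv chi s.
Proof.
move=> Qb; elim: N s => [|N IH] s Qs h /=; first exact: h.
apply: (@subdiv_rec_eq Q) => // t tn Qt; apply: IH => // u un Qu.
by apply: h => //; rewrite un.
Qed.

Lemma iter_subdiv_false N s : iter N subdiv (fun=> false) s = false.
Proof.
elim: N s => //= N IH s; rewrite /subdiv.
have -> : iter N subdiv (fun=> false) = fun=> false by exact/funext.
by move: (size s) => m; elim: m s => // n IHn t; exact: coboundary_false.
Qed.

Section sperner.
(** [G J] stands for the face spanned by the vertices with index in [J], so [G_lab] is Sperner's
    boundary condition. *)
Variables (lab : P -> nat) (e : nat -> P) (m : nat) (G : pred nat -> P -> Prop).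
Hypothesis G_bary : forall J, bary_closed (G J).
Hypothesis G_vertex : forall (J : pred nat) i, (i < m)%N -> J i -> G J (e i).
Hypothesis G_lab : forall J x, G J x -> J (lab x).

Let full q s := perm_eq (map lab s) (iota 0 q).

Lemma coboundary_perm_eq (p l : seq P) (w : seq nat) :
  coboundary (fun t => perm_eq (map lab (p ++ t)) w) l =
  odd (count (fun x => perm_eq (map lab (p ++ l)) (lab x :: w)) l).
Proof.
elim: l p => //= x t IH p.
have -> : (fun u => perm_eq (map lab (p ++ x :: u)) w) =
          (fun u => perm_eq (map lab (rcons p x ++ u)) w).
  by apply/funext => u; rewrite cat_rcons.
rewrite IH oddD cat_rcons; congr addb.
rewrite !map_cat /= oddb.
rewrite (@perm_catCA _ (map lab p) [:: lab x] (map lab t) (lab x :: w)) /=.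
by rewrite perm_cons.
Qed.

(** Door counting: a fully labelled list has exactly one facet labelled [0, ..., q - 1]; any other
    list has none or two. *)
Lemma full_coboundary q s :
  List.Forall (fun x => lab x <= q)%N s ->
  full q.+1 s = coboundary (full q) s.
Proof.
move=> sq; rewrite (coboundary_perm_eq [::]) /=.
transitivity (odd (count (fun x => perm_eq (map lab s) (x :: iota 0 q)) (map lab s))).
  rewrite odd_count_perm_iota//.
  by elim: sq => //= x t -> _ ->.
by rewrite count_map.
Qed.

(** Sperner's induction on the dimension: counting doors moves the parity to the boundary of the
    simplex. The facet opposite to the last vertex contributes 1 by induction, and the others
    contribute 0. *)
Lemma iter_subdiv_full N q : (q <= m)%N ->
  iter N subdiv (full q) (map e (iota 0 q)) = true.
Proof.
elim: q => [_|q IH qm].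
  by rewrite /=; elim: N => //= N; rewrite /subdiv /=.
have Gs (J : pred nat) u : all (fun i => J i && (i <= q)%N) u ->
    List.Forall (G J) (map e u).
  elim: u => [|x u IHu] //= /andP[/andP[Jx xq] Ju]; constructor.
    by apply: G_vertex => //; exact: leq_ltn_trans qm.
  exact: IHu.
transitivity (iter N subdiv (coboundary (full q)) (map e (iota 0 q.+1))).
  apply: (@iter_subdiv_eq (G (fun i => i <= q)%N)) => //.
    by apply: Gs; apply/allP => i; rewrite mem_iota /= add0n ltnS => ->.
  move=> t _ Gt; apply: full_coboundary.
  by apply: List.Forall_impl Gt => x; exact: G_lab.
rewrite iter_subdiv_coboundary -addn1 iotaD map_cat cats1 coboundary_rcons (IH (ltnW qm)).
rewrite coboundary_false// => s1 x s2 es.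
have [u1 [i [u2 [eu -> ->]]]] : exists u1 i u2,
    [/\ iota 0 q = u1 ++ i :: u2, s1 = map e u1 & s2 = map e u2].
  exists (take (size s1) (iota 0 q)), (nth 0%N (iota 0 q) (size s1)),
    (drop (size s1).+1 (iota 0 q)).
  have sz : (size s1 < size (iota 0 q))%N.
    by rewrite -(size_map e) es size_cat /= addnS ltnS leq_addr.
  rewrite -drop_nth// cat_take_drop; split => //.
    by rewrite map_take es take_size_cat.
  by rewrite map_drop es -cat1s catA drop_size_cat// size_cat addn1.
(* [J] indexes the facet that omits vertex [i]; no point of it has label [i < q], so it contains no
   door. *)
set J := fun j => (j \in u1 ++ u2 ++ [:: q]).
have iJ : ~~ J i.
  have : uniq (iota 0 q) by exact: iota_uniq.
  have : i \in iota 0 q by rewrite eu mem_cat in_cons eqxx orbT.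
  rewrite mem_iota /= add0n => iq.
  rewrite eu -cat1s uniq_catCA /= !mem_cat negb_or => /andP[/andP[i1 i2] _].
  by rewrite /J !mem_cat (negbTE i1) (negbTE i2) /= inE neq_ltn iq.
have iq : (i < q)%N.
  by have : i \in iota 0 q; [rewrite eu mem_cat in_cons eqxx orbT|rewrite mem_iota].
rewrite -map_cat -map_rcons.
rewrite (@iter_subdiv_eq (G J) _ _ (fun=> false)) ?iter_subdiv_false//.
  apply: Gs; apply/allP => j; rewrite mem_rcons in_cons /J catA [in X in X && _]mem_cat inE.
  rewrite orbC => ju; rewrite ju /=; case/orP: ju => [ju|/eqP->//].
  have : j \in iota 0 q.
    by rewrite eu mem_cat in_cons orbCA -mem_cat ju orbT.
  by rewrite mem_iota /= add0n => /ltnW.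
move=> t _ Gt; apply/negP => /perm_mem /(_ i).
rewrite mem_iota /= add0n iq => H; have {}H : i \in map lab t by rewrite H.
have /allP/(_ _ H) : all J (map lab t) by elim: Gt {H} => //= y u /G_lab -> _ ->.
by rewrite (negbTE iJ).
Qed.
End sperner.
End subdivision.

(** * Diameters of iterated subdivisions *)

Section barycenter.
Variable R : realType.
Implicit Types (x y : nat -> R) (s t : seq (nat -> R)).

Definition barycenter s : nat -> R := fun i => (\sum_(x <- s) x i) / (size s)%:R.

Local Notation sd := (subdiv barycenter).

Definition diam_le (d : R) s :=
  forall x y, List.In x s -> List.In y s -> forall i, `|x i - y i| <= d.

Definition in_simplex m (J : pred nat) x :=
  [/\ forall i, 0 <= x i, forall i, ~~ J i -> x i = 0 & \sum_(i < m) x i = 1].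

Lemma sum_Forall_le s (f : (nat -> R) -> R) (c : R) :
  List.Forall (fun x => f x <= c) s -> \sum_(x <- s) f x <= (size s)%:R * c.
Proof.
elim=> [|x t xc _ IH]; first by rewrite big_nil mul0r.
by rewrite big_cons /= mulrS mulrDl mul1r lerD.
Qed.

Lemma in_simplex_bary m J : bary_closed barycenter (in_simplex m J).
Proof.
move=> s s0 Fs.
have sp : 0 < (size s)%:R :> R by case: s s0 {Fs} => // x t _; rewrite ltr0n.
split => [i|i Ji|].
- apply: divr_ge0; last exact: ltW.
   elim: Fs {s0 sp} => [|x t [h _ _] _ IH].
    by rewrite big_nil.
  by rewrite big_cons addr_ge0.
- rewrite /barycenter (_ : \sum_(_ <- _) _ = 0) ?mul0r//.
  elim: Fs => [|x t [_ h _] _ IH]; first by rewrite big_nil.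
  by rewrite big_cons h// add0r.
- rewrite /barycenter -mulr_suml exchange_big /=.
  rewrite (_ : \sum_(_ <- _) _ = (size s)%:R) ?divff ?gt_eqF//.
  elim: Fs {sp s0} => [|x t [_ _ h] _ IH]; first by rewrite big_nil.
  by rewrite big_cons h IH /= mulrS.
Qed.

Lemma ball_bary_closed (c : R) i (e : R) : bary_closed barycenter (fun x => `|c - x i| <= e).
Proof.
move=> s s0 Fs.
have sp : 0 < (size s)%:R :> R by case: s s0 {Fs} => // x t _; rewrite ltr0n.
have -> : c - barycenter s i = (\sum_(x <- s) (c - x i)) / (size s)%:R.
  rewrite big_split /= sumrN mulrBl; congr (_ - _).
  by rewrite big_const_seq count_predT iter_addr_0 -[c *+ _]mulr_natr mulfK ?gt_eqF.
rewrite normrM normfV (gtr0_norm sp) ler_pdivrMr// mulrC.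
by apply: le_trans (ler_norm_sum _ _ _) _; exact: sum_Forall_le.
Qed.

(* The summand [x - x] vanishes, whence the contraction factor [1 - 1 / size s]. *)
Lemma dist_barycenter d s x : diam_le d s -> List.In x s ->
  forall i, `|barycenter s i - x i| <= (1 - (size s)%:R^-1) * d.
Proof.
move=> ds xs i.
have sp : 0 < (size s)%:R :> R by case: s xs {ds} => // *; rewrite ltr0n.
have -> : barycenter s i - x i = (\sum_(y <- s) (y i - x i)) / (size s)%:R.
  rewrite big_split /= mulrDl; congr (_ + _).
  by rewrite big_const_seq count_predT iter_addr_0 -[_ *+ _]mulr_natr mulfK ?gt_eqF.
rewrite normrM normfV (gtr0_norm sp) ler_pdivrMr//.
rewrite mulrAC mulrBl mul1r mulVf ?gt_eqF//.
apply: le_trans (ler_norm_sum _ _ _) _.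
have [s1 [s2 es]] := List.in_split _ _ xs.
have -> : s = s1 ++ x :: s2 by [].
rewrite big_cat big_cons /= subrr normr0 add0r -big_cat /=.
have -> : (size (s1 ++ x :: s2))%:R - 1 = (size (s1 ++ s2))%:R :> R.
  by rewrite !size_cat /= addnS -natr1 addrK.
apply: sum_Forall_le; apply/List.Forall_forall => y ys.
apply: ds => //; rewrite es; apply/List.in_app_iff.
by case: (List.in_app_or _ _ _ ys) => h; [left|right; right].
Qed.

(** In contrapositive form, because subdivision is known only through parities: there is no list of
    its simplices to inspect. A fixed [m >= n] gives one contraction factor for all faces met by the
    recursion. *)
Lemma subdiv_rec_small m n psi s d : (n <= m)%N -> 0 <= d -> size s = n ->
  diam_le d s ->
  (forall t, size t = n -> diam_le ((1 - m%:R^-1) * d) t ->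
    (forall Q, bary_closed barycenter Q -> List.Forall Q s -> List.Forall Q t) ->
    psi t = false) ->
  subdiv_rec barycenter n psi s = false.
Proof.
move=> + d0; elim: n psi s => [|n IH] psi s nm sn ds h /=.
  by apply: h => [|x y []|Q _ _]; [|exact: List.Forall_nil].
apply: coboundary_false => s1 x s2 es.
have sub y : List.In y (s1 ++ s2) -> List.In y s.
  rewrite es => /List.in_app_iff[] h'; apply/List.in_app_iff; [by left|by right; right].
apply: IH; first exact: ltnW.
- by move: sn; rewrite es !size_cat /= addnS => -[].
- by move=> y z /sub ys /sub zs; exact: ds.
move=> t tn dt Qt.
have Qs Q : bary_closed barycenter Q -> List.Forall Q s -> List.Forall Q (barycenter s :: t).
  move=> bQ Qs; constructor; first by apply: bQ => //; case: (s) sn.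
  by apply: Qt => //; apply: (@Forall_del _ _ _ x); rewrite -es.
(* Closeness to the barycenter is a [bary_closed] condition, so it passes from the vertices of [s]
   to every vertex of [t]. *)
have bt y : List.In y t -> forall i, `|barycenter s i - y i| <= (1 - m%:R^-1) * d.
  move=> yt i; pose Q z := is_true (`|barycenter s i - z i| <= (1 - m%:R^-1) * d).
  suff : List.Forall Q (barycenter s :: t).
    by move=> /(List.Forall_forall _ _).1; apply; right.
  apply: Qs; first exact: ball_bary_closed.
  apply/List.Forall_forall => z zs; apply: le_trans (dist_barycenter ds zs _) _.
  rewrite ler_wpM2r// lerD2l lerN2 sn lef_pV2 ?posrE ?ltr0n ?ler_nat//.
  exact: leq_trans nm.
apply: h => //; first by rewrite /= tn.
move=> y z /= [<-|yt] [<-|zt] i.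
- rewrite subrr normr0 mulr_ge0// subr_ge0 invf_le1 ?ler1n ?ltr0n//.
    exact: leq_trans nm.
  exact: leq_trans nm.
- exact: bt.
- by rewrite distrC; exact: bt.
- exact: dt.
Qed.

Lemma iter_subdiv_small m N psi s d Q : 0 <= d -> size s = m -> diam_le d s ->
  bary_closed barycenter Q -> List.Forall Q s ->
  iter N sd psi s -> exists t,
    [/\ psi t, size t = m, diam_le ((1 - m%:R^-1) ^+ N * d) t & List.Forall Q t].
Proof.
move=> d0 sm ds bQ; elim: N d s d0 sm ds => [|N IH] d s d0 sm ds Qs.
  by exists s; split => //; rewrite expr0 mul1r.
rewrite /= /subdiv sm => h; apply: contrapT => nt.
suff : subdiv_rec barycenter m (iter N sd psi) s = false by rewrite h.
apply: (subdiv_rec_small (m := m) (d := d)) => //.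
move=> t tm dt Qt; apply/negP => pt.
have th0 : 0 <= 1 - m%:R^-1 :> R.
  case: (posnP m) => [->|m0]; first by rewrite invr0 subr0.
  by rewrite subr_ge0 invf_le1 ?ler1n ?ltr0n.
have [u [pu um du Qu]] := IH _ _ (mulr_ge0 th0 d0) tm dt (Qt _ bQ Qs) pt.
by apply: nt; exists u; split => //; rewrite exprSr -mulrA.
Qed.

Lemma sperner m (lab : (nat -> R) -> nat) (e : R) : 0 < e ->
  (forall x, in_simplex m (fun i => i < m)%N x -> (lab x < m)%N /\ x (lab x) != 0) ->
  exists t, [/\ diam_le e t, List.Forall (in_simplex m (fun i => i < m)%N) t &
    forall i, (i < m)%N -> exists2 x, List.In x t & lab x = i].
Proof.
move=> e0 labP.
pose v (j : nat) : nat -> R := fun i => (i == j)%:R.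
have vG (J : pred nat) i : (J i && (i < m))%N -> in_simplex m J (v i).
  move=> /andP[Ji im]; split => [j|j Jj|]; first by rewrite ler0n.
    by rewrite /v; case: eqP => // ji; rewrite ji Ji in Jj.
  rewrite (bigD1 (Ordinal im)) //= /v eqxx big1 ?addr0// => j.
  by rewrite -val_eqE /= => /negbTE ->.
pose G J x := in_simplex m (predI J (fun i => i < m)%N) x.
pose th : R := 1 - m%:R^-1.
have [m0|m0] := posnP m.
  by exists [::]; split => [x y []||i]; [exact: List.Forall_nil|rewrite m0].
have m1 : 1 <= m%:R :> R by rewrite ler1n.
have th0 : 0 <= th by rewrite subr_ge0 invf_le1// (lt_le_trans _ m1).
have th1 : `|th| < 1 by rewrite ger0_norm// gtrBl invr_gt0 (lt_le_trans _ m1).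
have [N thN] : exists N, th ^+ N <= e.
  have /cvgrPdist_le/(_ e e0)[N _ h] := cvg_expr th1.
  by exists N; have := h N (leqnn N); rewrite /= sub0r normrN ger0_norm// exprn_ge0.
have Gbary J : bary_closed barycenter (G J) by exact: in_simplex_bary.
have Gv (J : pred nat) i : (i < m)%N -> J i -> G J (v i) by move=> im Ji; apply: vG; rewrite /= Ji im.
have Gl (J : pred nat) x : G J x -> J (lab x).
  move=> [x0 xJ x1].
  have /labP[_] : in_simplex m (fun i => i < m)%N x.
    by split => // i im; apply: xJ; rewrite /= negb_and im orbT.
  by apply: contra_neqT => nJ; apply: xJ; rewrite /= negb_and nJ.
have ivm j : List.In j (map v (iota 0 m)) -> exists2 i, (i < m)%N & j = v i.
  move=> /List.in_map_iff[i [<- im]]; exists i => //.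
  have : i \in iota 0 m; last by rewrite mem_iota.
  by elim: (iota 0 m) im => //= z l IHl [->|/IHl h]; rewrite in_cons ?eqxx// h orbT.
have dv : diam_le 1 (map v (iota 0 m)).
  move=> x y /ivm[i _ ->] /ivm[j _ ->] k; rewrite /v.
  by case: (k == i); case: (k == j); rewrite /= ?subrr ?sub0r ?subr0 ?normrN ?normr0 ?normr1.
have Qv : List.Forall (in_simplex m (fun i => i < m)%N) (map v (iota 0 m)).
  by apply/List.Forall_forall => _ /ivm[i im ->]; apply: vG; rewrite im.
have sv : size (map v (iota 0 m)) = m by rewrite size_map size_iota.
have [t [pt tm dt Qt]] := iter_subdiv_small ler01 sv dv (in_simplex_bary (J := _))
  Qv (iter_subdiv_full Gbary Gv Gl N (leqnn m)).
exists t; split => // [x y xt yt i|i im].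
  by apply: le_trans (dt x y xt yt i) _; rewrite mulr1.
have : i \in map lab t by rewrite (perm_mem pt) mem_iota.
by elim: (t) => //= x u IH; rewrite in_cons => /orP[/eqP ->|/IH[y yu yl]];
  [exists x => //; left|exists y => //; right].
Qed.
End barycenter.

(* Approximate fixed points by the KKM argument: the net [y] of [Phi @` C] spans
   a simplex, and a point [a] of it is labelled by a vertex of its carrier which
   is far from [Phi a]; such a label exists if [a] is not almost fixed, since balls
   are convex. A small fully labelled simplex contradicts the net property. *)
Lemma schauder_approx (R : realType) (I : Type) (X : normedModType R)
    (C : set (I -> X)) (Phi : (I -> X) -> I -> X) (L : R) :
  C !=set0 ->
  (forall m (y : nat -> I -> X) (a : nat -> R), (forall i, (i < m)%N -> C (y i)) ->
     (forall i, 0 <= a i) -> \sum_(i < m) a i = 1 ->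
     C (fun t => \sum_(i < m) a i *: y i t)) ->
  (forall u, C u -> exists M, forall t, `|u t| <= M) ->
  (forall u v (e : R), C u -> C v -> (forall t, `|u t - v t| <= e) ->
     forall t, `|Phi u t - Phi v t| <= L * e) ->
  (forall e : R, 0 < e -> exists m (y : nat -> I -> X), (forall i, (i < m)%N -> C (y i)) /\
     forall u, C u -> exists2 i, (i < m)%N & forall t, `|Phi u t - y i t| <= e) ->
  forall e : R, 0 < e -> exists2 u, C u & forall t, `|u t - Phi u t| <= e.
Proof.
move=> [u0 Cu0] Cconv Cbnd PhiL net e e0; apply: contrapT => nofix.
have [m [y [Cy ynet]]] := net (e / 2) (divr_gt0 e0 (ltr0Sn _ _)).
have [B yB] : exists B, forall i t, (i < m)%N -> `|y i t| <= B.
  have /choice[B hB] i : exists B, (i < m)%N -> forall t, `|y i t| <= B.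
    by have [im|] := boolP (i < m)%N; [have [M hM] := Cbnd _ (Cy _ im); exists M|exists 0].
  exists (\sum_(i < m) `|B i|) => i t im; apply: le_trans (hB _ im t) _.
  rewrite (bigD1 (Ordinal im))//= (le_trans (ler_norm _))// lerDl.
  by rewrite sumr_ge0.
pose hull (a : nat -> R) t := \sum_(i < m) a i *: y i t.
pose D := in_simplex m (fun i => i < m)%N : (nat -> R) -> Prop.
have Chull a : D a -> C (hull a) by move=> [a0 _ a1]; exact: Cconv.
have /choice[lab hlab] : forall a, exists i, D a ->
    [/\ (i < m)%N, a i != 0 & ~ forall t, `|Phi (hull a) t - y i t| <= e].
  move=> a; apply: contrapT => /forallNP H; apply: nofix.
  have Da : D a by apply: contrapT => nD; apply: (H 0%N) => /nD.
  exists (hull a); first exact: Chull.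
  have h i : (i < m)%N -> a i != 0 -> forall t, `|Phi (hull a) t - y i t| <= e.
    by move=> im ai; apply: contrapT => ne; apply: (H i) => _.
  case: Da => a0 _ a1 t; rewrite distrC.
  have -> : Phi (hull a) t - hull a t = \sum_(i < m) a i *: (Phi (hull a) t - y i t).
    rewrite -[in LHS](scale1r (Phi _ t)) -a1 scaler_suml -sumrB.
    by apply: eq_bigr => i _; rewrite scalerBr.
  apply: le_trans (ler_norm_sum _ _ _) _; rewrite -[e]mul1r -a1 mulr_suml.
  apply: ler_sum => i _; rewrite normrZ ger0_norm//.
  have [->|ai] := eqVneq (a i) 0; first by rewrite !mul0r.
  by rewrite ler_wpM2l// h.
have LB : 0 < `|L| * (m%:R * `|B|) + 1 by rewrite ltr_wpDl// !mulr_ge0.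
(* The mesh is such that [hull] changes by at most [m * |B|] times it and [Phi] by at most [e / 2];
   adding 1 keeps the denominator positive. *)
have [t [dt Dt full]] := @sperner _ m lab (e / 2 / (`|L| * (m%:R * `|B|) + 1))
  (divr_gt0 (divr_gt0 e0 (ltr0Sn _ _)) LB) (fun a Da => let: And3 h1 h2 _ := hlab a Da in conj h1 h2).
have DIn a : List.In a t -> D a by move/(List.Forall_forall _ _).1 : Dt; apply.
have [m0|m0] := posnP m.
  by have [i] := ynet _ Cu0; rewrite m0.
have [a at_ _] := full 0%N m0.
(* Some net point [y i] is within [e / 2] of the image of [a], hence within [e] of the image of the
   vertex [a'] labelled [i], against the choice of labels. *)
have [i im yi] := ynet _ (Chull _ (DIn _ at_)).
have [a' a't labi] := full i im.
have [_ _] := hlab _ (DIn _ a't); apply => s; rewrite labi.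
rewrite -(subrK (Phi (hull a) s) (Phi (hull a') s)) -addrA.
apply: le_trans (ler_normD _ _) _; rewrite [leRHS]splitr lerD//.
have : forall s, `|hull a' s - hull a s| <= m%:R * `|B| * (e / 2 / (`|L| * (m%:R * `|B|) + 1)).
  move=> {}s; rewrite -sumrB; apply: le_trans (ler_norm_sum _ _ _) _.
  rewrite -mulrA -[X in X%:R * _](card_ord m) mulr_natl -sumr_const; apply: ler_sum => j _.
  rewrite -scalerBl normrZ mulrC ler_pM// ?dt//.
  by rewrite (le_trans (yB _ _ _))// ler_norm.
move=> /(PhiL _ _ _ (Chull _ (DIn _ a't)) (Chull _ (DIn _ at_))) /(_ s) /le_trans; apply.
set K := m%:R * `|B|; rewrite -/K in LB *.
have -> : L * (K * (e / 2 / (`|L| * K + 1))) = e / 2 * (L * K / (`|L| * K + 1)).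
  by ring.
rewrite ler_piMr ?divr_ge0 ?(ltW e0)// ler_pdivrMr// mul1r.
have K0 : 0 <= K by rewrite mulr_ge0.
by rewrite (le_trans (ler_wpM2r K0 (ler_norm L)))// lerDl ler01.
Qed.

(** * Totally bounded sets and integrals of continuous curves *)

Section small.
Variable R : realType.

Lemma exists_small (c e : R) : 0 < e -> exists2 d, 0 < d & c * d < e.
Proof.
move=> e0; have c1 : 0 < `|c| + 1 by rewrite ltr_wpDl.
exists (e / (`|c| + 1)); first by rewrite divr_gt0.
rewrite mulrCA -[ltRHS]mulr1 ltr_pM2l// ltr_pdivrMr// mul1r.
by rewrite (le_lt_trans (ler_norm c))// ltrDl.
Qed.

Lemma le0_eps (r c : R) : (forall d, 0 < d -> r <= c * d) -> r <= 0.
Proof.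
move=> h; apply/ler_addgt0Pl => e e0; rewrite addr0.
by have [d d0 cd] := exists_small c e0; rewrite (le_trans (h d d0))// ltW.
Qed.

End small.

Section finite_nets.
Variable R : realType.

(** [d x y e] reads as distance at most [e]; a relation covers both the norm of a space and the
    uniform distance of paths, which has no normed space here. *)
Definition finite_nets (T : Type) (d : T -> T -> R -> Prop) (B : set T) :=
  forall e : R, 0 < e -> exists m (y : nat -> T),
    forall x, B x -> exists2 i, (i < m)%N & d x (y i) e.

(** Diagonal argument: nested infinite index sets [S n], each caught by one small ball, and [phi n]
    taken in [S n.+1] beyond [n]. The explicit rate [2^-1 ^+ n] is kept for later use. *)
Lemma finite_nets_cauchy (T : Type) (d : T -> T -> R -> Prop) (B : set T)
    (x : nat -> T) :
  (forall u v w e, d u w e -> d v w e -> d u v (2 * e)) ->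
  finite_nets d B -> (forall n, B (x n)) ->
  exists phi : nat -> nat, (forall n, (n <= phi n)%N) /\
    forall n m, (n <= m)%N -> d (x (phi n)) (x (phi m)) (2^-1 ^+ n).
Proof.
move=> dtri netB Bx.
pose inf (S : set nat) := forall N, exists2 n, (N <= n)%N & S n.
have refine (S : set nat) (e : R) : 0 < e -> inf S -> exists S' : set nat,
    [/\ inf S', S' `<=` S & forall i j, S' i -> S' j -> d (x i) (x j) e].
  move=> e0 Sinf; have e2 : 0 < e / 2 by rewrite divr_gt0.
  have [m [y net]] := netB _ e2.
  have [i [im infi]] : exists i, (i < m)%N /\ inf [set n | S n /\ d (x n) (y i) (e / 2)].
    apply: contrapT => /forallNP H.
    have /choice[N hN] i : exists N, (i < m)%N -> forall n, (N <= n)%N -> S n ->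
        ~ d (x n) (y i) (e / 2).
      have [im|] := boolP (i < m)%N; last by exists 0%N.
      have : ~ inf [set n | S n /\ d (x n) (y i) (e / 2)] by move=> h; apply: (H i).
      move=> /existsNP[N hN]; exists N => _ n Nn Sn dn; apply: hN; exists n => //.
    (* Pigeonhole: if every ball caught only indices below its threshold [N i], no index beyond
       their sum could be caught at all. *)
    have [n Nn Sn] := Sinf (\sum_(i < m) N i)%N.
    have [i im di] := net _ (Bx n).
    apply: (hN i im n _ Sn di); apply: leq_trans Nn.
    by rewrite (bigD1 (Ordinal im))//= leq_addr.
  exists [set n | S n /\ d (x n) (y i) (e / 2)]; split => // [n []//|j k [_ dj] [_ dk]].
  have -> : e = 2 * (e / 2) by rewrite mulrC divfK.
  exact: dtri dj dk.
have p2 n : 0 < 2^-1 ^+ n :> R by rewrite exprn_gt0.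
have /choice[next hnext] (p : set nat * nat) : exists S' : set nat, inf p.1 ->
    [/\ inf S', S' `<=` p.1 & forall i j, S' i -> S' j -> d (x i) (x j) (2^-1 ^+ p.2)].
  have [ip|nip] := pselect (inf p.1); last by exists setT.
  by have [S' hS'] := refine p.1 _ (p2 p.2) ip; exists S'.
pose fix S n : set nat := if n is k.+1 then next (S k, k) else next (setT, 0%N).
have infS n : inf (S n).
  elim: n => [|n IH] /=; last by have [] := hnext (S n, n) IH.
  by have [] // := hnext (setT, 0%N) (fun N => ex_intro2 _ _ N (leqnn N) Logic.I).
have SS n k : S (n + k)%N `<=` S n.
  elim: k => [|k IH]; first by rewrite addn0.
  by rewrite addnS /=; have [_ + _] := hnext (S (n + k)%N, (n + k)%N) (infS _) => /subset_trans; apply.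
have dS n i j : S n.+1 i -> S n.+1 j -> d (x i) (x j) (2^-1 ^+ n).
  by have [_ _] := hnext (S n, n) (infS n); apply.
have /choice[phi hphi] n : exists k, (n <= k)%N /\ S n.+1 k.
  by have [k] := infS n.+1 n; exists k.
exists phi; split => [n|n m nm]; first by have [] := hphi n.
apply: dS; first by have [] := hphi n.
have [_] := hphi m; rewrite -(subnKC nm) -addSn; exact: SS.
Qed.

Definition totally_bounded (X : normedModType R) (B : set X) :=
  finite_nets (fun x y e => `|x - y| <= e) B.

Section normed.
Variable X : normedModType R.
Implicit Types B C : set X.

Lemma totally_bounded_subset B C : B `<=` C -> totally_bounded C -> totally_bounded B.
Proof.
move=> BC netC e e0; have [m [y h]] := netC e e0; exists m, y => x /BC; exact: h.
Qed.

Lemma precompact_totally_bounded B : precompact B -> totally_bounded B.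
Proof.
rewrite precompactE compact_cover => cB e e0.
have := cB; move=> /(_ X setT (fun x => ball x e)) [].
- by move=> x _; exact: ball_open.
- by move=> x _; exists x => //; exact: ballxx.
move=> D' _ DB.
exists (size (enum_fset D')), (nth 0 (enum_fset D')) => x /(@subset_closure _ B) /DB [y yD].
rewrite /= -ball_normE /ball_ /= => xy; exists (index y (enum_fset D')).
  by rewrite index_mem.
by rewrite nth_index// distrC ltW.
Qed.

Lemma totally_bounded_approx B : (forall e : R, 0 < e -> exists C,
  totally_bounded C /\ forall x, B x -> exists2 y, C y & `|x - y| <= e) ->
  totally_bounded B.
Proof.
move=> H e e0; have e2 : 0 < e / 2 by rewrite divr_gt0.
have [C [tC BC]] := H _ e2; have [m [y h]] := tC _ e2; exists m, y => x /BC[z Cz xz].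
have [i im zi] := h _ Cz; exists i => //.
by rewrite -(subrK z x) -addrA [leRHS]splitr (le_trans (ler_normD _ _))// lerD.
Qed.

Lemma totally_bounded_image (Y : normedModType R) (f : X -> Y) (c : R) B :
  (forall x y, `|f x - f y| <= c * `|x - y|) ->
  totally_bounded B -> @totally_bounded Y (f @` B).
Proof.
move=> fc tB e e0; have c1 : 0 < `|c| + 1 by rewrite ltr_wpDl.
have [m [y h]] := tB (e / (`|c| + 1)) (divr_gt0 e0 c1).
exists m, (f \o y) => _ [x Bx <-]; have [i im xi] := h _ Bx; exists i => //=.
apply: le_trans (fc _ _) _.
apply: (@le_trans _ _ ((`|c| + 1) * `|x - y i|)).
  by rewrite ler_wpM2r// (le_trans (ler_norm c))// lerDl.
by rewrite -ler_pdivlMl// mulrC.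
Qed.

Lemma totally_bounded_add (B C : set X) : totally_bounded B -> totally_bounded C ->
  totally_bounded [set z | exists2 x, B x & exists2 y, C y & z = x + y].
Proof.
move=> tB tC e e0; have e2 : 0 < e / 2 by rewrite divr_gt0.
have [m [y hy]] := tB _ e2; have [k [z hz]] := tC _ e2.
exists (m * k)%N, (fun i => y (i %/ k)%N + z (i %% k)%N).
move=> _ [u /hy[i im ui] [v /hz[j jk vj] ->]].
have k0 : (0 < k)%N by exact: leq_trans jk.
exists (i * k + j)%N.
  have : (i.+1 * k <= m * k)%N by rewrite leq_mul2r im orbT.
  by apply: leq_trans; rewrite mulSn addnC ltn_add2r.
rewrite divnMDl// divn_small// addn0 modnMDl modn_small//.
by rewrite opprD addrACA [leRHS]splitr (le_trans (ler_normD _ _))// lerD.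
Qed.
End normed.
End finite_nets.

(** * Scalar integrals and Riemann sums on a segment *)

Section segment_integral.
Variable R : realType.
Local Notation mu := (@lebesgue_measure R).
Implicit Types (a b c t : R) (g : R -> R).

Lemma unif_continuous_segment (X : normedModType R) (g : R -> X) a b :
  continuous g -> forall e, 0 < e -> exists2 d, 0 < d &
  forall s t, a <= s <= b -> `|t - s| <= d -> `|g t - g s| <= e.
Proof.
move=> cg e e0.
have /compact_near_coveringP cov := @segment_compact R a b.
pose P d s := forall t : R, `|t - s| <= d -> `|g t - g s| <= e.
have h : \forall d \near 0^'+, `[a, b] `<=` P d.
  apply: (cov R (0^'+) P) => s _.
  have /cvgrPdist_le /(_ _ (divr_gt0 e0 (ltr0Sn _ 1))) := cg s.
  move=> /nbhs_ballP[r /= r0 gr].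
  have r2 : 0 < r / 2 by rewrite divr_gt0.
  exists (ball s (r / 2), [set d | d < r / 2]) => /=.
    split; first exact: nbhsx_ballx.
    exact: nbhs_right_lt.
  move=> [x d] /= [sx dr] t td.
  have gx : `|g s - g x| <= e / 2.
    by apply: gr; apply: le_ball sx; rewrite ler_pdivrMr// ler_pMr// ler1n.
  have gt : `|g s - g t| <= e / 2.
    apply: gr; rewrite /ball /= -(subrK x s) -addrA (splitr r).
    by rewrite (le_lt_trans (ler_normD _ _))// ltrD// distrC (le_lt_trans td).
  rewrite -(subrK (g s) (g t)) -addrA [leRHS]splitr (le_trans (ler_normD _ _))//.
  by rewrite lerD// distrC.
have : \forall d \near 0^'+, 0 < d /\ `[a, b] `<=` P d.
  near=> d; split; first by near: d; exact: nbhs_right_gt.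
  near: d; exact: h.
move=> /filter_ex[d [d0 hd]]; exists d => // s t sab; apply: hd.
by rewrite /= in_itv.
Unshelve. all: by end_near. Qed.

Lemma continuous_integrable g a b : continuous g -> mu.-integrable `[a, b] (EFin \o g).
Proof.
move=> cg; apply: continuous_compact_integrable; first exact: segment_compact.
exact: continuous_subspaceT.
Qed.

Lemma Rintegral_segmentD g a b c : continuous g -> a <= b -> b <= c ->
  \int[mu]_(x in `[a, c]) g x =
  \int[mu]_(x in `[a, b]) g x + \int[mu]_(x in `[b, c]) g x.
Proof.
move=> cg ab bc; apply/eqP; rewrite addrC -subr_eq; apply/eqP.
rewrite Rintegral_itvB ?bnd_simp//; last exact: continuous_integrable.
rewrite Rintegral_itv_obnd_cbnd//.
apply: integrableS (continuous_integrable b c cg) => //.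
by apply: subset_itvr; rewrite bnd_simp.
Qed.

Lemma fine_lebesgue_segment a b : a <= b -> fine (mu `[a, b]) = b - a.
Proof.
move=> ab; rewrite lebesgue_measure_itv /= lte_fin; case: ifPn => //.
by rewrite -leNgt => ba; rewrite (@le_anti _ _ a b) ?ab// subrr.
Qed.

Lemma Rintegral_segment_le g a b M : continuous g -> a <= b ->
  (forall s, a <= s <= b -> `|g s| <= M) ->
  `|\int[mu]_(x in `[a, b]) g x| <= (b - a) * M.
Proof.
move=> cg ab gM.
have ig := @continuous_integrable g a b cg.
apply: le_trans (le_normr_Rintegral _ ig) _ => //.
rewrite mulrC -(fine_lebesgue_segment ab) -Rintegral_cst//.
apply: le_Rintegral => //.
- apply: (@continuous_integrable (fun x => `|g x|)) => x.
  by apply: continuous_comp; [exact: cg|exact: norm_continuous].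
- by apply: continuous_integrable => x; exact: cvg_cst.
Qed.

Lemma riemann_sum_le g a b e n : continuous g -> a <= b ->
  (forall s t, a <= s <= b -> a <= t <= b -> `|t - s| <= (b - a) / n.+1%:R -> `|g t - g s| <= e) ->
  `|\sum_(i < n.+1) (b - a) / n.+1%:R * g (a + i%:R * ((b - a) / n.+1%:R)) -
    \int[mu]_(x in `[a, b]) g x| <= (b - a) * e.
Proof.
move=> cg ab; set h := (b - a) / n.+1%:R => ge.
have h0 : 0 <= h by rewrite divr_ge0 ?subr_ge0.
have bE : b = a + n.+1%:R * h by rewrite /h mulrC divfK ?pnatr_eq0// addrC subrK.
suff H k : (k <= n.+1)%N ->
    `|\sum_(i < k) h * g (a + i%:R * h) - \int[mu]_(x in `[a, a + k%:R * h]) g x| <= k%:R * h * e.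
  have := H _ (leqnn n.+1); rewrite -bE => /le_trans; apply.
  by have -> : b - a = n.+1%:R * h by rewrite [in LHS]bE addrAC subrr add0r.
elim: k => [_|k IH kn].
  by rewrite big_ord0 mul0r addr0 set_itv1 Rintegral_set1 subrr normr0 !mul0r.
have step : a + k.+1%:R * h = a + k%:R * h + h by rewrite -natr1; ring.
have el : a + k.+1%:R * h - (a + k%:R * h) = h by rewrite step addrAC subrr add0r.
have kk : a + k%:R * h <= a + k.+1%:R * h by rewrite step lerDl.
have kb : a + k.+1%:R * h <= b by rewrite bE lerD2l ler_wpM2r// ler_nat.
have ak : a <= a + k%:R * h by rewrite lerDl mulr_ge0.
rewrite big_ord_recr /= (@Rintegral_segmentD _ a (a + k%:R * h)) //.
rewrite opprD addrACA.
have -> : k.+1%:R * h * e = k%:R * h * e + h * e by rewrite -natr1; ring.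
apply: le_trans (ler_normD _ _) _; apply: lerD; first exact: IH (ltnW kn).
pose c : R -> R := fun x => g (a + k%:R * h) - g x.
have cc : continuous c by move=> x; apply: cvgB; [exact: cvg_cst|exact: cg].
have -> : h * g (a + k%:R * h) - \int[mu]_(x in `[a + k%:R * h, a + k.+1%:R * h]) g x =
    \int[mu]_(x in `[a + k%:R * h, a + k.+1%:R * h]) c x.
  rewrite RintegralB//; last 2 first.
  - by apply: continuous_integrable => x; exact: cvg_cst.
  - exact: continuous_integrable.
  by rewrite Rintegral_cst// (fine_lebesgue_segment kk) el mulrC.
rewrite (le_trans (@Rintegral_segment_le c _ _ e _ _ _))//.
- move=> s /andP[s1 s2]; apply: ge.
  + by rewrite (le_trans ak)// (le_trans s2).
  + by rewrite ak (le_trans s1)// (le_trans s2).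
  + rewrite distrC ger0_norm ?subr_ge0// lerBlDl (le_trans s2)// step//.
- by rewrite el.
Qed.

End segment_integral.

(** * Inner products and integrals of continuous curves *)

Definition is_inner (R : realType) (X : normedModType R) (ip : X -> X -> R) :=
  [/\ forall x y, ip x y = ip y x, forall x y z, ip (x + y) z = ip x z + ip y z,
      forall a x y, ip (a *: x) y = a * ip x y & forall x, ip x x = `|x| ^+ 2].

Section inner_product.
Variables (R : realType) (X : normedModType R) (ip : X -> X -> R).
Hypothesis ipP : is_inner ip.
Implicit Types x y z : X.

Lemma ipC x y : ip x y = ip y x. Proof. by case: ipP. Qed.

Lemma ipDl x y z : ip (x + y) z = ip x z + ip y z. Proof. by case: ipP. Qed.

Lemma ipZl a x y : ip (a *: x) y = a * ip x y. Proof. by case: ipP. Qed.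

Lemma ipxx x : ip x x = `|x| ^+ 2. Proof. by case: ipP. Qed.

Lemma ipDr x y z : ip x (y + z) = ip x y + ip x z.
Proof. by rewrite ipC ipDl !(ipC x). Qed.

Lemma ipZr a x y : ip x (a *: y) = a * ip x y.
Proof. by rewrite ipC ipZl ipC. Qed.

Lemma ip0l x : ip 0 x = 0. Proof. by rewrite -(scale0r 0) ipZl mul0r. Qed.

Lemma ipNl x y : ip (- x) y = - ip x y.
Proof. by rewrite -scaleN1r ipZl mulN1r. Qed.

Lemma ipBl x y z : ip (x - y) z = ip x z - ip y z.
Proof. by rewrite ipDl ipNl. Qed.

Lemma ipBr x y z : ip x (y - z) = ip x y - ip x z.
Proof. by rewrite ipC ipBl !(ipC x). Qed.

Lemma ip_suml n (f : 'I_n -> X) y : ip (\sum_i f i) y = \sum_i ip (f i) y.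
Proof. by elim/big_ind2 : _ => [|? ? ? ? <- <-|//]; rewrite ?ip0l ?ipDl. Qed.

Lemma ip_eq x y : (forall z, ip x z = ip y z) -> x = y.
Proof.
move=> h; apply/eqP; rewrite -subr_eq0 -normr_eq0 -sqrf_eq0 -ipxx.
by rewrite ipBl h subrr.
Qed.

Lemma normD_sqr x y : `|x + y| ^+ 2 = `|x| ^+ 2 + 2 * ip x y + `|y| ^+ 2.
Proof. by rewrite -!ipxx ipDl !ipDr (ipC y x); ring. Qed.

Lemma cauchy_schwarz x y : `|ip x y| <= `|x| * `|y|.
Proof.
have [->|y0] := eqVneq y 0; first by rewrite ipC ip0l !normr0 mulr0.
have ny : 0 < `|y| by rewrite normr_gt0.
have := ipxx (`|y| ^+ 2 *: x - ip x y *: y).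
rewrite ipBl !ipBr !ipZl !ipZr !ipxx (ipC y x) => h.
have {h} : 0 <= `|y| ^+ 2 * (`|x| ^+ 2 * `|y| ^+ 2 - ip x y ^+ 2).
  have := sqr_ge0 `| `|y| ^+ 2 *: x - ip x y *: y|; rewrite -h => /le_trans; apply.
  by rewrite le_eqVlt; apply/orP; left; apply/eqP; ring.
rewrite pmulr_rge0 ?exprn_gt0// subr_ge0 -exprMn -[ip x y ^+ 2]real_normK ?num_real//.
by rewrite ler_pXn2r// nnegrE mulr_ge0.
Qed.

Lemma continuous_ip (g : R -> X) z : continuous g -> continuous (fun s => ip (g s) z).
Proof.
move=> cg s; apply/cvgrPdist_le => e e0.
have z1 : 0 < `|z| + 1 by rewrite ltr_wpDl.
have /cvgrPdist_le/(_ _ (divr_gt0 e0 z1)) := cg s.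
apply: filterS => t gt; rewrite -ipBl (le_trans (cauchy_schwarz _ _))//.
rewrite (@le_trans _ _ (`|g s - g t| * (`|z| + 1)))//.
  by rewrite ler_wpM2l// lerDl.
by rewrite -ler_pdivlMr.
Qed.

End inner_product.

(** The Pettis integral in a Hilbert space: additivity and estimates are inherited from scalar
    integrals by testing with [z]. *)
Definition weak_integral (R : realType) (X : normedModType R) (ip : X -> X -> R)
    (a b : R) (g : R -> X) (v : X) :=
  forall z, ip v z = \int[@lebesgue_measure R]_(s in `[a, b]) ip (g s) z.

(** The default 0 is never reached for a continuous curve on a segment with [a <= b], where a weak
    integral exists. *)
HB.lock Definition integral (R : realType) (X : normedModType R)
    (ip : X -> X -> R) (a b : R) (g : R -> X) : X :=
  xget 0 (weak_integral ip a b g).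
Canonical integral_unlockable := Unlockable integral.unlock.

Section vector_integral.
Variables (R : realType) (X : completeNormedModType R) (ip : X -> X -> R).
Hypothesis ipP : is_inner ip.
Local Notation mu := (@lebesgue_measure R).
Local Notation weak_integral := (weak_integral ip).
Local Notation integral := (integral ip).
Implicit Types (a b c t : R) (g : R -> X).

Definition riemann_sum a b g n : X :=
  \sum_(i < n.+1) ((b - a) / n.+1%:R) *: g (a + i%:R * ((b - a) / n.+1%:R)).

(** The rank [n] is chosen before [z] and the error is linear in [|z|]: testing with the difference
    of two Riemann sums then shows that they form a Cauchy sequence in norm. *)
Lemma riemann_sum_weak a b g e : continuous g -> a <= b -> 0 < e ->
  \forall n \near \oo, forall z,
   `|ip (riemann_sum a b g n) z - \int[mu]_(s in `[a, b]) ip (g s) z| <= (b - a) * (e * `|z|).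
Proof.
move=> cg ab e0; have [d d0 hd] := unif_continuous_segment a b cg e0.
have d1 : 0 < d / (b - a + 1) by rewrite divr_gt0// ltr_wpDl// subr_ge0.
near=> n => z; rewrite /riemann_sum (ip_suml ipP).
under eq_bigr do rewrite (ipZl ipP).
apply: riemann_sum_le => //; first exact: continuous_ip.
move=> s t sab tab st; rewrite -(ipBl ipP) (le_trans (cauchy_schwarz ipP _ _))//.
rewrite ler_wpM2r// hd// (le_trans st)//.
have n1 : n.+1%:R^-1 <= d / (b - a + 1).
  by apply: ltW; near: n; exact: (near_infty_natSinv_lt (PosNum d1)).
apply: le_trans (ler_wpM2l _ n1) _; rewrite ?subr_ge0//.
have ba1 : 0 < b - a + 1 by rewrite ltr_wpDl// subr_ge0.
rewrite mulrCA ler_piMr ?(ltW d0)// ler_pdivrMr// mul1r lerDl//.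
Unshelve. all: by end_near. Qed.

Lemma integral_exists a b g : continuous g -> a <= b ->
  exists v, weak_integral a b g v /\ riemann_sum a b g n @[n --> \oo] --> v.
Proof.
move=> cg ab.
have /cauchy_cvgP/cvg_ex[v rv] : cauchy (riemann_sum a b g n @[n --> \oo]).
  apply/cauchyP => e e0.
  have [d d0 de] := exists_small ((b - a) * 2) e0.
  have /filter_ex[n hn] := riemann_sum_weak cg ab d0.
  exists (riemann_sum a b g n).
  have := riemann_sum_weak cg ab d0; apply: filterS => k hk.
  rewrite /= -ball_normE /ball_ /=; set z := _ - _.
  apply: le_lt_trans de.
  have [->|z0] := eqVneq z 0.
    by rewrite normr0 !mulr_ge0 ?subr_ge0// ltW.
  rewrite -(ler_pM2r (_ : 0 < `|z|)) ?normr_gt0// -expr2 -(ipxx ipP) {1}/z (ipBl ipP).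
  rewrite -(subrK (\int[mu]_(s in `[a, b]) ip (g s) z) (ip (riemann_sum a b g n) z)) -addrA.
  have -> : (b - a) * 2 * d * `|z| = (b - a) * (d * `|z|) + (b - a) * (d * `|z|) by ring.
  rewrite lerD//; first by rewrite (le_trans (ler_norm _)).
  by rewrite (le_trans (ler_norm _))// distrC.
exists v; split => // z; apply/eqP; rewrite -subr_eq0 -normr_le0.
apply: (@le0_eps _ _ (`|z| + (b - a) * `|z|)) => d d0.
have /cvgrPdist_le/(_ d d0) rvd := rv.
have [N _ hN] := riemann_sum_weak cg ab d0; have [M _ hM] := rvd.
have h1 := hN (maxn N M) (leq_maxl N M); have h2 := hM (maxn N M) (leq_maxr N M).
move: (maxn N M) h1 h2 => n /= h1 h2.
rewrite -(subrK (ip (riemann_sum a b g n) z) (ip v z)) -addrA -(ipBl ipP).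
rewrite (le_trans (ler_normD _ _))// mulrDl lerD//.
  by rewrite (le_trans (cauchy_schwarz ipP _ _))// mulrC ler_wpM2l.
by rewrite (le_trans (h1 z))// -mulrA (mulrC d).
Qed.

Lemma weak_integral_unique a b g v w :
  weak_integral a b g v -> weak_integral a b g w -> v = w.
Proof. by move=> hv hw; apply: (ip_eq ipP) => z; rewrite hv hw. Qed.

Lemma integralE a b g : continuous g -> a <= b -> weak_integral a b g (integral a b g).
Proof.
move=> cg ab; have [v [wv _]] := integral_exists cg ab.
by rewrite unlock; exact: (xgetPex 0 (ex_intro _ v wv)).
Qed.

Lemma integral_riemann a b g : continuous g -> a <= b ->
  riemann_sum a b g n @[n --> \oo] --> integral a b g.
Proof.
move=> cg ab; have [v [wv rv]] := integral_exists cg ab.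
by rewrite (weak_integral_unique (integralE cg ab) wv).
Qed.

Lemma integralP a b g v : continuous g -> a <= b -> weak_integral a b g v ->
  integral a b g = v.
Proof. by move=> cg ab; apply: weak_integral_unique; exact: integralE. Qed.

Lemma integral_le a b g M : continuous g -> a <= b ->
  (forall s, a <= s <= b -> `|g s| <= M) -> `|integral a b g| <= (b - a) * M.
Proof.
move=> cg ab gM; set v := integral _ _ _.
have M0 : 0 <= M by rewrite (le_trans _ (gM a _))// lexx.
have [->|v0] := eqVneq v 0; first by rewrite normr0 mulr_ge0 ?subr_ge0.
rewrite -(ler_pM2r (_ : 0 < `|v|)) ?normr_gt0// -expr2 -(ipxx ipP).
rewrite (integralE cg ab) (le_trans (ler_norm _))// -mulrA.
apply: Rintegral_segment_le => //; first exact: continuous_ip.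
by move=> s sab; rewrite (le_trans (cauchy_schwarz ipP _ _))// ler_wpM2r// gM.
Qed.

Lemma integralD a b c g : continuous g -> a <= b -> b <= c ->
  integral a c g = integral a b g + integral b c g.
Proof.
move=> cg ab bc; have ac := le_trans ab bc; apply: integralP => //.
move=> z; rewrite (ipDl ipP) !integralE// [RHS](@Rintegral_segmentD _ _ a b)//.
exact: continuous_ip.
Qed.

Lemma integralB a b g h : continuous g -> continuous h -> a <= b ->
  integral a b (fun s => g s - h s) = integral a b g - integral a b h.
Proof.
move=> cg ch ab; apply: integralP => //.
  by move=> s; apply: cvgB; [exact: cg|exact: ch].
move=> z; rewrite (ipBl ipP) !integralE// -RintegralB//.
- by apply: eq_Rintegral => s _; rewrite (ipBl ipP).
- exact/continuous_integrable/continuous_ip.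
- exact/continuous_integrable/continuous_ip.
Qed.

Lemma eq_integral_segment a b g h : (forall s, a <= s <= b -> g s = h s) ->
  integral a b g = integral a b h.
Proof.
move=> gh; rewrite unlock; congr (xget _ _); apply/funext => v; apply/propext.
have E z : \int[mu]_(s in `[a, b]) ip (g s) z = \int[mu]_(s in `[a, b]) ip (h s) z.
  by apply: eq_Rintegral => s /set_mem; rewrite /= in_itv /= => /gh ->.
by split => hv z; rewrite hv E.
Qed.

(** Passing through Riemann sums avoids constructing the adjoint of [B]. *)
Lemma integral_map (B : X -> X) a b g : linear B -> continuous B ->
  continuous g -> a <= b -> B (integral a b g) = integral a b (B \o g).
Proof.
move=> lB cB cg ab.
have cBg : continuous (B \o g) by move=> s; apply: continuous_comp; [exact: cg|exact: cB].
pose LB : {linear X -> X} := HB.pack B (GRing.isLinear.Build _ _ _ _ _ lB).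
have rB n : riemann_sum a b (B \o g) n = B (riemann_sum a b g n).
  rewrite /riemann_sum -[B]/(LB : X -> X) linear_sum; apply: eq_bigr => i _.
  by rewrite linearZ.
have h1 := integral_riemann cBg ab.
have h2 : riemann_sum a b (B \o g) n @[n --> \oo] --> B (integral a b g).
  under eq_fun do rewrite rB.
  by apply: continuous_cvg; [exact: cB|exact: integral_riemann].
exact: (cvg_unique _ h2 h1).
Qed.

Lemma integral_shift a b c g : continuous g -> a <= b ->
  integral (a + c) (b + c) g = integral a b (fun s => g (s + c)).
Proof.
move=> cg ab.
have cgc : continuous (fun s => g (s + c)).
  move=> s; apply: continuous_comp; last exact: cg.
  by apply: cvgD; [exact: cvg_id|exact: cvg_cst].
have h1 := integral_riemann cgc ab.
have h2 : riemann_sum (a + c) (b + c) g n @[n --> \oo] --> integral (a + c) (b + c) g.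
  by apply: integral_riemann => //; rewrite lerD2r.
have E : (fun n => riemann_sum (a + c) (b + c) g n) =
    (fun n => riemann_sum a b (fun s => g (s + c)) n).
  apply/funext => n; rewrite /riemann_sum.
  have -> : b + c - (a + c) = b - a by ring.
  apply: eq_bigr => i _.
  by rewrite addrAC.
by rewrite E in h2; exact: (cvg_unique _ h2 h1).
Qed.

End vector_integral.

(* Unlike [ge0_le_integral], no measurability is assumed. *)
Lemma ge0_integral_le d (T : measurableType d) (R : realType)
    (mu : {measure set T -> \bar R}) (D : set T) (f g : T -> \bar R) :
  (forall x, D x -> 0 <= f x)%E -> (forall x, D x -> f x <= g x)%E ->
  (\int[mu]_(x in D) f x <= \int[mu]_(x in D) g x)%E.
Proof.
move=> f0 fg; have g0 x : D x -> (0 <= g x)%E by move=> Dx; exact: le_trans (f0 x Dx) (fg x Dx).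
rewrite !ge0_integralE//; apply: le_ereal_sup => _ [h hf <-]; exists h => // x.
apply: le_trans (hf x) _; rewrite !patchE; case: ifPn => // xD; apply: fg.
exact: set_mem.
Qed.

(** * Bochner integrals of continuous curves *)

Section bochner.
Variables (R : realType) (X : completeNormedModType R) (ip : X -> X -> R).
Hypothesis ipP : is_inner ip.
Local Notation mu := (@lebesgue_measure R).
Variables (a b : R) (g : R -> X).
Hypotheses (cg : continuous g) (ab : a <= b).

Let h n := (b - a) / n.+1%:R.

Let node n (i : nat) := a + i%:R * h n.

(** Half-open pieces plus the singleton [b] partition the closed segment, so each point belongs to
    exactly one piece; the singleton has measure 0 and leaves the Riemann sum unchanged. *)
Definition step_simple n : @simple _ (measurableTypeR R) R X :=
  @Simple _ (measurableTypeR R) R X n.+2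
    (fun i => if (i < n.+1)%N then `[node n i, node n i.+1[%classic else [set b])
    (fun i => if (i < n.+1)%N then g (node n i) else g b).

Let h0 n : 0 <= h n. Proof. by rewrite divr_ge0 ?subr_ge0. Qed.

Let node_last n : node n n.+1 = b.
Proof. by rewrite /node /h mulrC divfK ?pnatr_eq0// addrC subrK. Qed.

Let node_mono n i j : (i <= j)%N -> node n i <= node n j.
Proof. by move=> ij; rewrite lerD2l ler_wpM2r ?ler_nat. Qed.

Let nodeS n i : node n i.+1 = node n i + h n.
Proof. by rewrite /node -natr1; ring. Qed.

Lemma step_simple_val n x : a <= x <= b ->
  exists2 y, a <= y <= b & `|x - y| <= h n /\ simple_fun (step_simple n) x = g y.
Proof.
move=> /andP[ax xb].
suff [i xi iu] : exists2 i : 'I_n.+2, simple_set (s := step_simple n) i x &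
    forall j, simple_set (s := step_simple n) j x -> j = i.
  have -> : simple_fun (step_simple n) x = simple_vec (s := step_simple n) i.
    rewrite /simple_fun (bigD1 i)//= indicE mem_set// scale1r big1 ?addr0// => j ji.
    rewrite indicE memNset ?scale0r// => /iu jE.
    by rewrite jE eqxx in ji.
  move: xi => /=; case: ifPn => [i_n|_ ->]; last first.
    by exists b; rewrite ?ab ?lexx// subrr normr0.
  rewrite /= in_itv /= nodeS => /andP[x1 x2]; exists (node n i).
    rewrite -(node_last n) node_mono ?(ltnW i_n)// andbT.
    by rewrite -[leLHS]addr0 lerD2l mulr_ge0.
  by split => //; rewrite ger0_norm ?subr_ge0// lerBlDl ltW.
have [->|xb'] := eqVneq x b.
  exists ord_max => [|j] /=; first by rewrite ltnn.
  case: ifPn => [jn|]; last first.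
    by rewrite -leqNgt => jn _; apply/val_inj/eqP; rewrite eqn_leq jn -ltnS ltn_ord.
  rewrite /= in_itv /= => /andP[_]; rewrite ltNge => /negP[].
  by rewrite -(node_last n) node_mono.
have {xb xb'} xb : x < b by rewrite lt_neqAle xb' xb.
have hp : 0 < h n by rewrite divr_gt0// subr_gt0 (le_lt_trans ax).
pose k := Num.truncn ((x - a) / h n).
have /andP[k1 k2] : node n k <= x < node n k.+1.
  have /truncn_itv : 0 <= (x - a) / h n by rewrite divr_ge0 ?subr_ge0.
  by rewrite ler_pdivlMr// ltr_pdivrMr// lerBrDl ltrBlDl.
have kn : (k < n.+1)%N.
  rewrite ltnNge; apply/negP => nk; have := le_trans (node_mono n nk) k1.
  by rewrite node_last leNgt xb.
exists (Ordinal (leqW kn)) => [|j] /=; first by rewrite kn /= in_itv /= k1.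
case: ifPn => [jn|_ xE]; last by move: xb; rewrite xE ltxx.
rewrite /= in_itv /= => /andP[j1 j2]; apply/val_inj => /=; apply/eqP.
rewrite eqn_leq; apply/andP; split; rewrite leqNgt; apply/negP => jk.
  by have := lt_le_trans k2 (le_trans (node_mono n jk) j1); rewrite ltxx.
by have := lt_le_trans j2 (le_trans (node_mono n jk) k1); rewrite ltxx.
Qed.

Lemma step_simple_integrable n :
  integrable_simple mu `[a, b] (step_simple n).
Proof.
move=> i; split; first by rewrite /=; case: ifP.
apply: (@le_lt_trans _ _ (mu `[a, b])).
  apply: le_measure; [|exact/mem_set|exact: subIsetl].
  by apply/mem_set; apply: measurableI => //=; case: ifP.
by rewrite /= lebesgue_measure_itv; case: ifPn => // _; rewrite -EFinB ltry.
Qed.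

Lemma step_simple_integral n :
  integral_simple mu `[a, b] (step_simple n) = riemann_sum a b g n.
Proof.
rewrite /integral_simple /= big_ord_recr /= ltnn.
rewrite (_ : `[a, b] `&` [set b] = [set b]); last first.
  by apply/seteqP; split => [x []//|x ->]; split => //=; rewrite in_itv /= ab lexx.
rewrite lebesgue_measure_set1 scale0r addr0; apply: eq_bigr => i _.
rewrite /= ltn_ord (_ : `[a, b] `&` _ = `[node n i, node n i.+1[%classic).
  congr (_ *: _); rewrite lebesgue_measure_itv /= lte_fin nodeS.
  case: ifPn => [_|]; first by rewrite -EFinB /= [_ + h n]addrC addrK.
  by rewrite -leNgt gerDl => hn; apply/le_anti; rewrite hn h0.
apply/seteqP; split => [x []//|x xi]; split => //.
move: xi; rewrite /= !in_itv /= => /andP[x1 x2].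
apply/andP; split; first by rewrite (le_trans _ x1)// lerDl mulr_ge0.
by rewrite (le_trans (ltW x2))// -(node_last n) node_mono.
Qed.

Lemma step_simple_close e : 0 < e -> \forall n \near \oo,
  forall x, a <= x <= b -> `|g x - simple_fun (step_simple n) x| <= e.
Proof.
move=> e0; have [d d0 hd] := unif_continuous_segment a b cg e0.
have [c c0 hc] := exists_small (b - a) d0.
have := near_infty_natSinv_lt (PosNum c0); apply: filterS => n nc x xab.
have [y yab [xy ->]] := step_simple_val n xab; apply: hd => //.
rewrite (le_trans xy)// (le_trans _ (ltW hc))// ler_wpM2l ?subr_ge0//; exact: ltW.
Qed.

Lemma has_bochner_integral_continuous :
  has_bochner_integral mu `[a, b] g (integral ip a b g).
Proof.
have intle n e : (forall x, a <= x <= b -> `|g x - simple_fun (step_simple n) x| <= e) ->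
    (\int[mu]_(x in `[a, b]) `|g x - simple_fun (step_simple n) x|%:E <= ((b - a) * e)%:E)%E.
  move=> ge; apply: (@le_trans _ _ (\int[mu]_(x in `[a, b]) e%:E)%E).
    apply: ge0_integral_le => x; rewrite /= in_itv /= => xab; rewrite lee_fin//.
    exact: ge.
  rewrite integral_cst//= lebesgue_measure_itv /= lte_fin; case: ifPn => [_|].
    by rewrite -EFinB -EFinM mulrC.
  by rewrite -leNgt => ba; rewrite (@le_anti _ _ a b) ?ab// subrr mule0 mul0r.
have ge0 n : (0 <= \int[mu]_(x in `[a, b]) `|g x - simple_fun (step_simple n) x|%:E)%E.
  by apply: integral_ge0 => x _; rewrite lee_fin.
exists step_simple; split.
- exact: step_simple_integrable.
- apply: aeW => x /=; rewrite in_itv /= => xab; apply/cvgrPdist_le => e e0.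
  by have := step_simple_close e0; apply: filterS => n; apply.
- apply/fine_cvgP; split.
    have := step_simple_close ltr01; apply: filterS => n /intle le1.
    by rewrite ge0_fin_numE// (le_lt_trans le1) ?ltry.
  apply/cvgrPdist_le => e e0; have [c c0 hc] := exists_small (b - a) e0.
  have := step_simple_close c0; apply: filterS => n /intle le1.
  rewrite sub0r normrN ger0_norm ?fine_ge0//= -lee_fin fineK; last first.
    by rewrite ge0_fin_numE// (le_lt_trans le1) ?ltry.
  by rewrite (le_trans le1)// lee_fin ltW.
- under eq_fun do rewrite step_simple_integral.
  exact: integral_riemann.
Qed.

End bochner.

(** * C0 semigroups *)

Section semigroup.
Variables (R : realType) (X : completeNormedModType R) (S : R -> X -> X).
Hypothesis S_C0 : C0_semigroup S.
Implicit Types (s t h : R) (x y : X).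

Lemma sg_linear t : 0 <= t -> linear (S t).
Proof. by case: S_C0 => [h _ _ _] /h[]. Qed.

Lemma sg0 x : S 0 x = x. Proof. by case: S_C0. Qed.

Lemma sgD s t x : 0 <= s -> 0 <= t -> S (s + t) x = S s (S t x).
Proof. by case: S_C0 => [_ _ h _]; exact: h. Qed.

Lemma sgB t x y : 0 <= t -> S t (x - y) = S t x - S t y.
Proof.
move=> t0; have := sg_linear t0 (-1) y x; rewrite !scaleN1r [- y + x]addrC => ->.
exact: addrC.
Qed.

Lemma sgZ t a x : 0 <= t -> S t (a *: x) = a *: S t x.
Proof.
move=> t0; have S00 : S t 0 = 0 by rewrite -{1}(subrr x) sgB// subrr.
by move: (sg_linear t0 a x 0); rewrite S00 !addr0 => h; exact: h.
Qed.

Lemma sg00 t : 0 <= t -> S t 0 = 0.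
Proof. by move=> t0; rewrite -{1}(subrr 0) sgB// subrr. Qed.

Lemma sg_add t x y : 0 <= t -> S t (x + y) = S t x + S t y.
Proof. by move=> t0; have := sg_linear t0 1 x y; rewrite !scale1r. Qed.

Lemma sg_near0 x e : 0 < e -> exists2 d, 0 < d &
  forall t, 0 <= t -> t < d -> `|S t x - x| <= e.
Proof.
move=> e0; have [_ _ _ /(_ x)/cvgrPdist_le/(_ e e0)] := S_C0.
rewrite /at_right near_withinE => /nbhs_ballP[d /= d0 hd].
exists d => // t; rewrite le_eqVlt => /predU1P[<-|t0 td].
  by rewrite sg0 subrr normr0 ltW.
by rewrite distrC; apply: hd => //=; rewrite /ball /= sub0r normrN gtr0_norm.
Qed.

(** Uniform boundedness: otherwise there are times [t n <= 1 / (n + 1)] at which the operator norm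
    exceeds [n + 1], although every orbit [S (t n) x] tends to [x] and is bounded. *)
Lemma sg_bound_near0 : exists d M, [/\ 0 < d, 1 <= M &
  forall t x, 0 <= t -> t <= d -> `|S t x| <= M * `|x|].
Proof.
apply: contrapT => H.
have /choice[t ht] n : exists t, [/\ 0 <= t, t <= n.+1%:R^-1 &
    exists x, n.+1%:R * `|x| < `|S t x|].
  apply: contrapT => /forallNP Hn; apply: H; exists n.+1%:R^-1, n.+1%:R.
  split; rewrite ?invr_gt0 ?ler1n// => t x t0 tn; rewrite leNgt; apply/negP => hx.
  by apply: (Hn t); split => //; exists x.
pose F := range (fun n => S (t n)).
have FP f : F f -> bounded_fun_norm f /\ linear f.
  move=> [n _ <-]; have [t0 _ _] := ht n; split; last exact: sg_linear.
  move=> r; have [/(_ _ t0)[_ [C hC]] _ _ _] := S_C0.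
  exists (`|C| * `|r|) => x xr; rewrite (le_trans (hC x))//.
  by rewrite (le_trans (ler_wpM2r _ (ler_norm C)))// ler_wpM2l// (le_trans xr)// ler_norm.
have Fb : pointwise_bounded F.
  move=> x; have [d d0 hd] := sg_near0 x ltr01.
  have [N _ hN] := near_infty_natSinv_lt (PosNum d0).
  exists (`|x| + 1 + \sum_(i < N) `|S (t i) x|) => _ [n _ <-].
  have [t0 tn _] := ht n; have [nN|nN] := ltnP n N.
    by rewrite (bigD1 (Ordinal nN))//= addrCA lerDl !addr_ge0// sumr_ge0.
  apply: (@le_trans _ _ (`|x| + 1)); last by rewrite lerDl sumr_ge0.
  rewrite -(subrK x (S _ x)) addrC (le_trans (ler_normD _ _))// lerD2l.
  by apply: hd => //; rewrite (le_lt_trans tn)//; exact: hN.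
have [M hM] := Banach_Steinhauss FP Fb 1.
pose n := Num.truncn M; have [t0 tn [x hx]] := ht n.
have Mn : M < n.+1%:R by exact: truncnS_gt.
have x0 : 0 < `|x|.
  rewrite normr_gt0; apply/eqP => x0; move: hx.
  by rewrite x0 sg00// normr0 mulr0 ltxx.
have := hM (S (t n)) (ex_intro2 _ _ n Logic.I erefl) (`|x|^-1 *: x).
rewrite normrZ normfV normr_id mulVf ?gt_eqF// lexx => /(_ isT).
rewrite sgZ// normrZ normfV normr_id mulrC ler_pdivrMr// leNgt => /negP[].
by rewrite (lt_trans _ hx)// ltr_pM2r.
Qed.

Lemma sg_bound b : exists2 C, 1 <= C &
  forall t x, 0 <= t -> t <= b -> `|S t x| <= C * `|x|.
Proof.
have [d [M [d0 M1 hM]]] := sg_bound_near0.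
suff H n : forall t x, 0 <= t -> t <= n%:R * d -> `|S t x| <= M ^+ n * `|x|.
  exists (M ^+ (Num.truncn (b / d)).+1); first exact: exprn_ege1.
  move=> t x t0 tb; apply: H => //; rewrite (le_trans tb)//.
  by rewrite -ler_pdivrMr// ltW// truncnS_gt.
elim: n => [|n IH] t x t0 tn.
  by rewrite (@le_anti _ _ t 0) ?sg0 ?expr0 ?mul1r// t0 andbT -(mul0r d).
have [td|/ltW dt] := leP t d.
  by rewrite (le_trans (hM _ _ t0 td))// ler_wpM2r// ler_eXnr.
have -> : S t x = S d (S (t - d) x).
  by rewrite -sgD ?subr_ge0 ?(ltW d0)// subrKC.
rewrite exprS -mulrA.
rewrite (le_trans (hM _ _ (ltW d0) (lexx _)))// ler_wpM2l ?(le_trans ler01)//.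
apply: IH; rewrite ?subr_ge0// lerBlDr (le_trans tn)// -natr1.
by rewrite mulrDl mul1r.
Qed.

(** Factoring out the operator at the smaller time reduces continuity of orbits to continuity at
    time 0. *)
Lemma sg_dist b C t s x : (forall t x, 0 <= t -> t <= b -> `|S t x| <= C * `|x|) ->
  0 <= t -> t <= b -> 0 <= s -> s <= b -> `|S t x - S s x| <= C * `|S `|t - s| x - x|.
Proof.
move=> hC; wlog ts : t s / s <= t.
  move=> H t0 tb s0 sb; have [/H|/ltW/H st] := leP s t; first exact.
  by rewrite distrC (distrC t); exact: st.
move=> t0 tb s0 sb; rewrite ger0_norm ?subr_ge0//.
have -> : S t x = S s (S (t - s) x) by rewrite -sgD ?subr_ge0// subrKC.
by rewrite -sgB//; exact: hC.
Qed.

(** Extension by the identity to negative times: integrands such as [sgp (c - s) (g s)] become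
    continuous on the whole line. *)
Definition sgp t x := S (Num.max t 0) x.

Lemma max0_ge0 t : 0 <= Num.max t 0. Proof. by rewrite le_max lexx orbT. Qed.

Lemma dist_max0 t s : `|Num.max t 0 - Num.max s 0| <= `|t - s|.
Proof.
rewrite /Num.max; case: ltP => t0; case: ltP => s0; rewrite ?subr0 ?sub0r ?subrr ?normr0// ?normrN.
- rewrite ger0_norm// distrC ger0_norm ?subr_ge0; last by rewrite ltW// (lt_le_trans t0).
  by rewrite lerDl oppr_ge0 ltW.
- rewrite ger0_norm// ger0_norm ?subr_ge0; last by rewrite ltW// (lt_le_trans s0).
  by rewrite lerDl oppr_ge0 ltW.
Qed.

Lemma sgp_continuous (c : R) (g : R -> X) : continuous g ->
  continuous (fun s => sgp (c - s) (g s)).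
Proof.
move=> cg s; apply/cvgrPdist_le => e e0.
have [C C1 hC] := sg_bound (`|c - s| + 1).
have C0 : 0 <= C by rewrite (le_trans ler01).
have [e1 e10 he1] := exists_small (2 * C) e0.
have [d d0 hd] := sg_near0 (g s) e10.
have d1 : 0 < Num.min d 1 by rewrite lt_min d0 ltr01.
have cgs : \forall t \near s, `|g s - g t| <= e1.
  by have /cvgrPdist_le/(_ _ e10) := cg s.
near=> t.
have st : `|s - t| < Num.min d 1.
  by near: t; exact: (nbhsx_ballx s (Num.min d 1) d1).
have bnd u : `|s - u| <= 1 -> Num.max (c - u) 0 <= `|c - s| + 1.
  move=> su; rewrite ge_max addr_ge0// andbT.
  have -> : c - u = (c - s) + (s - u) by ring.
  by rewrite lerD// (le_trans (ler_norm _)).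
have b1 : Num.max (c - s) 0 <= `|c - s| + 1 by apply: bnd; rewrite subrr normr0.
have b2 : Num.max (c - t) 0 <= `|c - s| + 1.
  by apply: bnd; rewrite ltW// (lt_le_trans st)// ge_min lexx orbT.
rewrite -(subrK (sgp (c - t) (g s)) (sgp (c - s) (g s))) -addrA.
rewrite (le_trans (ler_normD _ _))// (le_trans _ (ltW he1))//.
have -> : 2 * C * e1 = C * e1 + C * e1 by ring.
apply: lerD.
  rewrite (le_trans (sg_dist _ hC _ _ _ _))// ?max0_ge0//.
  rewrite ler_wpM2l// hd// (le_lt_trans (dist_max0 _ _))//.
  have -> : c - s - (c - t) = t - s by ring.
  by rewrite distrC (lt_le_trans st)// ge_min lexx.
rewrite -sgB ?max0_ge0// (le_trans (hC _ _ _ _))// ?max0_ge0// ler_wpM2l//.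
by near: t.
Unshelve. all: by end_near. Qed.

Lemma sgp_orbit_continuous x : continuous (fun t => sgp t x).
Proof.
have h := @sgp_continuous 0 (fun=> x) (fun _ => cvg_cst _).
move=> t; rewrite (_ : (fun t => sgp t x) = (fun s => sgp (0 - s) x) \o -%R); last first.
  by apply/funext => u; rewrite /= sub0r opprK.
by apply: continuous_comp; [exact: opp_continuous|exact: h].
Qed.

Lemma sg_op_continuous t : 0 <= t -> continuous (S t).
Proof.
move=> t0 x; have [C C1 hC] := sg_bound t.
apply/cvgrPdist_le => e e0; have [d d0 hd] := exists_small C e0.
have /cvgrPdist_le/(_ _ d0) := @cvg_id _ (nbhs x).
apply: filterS => y xy; rewrite -sgB// (le_trans (hC _ _ _ _))//.
by rewrite (le_trans _ (ltW hd))// ler_wpM2l// (le_trans ler01).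
Qed.

End semigroup.

Lemma expR_semigroup (R : realType) (X : completeNormedModType R) (S : R -> X -> X)
  (c : R) : C0_semigroup S -> C0_semigroup (fun t x => expR (c * t) *: S t x).
Proof.
move=> SC0; have [h1 h2 h3 h4] := SC0; split.
- move=> t t0; split => [a x y|]; first by rewrite (sg_linear SC0)// scalerDr !scalerA [a * _]mulrC.
  have [_ [C hC]] := h1 _ t0; exists (expR (c * t) * C) => x.
  by rewrite normrZ gtr0_norm ?expR_gt0// -mulrA ler_pM2l ?expR_gt0.
- by move=> x; rewrite mulr0 expR0 scale1r.
- by move=> s t x s0 t0; rewrite mulrDr expRD h3// (sgZ SC0)// scalerA.
- move=> x; suff : expR (c * h) *: S h x @[h --> 0^'+] --> expR (c * 0) *: x.
    by rewrite mulr0 expR0 scale1r.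
  apply: cvgZ; last exact: h4.
  apply: cvg_within_filter; apply: continuous_comp; last exact: continuous_expR.
  by apply: cvgM; [exact: cvg_cst|exact: cvg_id].
Qed.

(** * Generators and eigenvectors *)

Section generator.
Variables (R : realType) (X : completeNormedModType R) (ip : X -> X -> R).
Hypothesis ipP : is_inner ip.
Implicit Types (s t h c : R) (x y : X).

Lemma expR_slope c : h^-1 * (expR (c * h) - 1) @[h --> 0^'+] --> c.
Proof.
have dg : is_derive (0 : R) (1 : R) (c \*: @id R) (c *: 1) by exact: is_deriveZ.
have d : is_derive (0 : R) (1 : R) (expR \o (c \*: @id R)) (expR (c *: 0) * (c *: 1)).
  exact: is_derive1_comp.
have {d} d : is_derive (0 : R) (1 : R) (fun h => expR (c * h)) c.
  by move: d; rewrite scaler0 expR0 mul1r -[c *: 1]/(c * 1) mulr1.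
have := @ex_derive _ _ _ _ _ _ _ d => /cvg_ex[l hl].
have cl : l = c by rewrite -(@derive_val _ _ _ _ _ _ _ d); apply/esym; exact: cvg_lim hl.
have : (fun h => h^-1 * (expR (c * h) - 1)) @ 0^' --> c.
  move: hl; rewrite cl; apply: cvg_trans; apply: near_eq_cvg; near=> h => /=.
  by rewrite addr0 mulr0 expR0 -[h *: 1]/(h * 1) mulr1.
exact: cvg_dnbhs_at_right.
Unshelve. all: by end_near. Qed.

Lemma generator_scale (S : R -> X -> X) c x w : C0_semigroup S ->
  h^-1 *: (S h x - x) @[h --> 0^'+] --> w ->
  h^-1 *: (expR (c * h) *: S h x - x) @[h --> 0^'+] --> w + c *: x.
Proof.
move=> SC0 hw.
have [_ _ _ S0] := SC0.
have E h : h^-1 *: (expR (c * h) *: S h x - x) =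
   h^-1 *: (S h x - x) + (h^-1 * (expR (c * h) - 1)) *: S h x.
  rewrite -scalerA -scalerDr; congr (_ *: _).
  by rewrite scalerBl scale1r [RHS]addrC addrA subrK.
under eq_fun do rewrite E.
by apply: cvgD => //; apply: cvgZ; [exact: expR_slope|exact: S0].
Qed.

(** Telescoping over [n.+1] steps of length [h = t / n.+1]: the semigroup bound makes each increment
    at most [C * d * h], so the total is at most [t * C * d] for arbitrary [d]. Only the right
    derivative at 0 is needed. *)
Lemma generator_fixed (K : R -> X -> X) x : C0_semigroup K ->
  h^-1 *: (K h x - x) @[h --> 0^'+] --> (0 : X) -> forall t, 0 <= t -> K t x = x.
Proof.
move=> KC0 h0 t t0; apply/eqP; rewrite -subr_eq0 -normr_le0.
have [C C1 hC] := sg_bound KC0 t.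
have C0 : 0 <= C by rewrite (le_trans ler01).
have [->|tn0] := eqVneq t 0; first by rewrite (sg0 KC0) subrr normr0.
have tp : 0 < t by rewrite lt_neqAle eq_sym tn0.
apply: (@le0_eps _ _ (t * C)) => d d0.
move: h0 => /cvgrPdist_le/(_ _ d0); rewrite /at_right near_withinE => /nbhs_ballP[r /= r0 hr].
have [c c0 hc] := exists_small t r0.
have [n nc] : exists n, n.+1%:R^-1 < c.
  by have /filter_ex[n] := near_infty_natSinv_lt (PosNum c0); exists n.
set h := t / n.+1%:R.
have hp : 0 < h by rewrite divr_gt0.
have hx : `|K h x - x| <= d * h.
  have : `|0 - h^-1 *: (K h x - x)| <= d.
    apply: hr => //=; rewrite /ball /= sub0r normrN gtr0_norm//.
    by rewrite (lt_trans _ hc)// ltr_pM2l.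
  by rewrite sub0r normrN normrZ gtr0_norm ?invr_gt0// mulrC ler_pdivrMr.
have tE : t = n.+1%:R * h by rewrite /h mulrC divfK.
suff H k : (k <= n.+1)%N -> `|K (k%:R * h) x - x| <= k%:R * (h * (C * d)).
  have := H _ (leqnn n.+1); rewrite -tE => /le_trans; apply.
  by rewrite mulrA -tE mulrA.
elim: k => [_|k IH kn]; first by rewrite !mul0r (sg0 KC0) subrr normr0.
have kh : 0 <= k%:R * h by rewrite mulr_ge0// ltW.
rewrite -(subrK (K (k%:R * h) x) (K _ x)) -addrA.
have -> : K (k.+1%:R * h) x = K (k%:R * h) (K h x).
  by rewrite -(sgD KC0) ?(ltW hp)// -natr1 mulrDl mul1r.
rewrite -natr1 mulrDl mul1r addrC (le_trans (ler_normD _ _))// lerD ?IH 1?ltnW//.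
rewrite -(sgB KC0)// (le_trans (hC _ _ _ _))//.
  by rewrite tE ler_wpM2r ?(ltW hp)// ler_nat ltnW.
by rewrite mulrCA ler_wpM2l// mulrC.
Qed.

Lemma integral_slope (g : R -> X) c : continuous g ->
  h^-1 *: integral ip c (c + h) g @[h --> 0^'+] --> g c.
Proof.
move=> cg; apply/cvgrPdist_le => e e0.
have /cvgrPdist_le/(_ _ e0) := cg c => /nbhs_ballP[r /= r0 hr].
near=> h.
have hp : 0 < h by near: h; exact: nbhs_right_gt.
have hr0 : h < r by near: h; exact: nbhs_right_lt.
have ch : c <= c + h by rewrite lerDl ltW.
have cc : continuous (fun _ : R => g c) by move=> s; exact: cvg_cst.
have -> : g c = h^-1 *: integral ip c (c + h) (fun _ : R => g c).
  have -> : integral ip c (c + h) (fun _ : R => g c) = h *: g c.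
    apply: (integralP ipP) => // z; rewrite Rintegral_cst//.
    by rewrite fine_lebesgue_segment// (ipZl ipP) [c + h]addrC addrK mulrC.
  by rewrite scalerA mulVf ?scale1r ?gt_eqF.
rewrite -scalerBr -(integralB ipP)// normrZ gtr0_norm ?invr_gt0//.
rewrite ler_pdivrMl//.
have hc : c + h - c = h by rewrite [c + h]addrC addrK.
rewrite -[X in _ <= X * _]hc.
apply: (integral_le ipP) => //; first by move=> s; apply: cvgB; [exact: cc|exact: cg].
move=> s /andP[cs sh]; apply: hr.
rewrite /ball /= distrC ger0_norm ?subr_ge0// (le_lt_trans _ hr0)//.
by rewrite lerBlDl.
Unshelve. all: by end_near. Qed.

(** Shifting the orbit by [h] changes its integral only at the two ends. Thus time averages lie in
    the domain of the generator for every [x]. *)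
Lemma generator_integral (K : R -> X -> X) x t : C0_semigroup K -> 0 <= t ->
  h^-1 *: (K h (integral ip 0 t (fun s => sgp K s x)) - integral ip 0 t (fun s => sgp K s x))
    @[h --> 0^'+] --> K t x - x.
Proof.
move=> KC0 t0; set g := fun s => sgp K s x.
have cg : continuous g by exact: sgp_orbit_continuous.
have E h : 0 < h -> K h (integral ip 0 t g) - integral ip 0 t g =
    integral ip t (t + h) g - integral ip 0 (0 + h) g.
  move=> /ltW hp; rewrite (integral_map ipP) //; last 2 first.
  - exact: sg_linear.
  - exact: sg_op_continuous.
  have -> : integral ip 0 t (K h \o g) = integral ip 0 t (fun s => g (s + h)).
    apply: eq_integral_segment => s /andP[s0 _].
    rewrite /g /sgp /= !(max_idPl _) ?addr_ge0// -(sgD KC0)// addrC//.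
  rewrite -(integral_shift ipP)//.
  have th : t <= t + h by rewrite lerDl.
  have h1 := integralD ipP cg t0 th.
  have hh : 0 <= 0 + h by rewrite add0r.
  have ht : 0 + h <= t + h by rewrite lerD2r.
  have h2 := integralD ipP cg hh ht.
  have -> : integral ip (0 + h) (t + h) g =
    integral ip 0 t g + integral ip t (t + h) g - integral ip 0 (0 + h) g.
    by rewrite -h1 h2 [RHS]addrAC subrr !add0r.
  by rewrite [LHS]addrAC [X in X - _ - _]addrC addrK.
have gt : g t = K t x by rewrite /g /sgp (max_idPl _).
have g0 : g 0 = x by rewrite /g /sgp (max_idPl _)// (sg0 KC0).
rewrite -gt -[X in _ - X]g0.
have H : (h^-1 *: integral ip t (t + h) g - h^-1 *: integral ip 0 (0 + h) g)
    @[h --> 0^'+] --> g t - g 0.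
  by apply: cvgB; exact: integral_slope.
apply: cvg_trans H; apply: near_eq_cvg; near=> h.
rewrite /= E ?scalerBr//; near: h; exact: nbhs_right_gt.
Unshelve. all: by end_near. Qed.

Section spectrum.
Variables (S : R -> X -> X) (A : operator X) (lambda : R).
Hypotheses (SC0 : C0_semigroup S) (AS : generates (opp_op A) S).
Let K t x := expR (lambda * t) *: S t x.
Let KC0 : C0_semigroup K := expR_semigroup lambda SC0.

Lemma eigenvector_fixed u : dom A u -> A u = lambda *: u ->
  forall t, 0 <= t -> K t u = u.
Proof.
move=> Au Alu; apply: generator_fixed => //.
have [domE genE] := AS.
have du : dom (generator S) u by rewrite -domE.
have h0 : h^-1 *: (S h u - u) @[h --> 0^'+] --> - (lambda *: u).
  by rewrite -Alu; move: (genE u Au) => /= ->; exact: du.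
have := generator_scale (c := lambda) SC0 h0.
by rewrite addNr.
Qed.

(** For arbitrary [x], the average [y = int_0^t K(s) x ds] is in [dom A] with lambda y - A y = K(t)
    x - x; the hypothesis on [v] makes the left side orthogonal to [v]. *)
Lemma adjoint_eigenvector_fixed v :
  (forall u, dom A u -> ip (A u) v = ip u (lambda *: v)) ->
  forall t x, 0 <= t -> ip (K t x) v = ip x v.
Proof.
move=> Av t x t0; have := generator_integral (x := x) KC0 t0.
set y := integral _ _ _ _ => hy.
(* Rescaling [K] by [expR (- lambda * h)] gives back [S], whose generator is [- A]. *)
have hS : h^-1 *: (S h y - y) @[h --> 0^'+] --> (K t x - x) + (- lambda) *: y.
  have := generator_scale (c := - lambda) KC0 hy.
  by under eq_fun do rewrite /K scalerA -expRD mulNr addNr expR0 scale1r.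
have [domE genE] := AS.
have dy : dom A y.
  by rewrite -[dom A]/(dom (opp_op A)) domE /=; apply/cvg_ex; eexists; exact: hS.
have := genE y dy; rewrite /= => Ay.
have {}Ay : - A y = (K t x - x) + (- lambda) *: y by rewrite Ay; exact: cvg_lim hS.
have := Av y dy; rewrite -[A y]opprK Ay (ipNl ipP) (ipDl ipP) (ipZl ipP) (ipZr ipP) (ipBl ipP).
by move=> h; apply/eqP; rewrite -subr_eq0; apply/eqP; move: h; lra.
Qed.

End spectrum.
End generator.

(** * Compact operators and the Fredholm alternative *)

Section complete.
Variables (R : realType) (X : completeNormedModType R).

Lemma exp2V_small (e : R) : 0 < e -> exists n, 2^-1 ^+ n <= e.
Proof.
move=> e0; have lt1 : `|2^-1| < 1 :> R by rewrite ger0_norm ?invr_ge0// invf_lt1// ltr1n.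
have /cvgrPdist_le/(_ e e0)[n _ h] := cvg_expr lt1.
by exists n; have := h n (leqnn n); rewrite /= sub0r normrN ger0_norm.
Qed.

Lemma cvgn_distP (x : nat -> X) (l : X) : x n @[n --> \oo] --> l <->
  forall e : R, 0 < e -> exists N, forall n, (N <= n)%N -> `|l - x n| <= e.
Proof.
split=> [/cvgrPdist_le h e /h[N _ hN]|h]; first by exists N => n; exact: hN.
by apply/cvgrPdist_le => e /h[N hN]; exists N => // n; exact: hN.
Qed.

Lemma cauchy_seq_cvg (x : nat -> X) :
  (forall e : R, 0 < e -> exists N, forall n, (N <= n)%N -> `|x N - x n| <= e) ->
  exists l : X, x n @[n --> \oo] --> l.
Proof.
move=> h; suff /cauchy_cvgP/cvg_ex : cauchy (x n @[n --> \oo]) by [].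
apply/cauchyP => e e0; have [N hN] := h _ (divr_gt0 e0 (ltr0Sn _ 1)).
exists (x N), N => //= n /hN; rewrite /= -ball_normE /ball_ /= => /le_lt_trans; apply.
by rewrite ltr_pdivrMr// ltr_pMr// ltr1n.
Qed.

(** The rate in the last clause is what later turns convergence in L2 into almost everywhere
    convergence. *)
Lemma totally_bounded_cvg (B : set X) (x : nat -> X) :
  totally_bounded B -> (forall n, B (x n)) ->
  exists phi : nat -> nat, exists l : X, [/\ forall n, (n <= phi n)%N,
    x (phi n) @[n --> \oo] --> l & forall n, `|x (phi n) - l| <= 2^-1 ^+ n].
Proof.
move=> tB Bx; have [|phi [phin hphi]] := finite_nets_cauchy _ tB Bx.
  move=> u v w e uw vw; rewrite -(subrK w u) -addrA mulr_natl mulr2n.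
  by rewrite (le_trans (ler_normD _ _))// lerD// distrC.
have [e e0|l hl] := @cauchy_seq_cvg (x \o phi).
  have [N hN] := exp2V_small e0; exists N => n Nn.
  by rewrite (le_trans (hphi _ _ Nn)).
exists phi, l; split => // n.
rewrite -subr_le0; apply: (@le0_eps _ _ 1) => d d0; rewrite mul1r.
have /cvgn_distP/(_ d d0)[m /(_ (maxn n m) (leq_maxr _ _)) hm] := hl.
rewrite lerBlDl -(subrK (x (phi (maxn n m))) (x (phi n))) -addrA.
by rewrite (le_trans (ler_normD _ _))// lerD// ?hphi ?leq_maxl// distrC.
Qed.

End complete.

Section fredholm.
Variables (R : realType) (X : completeNormedModType R) (ip : X -> X -> R).
Hypothesis ipP : is_inner ip.
Variables (G : X -> X) (C : R).
Hypotheses (GB : forall x y, G (x - y) = G x - G y) (GZ : forall a x, G (a *: x) = a *: G x).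
Hypotheses (C0 : 0 <= C) (GC : forall x, `|G x| <= C * `|x|).
Hypothesis G_compact : forall B, bounded_set B -> totally_bounded (G @` B).

Let N := [set x | G x = x].
Let M := [set x | forall v, N v -> ip x v = 0].

Hypothesis GN : forall v x, N v -> ip (G x) v = ip x v.

Lemma fix_lin a x y : N x -> N y -> N (a *: x - y).
Proof. by rewrite /N /= => xE yE; rewrite GB GZ xE yE. Qed.

Lemma perp_lin a x y : M x -> M y -> M (a *: x - y).
Proof. by move=> Mx My v Nv; rewrite (ipBl ipP) (ipZl ipP) Mx// My// mulr0 subr0. Qed.

Lemma G_cvg (x : nat -> X) (l : X) : x n @[n --> \oo] --> l -> G (x n) @[n --> \oo] --> G l.
Proof.
move=> /cvgn_distP xl; apply/cvgn_distP => e e0.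
have [d d0 hd] := exists_small C e0.
have [m hm] := xl _ d0; exists m => n /hm xn; rewrite -GB.
by rewrite (le_trans (GC _))// (le_trans _ (ltW hd))// ler_wpM2l.
Qed.

Lemma fix_closed (x : nat -> X) (l : X) : (forall n, N (x n)) -> x n @[n --> \oo] --> l -> N l.
Proof.
move=> Nx xl; have := G_cvg xl; under eq_fun do rewrite Nx.
by move=> xl'; exact: (cvg_unique _ xl' xl).
Qed.

Lemma perp_closed (x : nat -> X) (l : X) : (forall n, M (x n)) -> x n @[n --> \oo] --> l -> M l.
Proof.
move=> Mx /cvgn_distP xl v Nv; apply/eqP; rewrite -normr_le0.
apply: (@le0_eps _ _ `|v|) => d d0; have [n /(_ n (leqnn n)) hn] := xl _ d0.
rewrite -[ip l v]subr0 -(Mx n v Nv) -(ipBl ipP) (le_trans (cauchy_schwarz ipP _ _))//.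
by rewrite mulrC ler_wpM2l.
Qed.

(** A sequence in [N] is its own image under [G], so compactness of [G] applies to it directly. *)
Lemma fix_bounded_cvg (x : nat -> X) B : (forall n, N (x n)) -> (forall n, `|x n| <= B) ->
  exists phi : nat -> nat, exists l : X, [/\ forall n, (n <= phi n)%N, N l,
    x (phi n) @[n --> \oo] --> l & forall n, `|x (phi n) - l| <= 2^-1 ^+ n].
Proof.
move=> Nx xB.
have bB : bounded_set [set y : X | `|y| <= B].
  by exists B; split; [exact: num_real|move=> y By z /= zB; exact: le_trans zB (ltW By)].
have [n|phi [l [h1 h2 h3]]] := totally_bounded_cvg (x := x) (G_compact bB).
  by exists (x n); [exact: xB|exact: Nx].
by exists phi, l; split => //; exact: fix_closed h2.
Qed.

(** Nearest point of [N]: a minimizing sequence is bounded, so a subsequence converges in [N];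
    minimality of the limit gives orthogonality by first variation. *)
Lemma exists_proj x : exists v, N v /\ M (x - v).
Proof.
pose D := [set r | exists2 v, N v & r = `|x - v|].
have N0 : N 0 by rewrite /N /= -{1}(subrr 0) GB subrr.
have D0 : D !=set0 by exists `|x - 0|; exists 0.
have Dlb : has_lbound D by exists 0 => _ [v _ ->].
have dle v : N v -> inf D <= `|x - v| by move=> Nv; apply: ge_inf => //; exists v.
have /choice[v hv] n : exists v, N v /\ `|x - v| <= inf D + n.+1%:R^-1.
  have n0 : 0 < n.+1%:R^-1 :> R by rewrite invr_gt0.
  have [_ [v Nv ->] /ltW hv] := inf_adherent n0 (conj D0 Dlb).
  by exists v.
have Nv n := (hv n).1; have dv n := (hv n).2.
have vB n : `|v n| <= `|x| + (inf D + 1).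
  rewrite -(subrK x (v n)) addrC (le_trans (ler_normD _ _))// lerD2l distrC.
  by rewrite (le_trans (dv n))// lerD2l invf_le1 ?ler1n.
have [phi [l [phin Nl vl _]]] := fix_bounded_cvg Nv vB.
exists l; split => // w Nw.
have dl : `|x - l| <= inf D.
  rewrite -subr_le0; apply: (@le0_eps _ _ 2) => d d0.
  have /cvgn_distP/(_ d d0)[n1 hn1] := vl.
  have [n2 _ hn2] := near_infty_natSinv_lt (PosNum d0).
  pose n := maxn n1 n2; rewrite lerBlDl -(subrK (v (phi n)) x) -addrA.
  rewrite (le_trans (ler_normD _ _))// mulr_natl mulr2n addrA lerD//.
    rewrite (le_trans (dv _))// lerD2l ltW//; apply: hn2.
    by rewrite /= (leq_trans _ (phin _))// leq_maxr.
  by rewrite distrC hn1// leq_maxl.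
have key s : 2 * s * ip (x - l) w <= s ^+ 2 * `|w| ^+ 2.
  have : `|x - l| ^+ 2 <= `|x - l - s *: w| ^+ 2.
    rewrite ler_pXn2r ?nnegrE// (le_trans dl)// -addrA -opprD; apply: dle.
    by have := fix_lin s Nw (fix_lin (-1) Nl N0); rewrite subr0 scaleN1r opprK addrC.
  rewrite (normD_sqr ipP (x - l)) -scaleNr (ipZr ipP) normrZ normrN exprMn real_normK ?num_real//.
  lra.
apply/eqP; rewrite -sqrf_eq0; apply/eqP.
set a := ip _ _ in key *; set W := `|w| ^+ 2 in key.
have W0 : 0 <= W by rewrite exprn_ge0.
(* This step makes the linear gain exceed the quadratic loss unless [a = 0]; [W + 1] instead of [W]
   also covers [w = 0]. *)
have := key (a / (W + 1)).
have W1 : 0 < W + 1 by rewrite ltr_wpDl.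
have -> : 2 * (a / (W + 1)) * a = a ^+ 2 * (2 / (W + 1)) by ring.
have -> : (a / (W + 1)) ^+ 2 * W = a ^+ 2 * (W / (W + 1) ^+ 2) by field; rewrite gt_eqF.
have lt : W / (W + 1) ^+ 2 < 2 / (W + 1).
  rewrite ltr_pdivrMr ?exprn_gt0// expr2 mulrA divfK ?gt_eqF//; lra.
move=> h; apply/eqP; rewrite eq_le sqr_ge0 andbT leNgt; apply/negP => a0.
by move: h; rewrite ler_pM2l// leNgt lt.
Qed.

Definition proj (x : X) : X := projT1 (cid (exists_proj x)).

Lemma proj_fix x : N (proj x). Proof. by rewrite /proj; case: cid => v []. Qed.

Lemma proj_perp x : M (x - proj x). Proof. by rewrite /proj; case: cid => v []. Qed.

Lemma proj_unique x v : N v -> M (x - v) -> proj x = v.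
Proof.
move=> Nv Mv; apply/eqP; rewrite -subr_eq0 -normr_eq0 -sqrf_eq0 -(ipxx ipP).
have Nw : N (proj x - v) by have := fix_lin 1 (proj_fix x) Nv; rewrite scale1r.
have E : proj x - v = (x - v) - (x - proj x) by rewrite opprB [RHS]addrC addrA subrK.
by rewrite {1}E (ipBl ipP) Mv// proj_perp// subrr.
Qed.

Lemma proj_id v : N v -> proj v = v.
Proof. by move=> Nv; apply: proj_unique => // w _; rewrite subrr (ip0l ipP). Qed.

Lemma proj_lin a x y : proj (a *: x - y) = a *: proj x - proj y.
Proof.
apply: proj_unique; first by apply: fix_lin; exact: proj_fix.
rewrite (_ : _ - _ = a *: (x - proj x) - (y - proj y)).
  by apply: perp_lin; exact: proj_perp.
by rewrite scalerBr !opprB [proj y - a *: _]addrC addrACA [- y + _]addrC.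
Qed.

Lemma projB x y : proj (x - y) = proj x - proj y.
Proof. by have := proj_lin 1 x y; rewrite !scale1r. Qed.

Lemma proj0 : proj 0 = 0. Proof. by rewrite -{1}(subrr 0) projB subrr. Qed.

Lemma projZ a x : proj (a *: x) = a *: proj x.
Proof. by have := proj_lin a x 0; rewrite proj0 !subr0. Qed.

Lemma norm_proj_sqr x : `|x| ^+ 2 = `|proj x| ^+ 2 + `|x - proj x| ^+ 2.
Proof.
rewrite -{1}(subrK (proj x) x) (normD_sqr ipP) (proj_perp _ (proj_fix x)) mulr0 addr0.
exact: addrC.
Qed.

Lemma norm_proj_le x : `|proj x| <= `|x|.
Proof.
by rewrite -(@ler_pXn2r _ 2)// ?nnegrE// (norm_proj_sqr x) lerDl exprn_ge0.
Qed.

Lemma norm_proj_perp_le x : `|x - proj x| <= `|x|.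
Proof.
by rewrite -(@ler_pXn2r _ 2)// ?nnegrE// (norm_proj_sqr x) lerDr exprn_ge0.
Qed.

Let H x := x - G x.

Let HB x y : H (x - y) = H x - H y.
Proof. by rewrite /H GB !opprB [G y - G x]addrC addrACA [- y + _]addrC. Qed.

Let HZ a x : H (a *: x) = a *: H x. Proof. by rewrite /H GZ scalerBr. Qed.

Let HD x y : H (x + y) = H x + H y.
Proof.
have -> : x + y = x - (-1) *: y by rewrite scaleN1r opprK.
by rewrite HB HZ scaleN1r opprK.
Qed.

Lemma perp_H x : M x -> M (H x).
Proof. by move=> Mx v Nv; rewrite (ipBl ipP) GN// Mx// subr0. Qed.

Lemma unit_bounded : bounded_set [set y : X | `|y| <= 1].
Proof.
by exists 1; split; [exact: num_real|move=> y By z /= zB; exact: le_trans zB (ltW By)].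
Qed.

(** Otherwise unit vectors [w n] of [M] have [H (w n)] tending to 0. Along a subsequence [G (w n)]
    converges, hence so does [w n = H (w n) + G (w n)], to a unit vector lying in both [N] and
    [M]. *)
Lemma perp_bounded_below : exists2 c, 0 < c & forall x, M x -> c * `|x| <= `|H x|.
Proof.
apply: contrapT => nc.
have /choice[w hw] n : exists w, [/\ M w, `|w| = 1 & `|H w| <= n.+1%:R^-1].
  apply: contrapT => /forallNP nw; apply: nc; exists n.+1%:R^-1; rewrite ?invr_gt0// => x Mx.
  have [->|x0] := eqVneq x 0; first by rewrite normr0 mulr0.
  have nx : 0 < `|x| by rewrite normr_gt0.
  rewrite leNgt; apply/negP => hx; apply: (nw (`|x|^-1 *: x)); split.
  - have M0 : M 0 by move=> v _; rewrite (ip0l ipP).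
    by have := perp_lin `|x|^-1 Mx M0; rewrite subr0.
  - by rewrite normrZ normfV normr_id mulVf ?gt_eqF.
  - by rewrite HZ normrZ normfV normr_id mulrC ler_pdivrMr// ltW.
have Mw n : M (w n) by have [] := hw n.
have [n|phi [l [phin Gl _]]] := totally_bounded_cvg (x := G \o w) (G_compact unit_bounded).
  by exists (w n) => //=; have [_ ->] := hw n.
have wl : w (phi n) @[n --> \oo] --> l.
  apply/cvgn_distP => e e0; have e2 : 0 < e / 2 by rewrite divr_gt0.
  have /cvgn_distP/(_ _ e2)[n1 hn1] := Gl.
  have [n2 _ hn2] := near_infty_natSinv_lt (PosNum e2).
  exists (maxn n1 n2) => n; rewrite geq_max => /andP[n1n n2n].
  rewrite -(subrK (G (w (phi n))) l) -addrA (splitr e).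
  rewrite (le_trans (ler_normD _ _))// lerD ?hn1// distrC.
  have [_ _ h] := hw (phi n); rewrite (le_trans h)// ltW//; apply: hn2.
  by rewrite /= (leq_trans n2n).
have Gl' : G l = l by exact: (cvg_unique _ (G_cvg wl) Gl).
have Ml : M l by exact: perp_closed wl.
have l0 : `|l| = 0.
  by apply/eqP; rewrite -sqrf_eq0 -(ipxx ipP) Ml.
have /cvgn_distP/(_ _ (divr_gt0 ltr01 (ltr0Sn _ 1)))[n /(_ n (leqnn n))] := wl.
have [_ w1 _] := hw (phi n).
rewrite (normr0_eq0 l0) sub0r normrN w1 mul1r leNgt invf_lt1// ltr1n//.
Qed.

(* Riesz: if [b] is not a value of [H] on [M], the ranges of the powers of [H] on [M]
   decrease strictly; unit vectors in successive ranges, at distance at least [1 / 2] from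
   the next one, have separated images under [G = id - H], which contradicts compactness. *)
Lemma perp_surjective b : M b -> exists w, M w /\ H w = b.
Proof.
move=> Mb; apply: contrapT => /forallNP nb.
have [c c0 hc] := perp_bounded_below.
(* The range of [H] on [M] is closed by the lower bound [c], so a missed [b] is at positive distance
   from it. *)
have [d d0 hd] : exists2 d, 0 < d & forall w, M w -> d <= `|b - H w|.
  apply: contrapT => nd.
  have /choice[w hw] n : exists w, M w /\ `|b - H w| <= n.+1%:R^-1.
    apply: contrapT => /forallNP nw; apply: nd; exists n.+1%:R^-1; rewrite ?invr_gt0// => w Mw.
    by rewrite leNgt; apply/negP => hw; apply: (nw w); split => //; rewrite ltW.
  have [e e0|l wl] := @cauchy_seq_cvg _ _ w.
    have [r r0 hr] := exists_small 2 (mulr_gt0 c0 e0).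
    have [N0 _ hN] := near_infty_natSinv_lt (PosNum r0); exists N0 => n Nn.
    rewrite -(ler_pM2l c0) (le_trans (hc _ _))//.
      by have := perp_lin 1 (hw N0).1 (hw n).1; rewrite scale1r.
    rewrite HB (le_trans _ (ltW hr))// -(subrK b (H (w N0))) -addrA mulr_natl mulr2n.
    rewrite (le_trans (ler_normD _ _))// lerD//.
      by rewrite distrC (le_trans (hw N0).2)// ltW// hN/=.
    by rewrite (le_trans (hw n).2)// ltW// hN.
  apply: (nb l); split; first by apply: perp_closed wl => n; exact: (hw n).1.
  have Hl : H (w n) @[n --> \oo] --> H l by apply: cvgB => //; exact: G_cvg.
  have bl : H (w n) @[n --> \oo] --> b.
    apply/cvgn_distP => e e0; have [N0 _ hN] := near_infty_natSinv_lt (PosNum e0).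
    by exists N0 => n Nn; rewrite (le_trans (hw n).2)// ltW// hN.
  exact: (cvg_unique _ Hl bl).
have MH j w : M w -> M (iter j H w) by move=> Mw; elim: j => //= j; exact: perp_H.
have HjB j x y : iter j H (x - y) = iter j H x - iter j H y.
  by elim: j => //= j ->; rewrite HB.
have HjD j x y : iter j H (x + y) = iter j H x + iter j H y.
  by elim: j => //= j ->; rewrite HD.
have HjZ j a x : iter j H (a *: x) = a *: iter j H x.
  by elim: j => //= j ->; rewrite HZ.
have Hjc j x : M x -> c ^+ j * `|x| <= `|iter j H x|.
  move=> Mx; elim: j => [|j IH]; first by rewrite mul1r.
  rewrite exprS -mulrA (le_trans (ler_wpM2l (ltW c0) IH))//.
  by rewrite iterS hc//; exact: MH.
have Msub x y : M x -> M y -> M (x - y).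
  by move=> Mx My; have := perp_lin 1 Mx My; rewrite scale1r.
have Madd x y : M x -> M y -> M (x + y).
  by move=> Mx My v Nv; rewrite (ipDl ipP) Mx// My// addr0.
have /choice[u hu] j : exists u, [/\ M u, `|iter j H u| = 1 &
    forall w, M w -> 2^-1 <= `|iter j H u - iter j.+1 H w|].
  pose D := [set r | exists2 w, M w & r = `|iter j H (b - H w)|].
  have M0 : M 0 by move=> v _; rewrite (ip0l ipP).
  have DD : D !=set0 by exists `|iter j H (b - H 0)|; exists 0.
  have cd : 0 < c ^+ j * d by rewrite mulr_gt0// exprn_gt0.
  have Dlb : lbound D (c ^+ j * d).
    move=> _ [w Mw ->]; apply: le_trans (Hjc _ _ (Msub _ _ Mb (perp_H Mw))).
    by rewrite ler_pM2l ?exprn_gt0// hd.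
  have D0 : 0 < inf D by rewrite (lt_le_trans cd)//; apply: lb_le_inf.
  (* With tolerance [inf D] itself, the vector found has norm below twice its distance to the next
     range, whence the constant [2^-1] after normalization. *)
  have [_ [w Mw ->] hw] := inf_adherent D0 (conj DD (ex_intro _ _ Dlb)).
  set r := `|iter j H (b - H w)| in hw.
  have rD : inf D <= r by apply: ge_inf; [exists (c ^+ j * d)|exists w].
  have r0 : 0 < r by exact: lt_le_trans rD.
  have Mu : M (b - H w) by apply: Msub => //; exact: perp_H.
  exists (r^-1 *: (b - H w)); split.
  - by have := perp_lin r^-1 Mu M0; rewrite subr0.
  - by rewrite HjZ normrZ normfV -/r (gtr0_norm r0) mulVf ?gt_eqF.
  - move=> w' Mw'.
    have -> : iter j H (r^-1 *: (b - H w)) - iter j.+1 H w' =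
        r^-1 *: iter j H (b - H (w + r *: w')).
      rewrite iterSr -HjB -HjZ; congr (iter j H _).
      by rewrite (HD w) (HZ r) (opprD (H w)) addrA (scalerBr r^-1 (b - H w)) scalerA mulVf ?gt_eqF// scale1r.
    rewrite normrZ gtr0_norm ?invr_gt0// mulrC ler_pdivlMr// ler_pdivrMl//.
    rewrite (@le_trans _ _ (2 * inf D))//; first by rewrite ltW// mulr_natl mulr2n.
    rewrite ler_pM2l//; apply: ge_inf; first by exists (c ^+ j * d).
    exists (w + r *: w') => //.
    by have := Msub _ _ Mw (perp_lin (- r) Mw' M0); rewrite subr0 scaleNr opprK.
pose e j := iter j H (u j).
have sep j k : (j < k)%N -> 2^-1 <= `|G (e j) - G (e k)|.
  move=> jk; have [Muj _ huj] := hu j; have [Muk _ _] := hu k.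
  (* Chosen so that [iter j.+1 H w] equals [H (e j) + e k - H (e k)], which collects everything but
     [e j] in [G (e j) - G (e k)], up to sign. *)
  pose w := u j + iter (k - j.+1) H (u k) - iter (k - j) H (u k).
  have Mw : M w.
    by apply: (Msub _ _ _ (MH _ _ Muk)); apply: Madd => //; exact: MH.
  have -> : G (e j) - G (e k) = iter j H (u j) - iter j.+1 H w; last exact: huj.
  have -> : iter j.+1 H w = H (e j) + e k - H (e k).
    rewrite /w (HjB j.+1) (HjD j.+1) -!(iterD j.+1).
    by rewrite subnKC// [(j.+1 + _)%N]addSn subnKC// ltnW.
  have GE x : G x = x - H x by rewrite opprB addrC subrK.
  rewrite (GE (e j)) (GE (e k)) !opprD !opprK -/(e j).
  by rewrite !addrA.
have [||phi [phin hphi]] := finite_nets_cauchy (x := G \o e) _ (G_compact unit_bounded).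
- move=> x y z r xz yz; rewrite -(subrK z x) -addrA mulr_natl mulr2n.
  by rewrite (le_trans (ler_normD _ _))// lerD// distrC.
- by move=> n; exists (e n) => //=; have [_ ->] := hu n.
(* The second index lies beyond [phi 2], so the two terms are distinct, yet closer than
   [2^-1 ^+ 2 < 2^-1]. *)
have := hphi 2%N (maxn 2 (phi 2%N).+1) (leq_maxl _ _).
rewrite /= leNgt => /negP; apply.
apply: lt_le_trans (sep _ _ _).
  by rewrite expr2 gtr_pMl ?invr_gt0// invf_lt1// ltr1n.
by rewrite (leq_trans _ (phin _))// leq_maxr.
Qed.

End fredholm.

(** * Periodic solutions of an abstract equation *)

Section clamp.
Variables (R : realType) (T : R).
Hypothesis T0 : 0 <= T.

(** Retraction onto [[0, T]]: paths become functions on the whole line, so uniform distances and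
    continuity need no restriction of the domain. *)
Definition clamp (t : R) := Num.min (Num.max t 0) T.

Lemma clamp_ge0 t : 0 <= clamp t.
Proof. by rewrite /clamp le_min T0 max0_ge0. Qed.

Lemma clamp_le t : clamp t <= T.
Proof. by rewrite /clamp ge_min lexx orbT. Qed.

Lemma clamp_id t : 0 <= t -> t <= T -> clamp t = t.
Proof. by move=> t0 tT; rewrite /clamp (max_idPl t0) (min_idPl tT). Qed.

Lemma clampK t : clamp (clamp t) = clamp t.
Proof. by rewrite clamp_id ?clamp_ge0 ?clamp_le. Qed.

Lemma clamp_dist t s : `|clamp t - clamp s| <= `|t - s|.
Proof.
apply: le_trans (dist_max0 t s); rewrite /clamp.
move: (Num.max t 0) (Num.max s 0) => a b; rewrite /Num.min.
case: ltP => aT; case: ltP => bT; rewrite ?subrr ?normr0//.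
- rewrite distrC ger0_norm ?subr_ge0 ?(ltW aT)// distrC ger0_norm ?subr_ge0.
    by rewrite lerD2r.
  by rewrite ltW// (lt_le_trans aT).
- rewrite ger0_norm ?subr_ge0 ?(ltW bT)// ger0_norm ?subr_ge0; first by rewrite lerD2r.
  by rewrite ltW// (lt_le_trans bT).
Qed.

End clamp.

Section ascoli.
Variables (R : realType) (X : normedModType R) (T : R).
Hypothesis T0 : 0 <= T.

(* Functions are extended from [0, T] by constants: their values at the nodes of
   a fine grid, up to [e], determine them up to [3 * e]. *)
Lemma ascoli_nets (E : set (R -> X)) (V : set X) :
  (forall f t, E f -> f t = f (clamp T t)) ->
  (forall f t, E f -> V (f t)) -> totally_bounded V ->
  (forall e : R, 0 < e -> exists2 d, 0 < d & forall f s t, E f ->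
     0 <= s -> s <= T -> 0 <= t -> t <= T -> `|s - t| <= d -> `|f s - f t| <= e) ->
  forall e : R, 0 < e -> exists m (y : nat -> R -> X), (forall i, (i < m)%N -> E (y i)) /\
    forall f, E f -> exists2 i, (i < m)%N & forall t, `|f t - y i t| <= e.
Proof.
move=> Ecl EV tV Eeq e e0; have e4 : 0 < e / 4 by rewrite divr_gt0.
have [d d0 hd] := Eeq _ e4; have [k [z hz]] := tV _ e4.
have [c c0 hc] := exists_small T d0.
have [n nc] : exists n, n.+1%:R^-1 < c.
  by have /filter_ex[n] := near_infty_natSinv_lt (PosNum c0); exists n.
set h := T / n.+1%:R.
have h0 : 0 <= h by rewrite divr_ge0.
have hd' : h <= d by rewrite (le_trans _ (ltW hc))// ler_wpM2l// ltW.
pose node (i : 'I_n.+1) := i%:R * h.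
have nodeT (i : 'I_n.+1) : 0 <= node i /\ node i <= T.
  split; first by rewrite mulr_ge0.
  rewrite (_ : T = n.+1%:R * h); last by rewrite /h mulrC divfK.
  by rewrite ler_wpM2r// ler_nat ltnW.
have near_node t : 0 <= t -> t <= T -> exists i, `|t - node i| <= d.
  move=> t0 tT; have [Tz|Tp] := eqVneq T 0.
    exists ord0; rewrite /node mul0r subr0 ger0_norm// (le_trans tT)// Tz.
    exact: ltW.
  have hp : 0 < h by rewrite divr_gt0// lt_neqAle eq_sym Tp.
  have th : 0 <= t / h by rewrite divr_ge0.
  have /andP[k1 k2] := truncn_itv th; set j := Num.truncn _ in k1 k2.
  rewrite ler_pdivlMr// in k1; rewrite ltr_pdivrMr// in k2.
  have [jn|nj] := ltnP j n.+1.
    exists (Ordinal jn); rewrite /node /= ger0_norm ?subr_ge0// (le_trans _ hd')//.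
    by rewrite lerBlDl -[X in _ + X]mul1r -mulrDl natr1 ltW.
  exists ord_max; have tE : t = T.
    apply/le_anti; rewrite tT /= (le_trans _ k1)//.
    rewrite -[leLHS](_ : n.+1%:R * h = T); last by rewrite /h mulrC divfK.
    by rewrite ler_wpM2r// ler_nat.
  rewrite tE /node /= -{1}(_ : n.+1%:R * h = T); last by rewrite /h mulrC divfK.
  by rewrite -mulrBl -natr1 [_ + 1]addrC addrK mul1r ger0_norm.
(* a code records which centers approximate the values at the nodes *)
pose code := {ffun 'I_n.+1 -> 'I_k}.
pose good (a : code) f := E f /\ forall i, `|f (node i) - z (a i)| <= e / 4.
have /choice[rep hrep] (a : code) : exists f, (exists g, good a g) -> good a f.
  by have [[g hg]|ng] := pselect (exists g, good a g); [exists g|exists (fun=> 0) => /ng].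
pose codes := [seq a <- enum code | `[< exists g, good a g >]].
have codesP a : reflect (exists g, good a g) (a \in codes).
  by rewrite mem_filter mem_enum andbT; exact: asboolP.
exists (size codes), (fun i => nth (fun=> 0) (map rep codes) i); split => [i im|f Ef].
  have [a ac ->] : exists2 a, a \in codes & nth (fun=> 0) (map rep codes) i = rep a.
    case: codes im {codesP} => [//|a0 l] im.
    by exists (nth a0 (a0 :: l) i); [exact: mem_nth|rewrite (nth_map a0)].
  by have /codesP/hrep[] := ac.
have /choice[a ha] i : exists a : 'I_k, `|f (node i) - z a| <= e / 4.
  by have [a ak az] := hz _ (EV f (node i) Ef); exists (Ordinal ak).
have ga : good (finfun a) f by split => // i; rewrite ffunE.
have ac : finfun a \in codes by apply/codesP; exists f.
exists (index (finfun a : code) codes); first by rewrite index_mem.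
move=> t; rewrite (nth_map (finfun a)) ?index_mem// nth_index//.
have [Er hr] := hrep _ (ex_intro _ f ga); set g := rep _ in Er hr *.
rewrite (Ecl f)// (Ecl g)//; move: (clamp_ge0 T0 t) (clamp_le T t).
move: (clamp T t) => {}t t0 tT; have [i ti] := near_node t t0 tT.
have [n0 nT] := nodeT i.
have h1 : `|f t - f (node i)| <= e / 4 by exact: hd.
have h2 : `|g t - g (node i)| <= e / 4 by exact: hd.
have h3 := ha i; have := hr i; rewrite ffunE => h4.
have -> : f t - g t = (f t - f (node i)) + (f (node i) - z (a i)) +
    ((z (a i) - g (node i)) + (g (node i) - g t)).
  by rewrite !addrA !subrK.
rewrite (_ : e = (e / 4 + e / 4) + (e / 4 + e / 4)); last by field.
rewrite (le_trans (ler_normD _ _))//; apply: lerD; rewrite (le_trans (ler_normD _ _))//;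
  apply: lerD => //; by rewrite distrC.
Qed.

End ascoli.

(** * The Duhamel integral and its compactness *)

Section convolution.
Variables (R : realType) (X : completeNormedModType R) (ip : X -> X -> R).
Hypothesis ipP : is_inner ip.
Variable K : R -> X -> X.
Hypothesis KC0 : C0_semigroup K.
Implicit Types (s t h : R) (g : R -> X).

Definition conv g t := integral ip 0 t (fun s => sgp K (t - s) (g s)).

Lemma sgp_id t x : 0 <= t -> sgp K t x = K t x.
Proof. by move=> t0; rewrite /sgp (max_idPl t0). Qed.

Lemma conv0 g : continuous g -> conv g 0 = 0.
Proof.
move=> cg; apply/eqP; rewrite -normr_le0.
have := @integral_le _ _ ip ipP 0 0 _ `|sgp K (0 - 0) (g 0)| (sgp_continuous KC0 (c := 0) cg) (lexx 0).
rewrite subrr mul0r; apply => s /andP[s0 s1].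
by rewrite (@le_anti _ _ s 0) ?s0 ?s1// subrr.
Qed.

Lemma continuous_shift g t : continuous g -> continuous (fun s => g (t + s)).
Proof.
move=> cg s; apply: continuous_comp; last exact: cg.
by apply: cvgD; [exact: cvg_cst|exact: cvg_id].
Qed.

(** Restarting the equation at time [t]. This identity yields compactness, equicontinuity and the
    extension over several periods. *)
Lemma convD g t h : continuous g -> 0 <= t -> 0 <= h ->
  conv g (t + h) = K h (conv g t) + conv (fun s => g (t + s)) h.
Proof.
move=> cg t0 h0; have tth : t <= t + h by rewrite lerDl.
rewrite /conv (integralD ipP (sgp_continuous KC0 (c := t + h) cg) t0 tth); congr (_ + _).
  rewrite (integral_map ipP (sg_linear KC0 h0) (sg_op_continuous KC0 h0)
    (sgp_continuous KC0 (c := t) cg) t0).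
  apply: eq_integral_segment => s /andP[s0 st].
  have ts : 0 <= t - s by rewrite subr_ge0.
  have -> : t + h - s = h + (t - s) by ring.
  have hts : 0 <= h + (t - s) by rewrite addr_ge0.
  by rewrite /= (sgp_id _ hts) (sgp_id _ ts) (sgD KC0).
have := integral_shift ipP (a := 0) (b := h) t (sgp_continuous KC0 (c := t + h) cg) h0.
rewrite add0r (addrC h) => ->; apply: eq_integral_segment => s _.
by rewrite [s + t]addrC opprD addrACA subrr add0r.
Qed.

Lemma conv_le g t C m : continuous g -> 0 <= t ->
  (forall s x, 0 <= s -> s <= t -> `|K s x| <= C * `|x|) -> 0 <= C ->
  (forall s, 0 <= s -> `|g s| <= m) -> `|conv g t| <= t * (C * m).
Proof.
move=> cg t0 hC C0 gm.
have := @integral_le _ _ ip ipP 0 t _ (C * m) (sgp_continuous KC0 (c := t) cg) t0.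
rewrite subr0; apply => s /andP[s0 st]; have ts : 0 <= t - s by rewrite subr_ge0.
by rewrite sgp_id// (le_trans (hC _ _ _ _))// ?gerBl// ler_wpM2l// gm.
Qed.

Lemma convB g g' t : continuous g -> continuous g' -> 0 <= t ->
  conv g t - conv g' t = conv (fun s => g s - g' s) t.
Proof.
move=> cg cg' t0.
rewrite /conv -(integralB ipP (sgp_continuous KC0 (c := t) cg) (sgp_continuous KC0 (c := t) cg') t0).
by apply: eq_integral_segment => s _; rewrite /sgp (sgB KC0)// max0_ge0.
Qed.

Lemma conv_ext g g' t : (forall s, 0 <= s <= t -> g s = g' s) -> conv g t = conv g' t.
Proof. by move=> h; apply: eq_integral_segment => s /h ->. Qed.

(** Strong continuity is uniform on the finitely many centers of a net and spreads to [B] by the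
    bound on [K] over [[0, 1]], hence [D <= 1]. *)
Lemma sg_unif_near0 (B : set X) e : totally_bounded B -> 0 < e ->
  exists2 d, 0 < d & forall h x, 0 <= h -> h <= d -> B x -> `|K h x - x| <= e.
Proof.
move=> tB e0; have [C C1 hC] := sg_bound KC0 1.
have e2 : 0 < e / 2 by rewrite divr_gt0.
have [r r0 hr] := exists_small (C + 1) e2; have [m [y hy]] := tB _ r0.
have /choice[d hd] i : exists d, 0 < d /\ forall t, 0 <= t -> t < d -> `|K t (y i) - y i| <= e / 2.
  by have [d d0 h] := sg_near0 KC0 (y i) e2; exists d.
have [D [D0 D1 Dd]] : exists D, [/\ 0 < D, D <= 1 & forall i, (i < m)%N -> D < d i].
  elim: m {hy} => [|m [D [D0 D1 hD]]]; first by exists 1.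
  have d2 : 0 < d m / 2 by rewrite divr_gt0//; exact: (hd m).1.
  exists (Num.min D (d m / 2)); split => [||i].
  - by rewrite lt_min D0.
  - by rewrite ge_min D1.
  - rewrite ltnS leq_eqVlt => /predU1P[->|im].
      by rewrite gt_min ltr_pdivrMr// ltr_pMr ?(hd m).1// ltr1n orbT.
    by rewrite gt_min hD.
exists D => // h x h0 hD /hy[i im xi].
have -> : K h x - x = K h (x - y i) + (K h (y i) - y i) + (y i - x).
  by rewrite (sgB KC0)// !addrA !subrK.
rewrite -addrA addrCA (le_trans (ler_normD _ _))// (splitr e) lerD//.
  by apply: (hd i).2 => //; rewrite (le_lt_trans hD) ?Dd.
rewrite (le_trans _ (ltW hr))// mulrDl mul1r (le_trans (ler_normD _ _))// lerD//.
  rewrite (le_trans (hC _ _ _ _)) ?(le_trans hD)// ler_wpM2l//.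
  exact: le_trans C1.
by rewrite distrC.
Qed.

Lemma sg_orbit_totally_bounded (B : set X) T : totally_bounded B -> 0 <= T ->
  totally_bounded [set z | exists2 x, B x & exists2 t : R, 0 <= t <= T & z = K t x].
Proof.
move=> tB T0 e e0; have [C C1 hC] := sg_bound KC0 T.
have C0 : 0 <= C by exact: le_trans C1.
have [r r0 hr] := exists_small (2 * C) e0; have [d d0 hd] := sg_unif_near0 tB r0.
have [m [y hy]] := tB _ r0.
exists ((Num.truncn (T / d)).+1 * m)%N, (fun i => K ((i %/ m)%:R * d) (y (i %% m)%N)).
move=> _ [x Bx [t /andP[t0 tT] ->]]; have [j jm xj] := hy x Bx.
have m0 : (0 < m)%N by exact: leq_trans jm.
have /andP[k1 k2] : (Num.truncn (t / d))%:R <= t / d < (Num.truncn (t / d)).+1%:R.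
  by rewrite truncn_itv// divr_ge0// ltW.
have kT : (Num.truncn (t / d) <= Num.truncn (T / d))%N.
  by apply: le_truncn; rewrite ler_pM2r// invr_gt0.
move: (Num.truncn (t / d)) k1 k2 kT => k k1 k2 kT; exists (k * m + j)%N.
  have : (k.+1 * m <= (Num.truncn (T / d)).+1 * m)%N by rewrite leq_mul2r ltnS kT orbT.
  by apply: leq_trans; rewrite mulSn addnC ltn_add2r.
rewrite divnMDl// divn_small// addn0 modnMDl modn_small//.
rewrite ler_pdivlMr// in k1; rewrite ltr_pdivrMr// in k2.
have kd : 0 <= k%:R * d by rewrite mulr_ge0// ltW.
have tk : 0 <= t - k%:R * d by rewrite subr_ge0.
have -> : K t x - K (k%:R * d) (y j) =
    K (k%:R * d) ((K (t - k%:R * d) x - x) + (x - y j)).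
  by rewrite addrA subrK (sgB KC0)// -(sgD KC0)// subrKC.
rewrite (le_trans (hC _ _ _ _))// ?(le_trans k1)// (le_trans _ (ltW hr))//.
rewrite [2 * C]mulrC -mulrA ler_wpM2l//.
have -> : 2 * r = r + r by ring.
rewrite (le_trans (ler_normD _ _))// lerD//; apply: hd => //.
by rewrite lerBlDl -[X in _ + X]mul1r -mulrDl natr1 ltW.
Qed.

(** The integral up to [t - d], pushed forward by the compact [K d], lies in a fixed totally bounded
    set; the remaining piece has length [d] and is small. *)
Lemma conv_totally_bounded (m T : R) : 0 <= T ->
  (forall B t, bounded_set B -> 0 < t -> totally_bounded (K t @` B)) ->
  totally_bounded [set z | exists g t, [/\ continuous g, forall s, 0 <= s -> `|g s| <= m,
    0 <= t <= T & z = conv g t]].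
Proof.
move=> T0 Kc; apply: totally_bounded_approx => e e0.
have [C C1 hC] := sg_bound KC0 T; have C0 : 0 <= C by exact: le_trans C1.
have [d d0 hd] := exists_small (C * m) e0.
pose B := [set x : X | `|x| <= T * (C * m)].
have bB : bounded_set B.
  by exists (T * (C * m)); split; [exact: num_real|move=> b Bb x /= xB; exact: le_trans xB (ltW Bb)].
exists (K d @` B); split; first exact: Kc.
move=> _ [g [t [cg gm /andP[t0 tT] ->]]].
have m0 : 0 <= m by rewrite (le_trans _ (gm 0 (lexx 0))).
have hCt t' : t' <= T -> forall s x, 0 <= s -> s <= t' -> `|K s x| <= C * `|x|.
  by move=> tT' s x s0 st; apply: hC => //; exact: le_trans tT'.
have [td|/ltW dt] := leP t d.
  (* For [t] below [d] the whole integral is small, and 0, written as [K d 0], approximates it. *)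
  exists (K d 0).
    exists 0 => //; rewrite /B /= normr0; exact: mulr_ge0 T0 (mulr_ge0 C0 m0).
  rewrite (sg00 KC0) ?(ltW d0)// subr0 (le_trans (conv_le cg t0 (hCt _ tT) C0 gm))//.
  by rewrite (le_trans _ (ltW hd))// mulrC ler_wpM2l// mulr_ge0.
have td0 : 0 <= t - d by rewrite subr_ge0.
have tdT : t - d <= T by rewrite (le_trans _ tT)// gerBl ltW.
exists (K d (conv g (t - d))).
  exists (conv g (t - d)) => //; rewrite /B /=.
  rewrite (le_trans (conv_le cg td0 (hCt _ tdT) C0 gm))// ler_wpM2r// mulr_ge0//.
have -> : conv g t = K d (conv g (t - d)) + conv (fun s => g (t - d + s)) d.
  by rewrite -(convD cg td0 (ltW d0)) subrK.
rewrite addrAC subrr add0r.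
have dT : d <= T by exact: le_trans tT.
rewrite (le_trans (conv_le (continuous_shift (t := t - d) cg) (ltW d0) (hCt _ dT) C0 (m := m) _))//.
  by move=> s s0; apply: gm; rewrite addr_ge0.
by rewrite mulrC ltW.
Qed.

End convolution.

(** * The Lyapunov-Schmidt map on paths *)

Section fixed_point_map.
Variables (R : realType) (X : completeNormedModType R) (ip : X -> X -> R).
Hypothesis ipP : is_inner ip.
Variables (K : R -> X -> X) (T C : R).
Hypotheses (KC0 : C0_semigroup K) (T_gt0 : 0 < T) (C_ge1 : 1 <= C).
Hypothesis K_le : forall t x, 0 <= t -> t <= T -> `|K t x| <= C * `|x|.
Hypothesis K_compact :
  forall B t, bounded_set B -> 0 < t -> totally_bounded (K t @` B).

Let N := [set x | K T x = x].
Let M := [set x | forall v, N v -> ip x v = 0].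

Hypothesis K_fix : forall v t, N v -> 0 <= t -> K t v = v.
Hypothesis K_ip : forall v t x, N v -> 0 <= t -> ip (K t x) v = ip x v.

Variables (Q W : X -> X) (c : R).
Hypotheses (Q_fix : forall x, N (Q x)) (Q_perp : forall x, M (x - Q x)).
Hypotheses (QB : forall x y, Q (x - y) = Q x - Q y) (QZ : forall a x, Q (a *: x) = a *: Q x).
Hypotheses (Q_id : forall v, N v -> Q v = v) (Q0 : forall x, M x -> Q x = 0).
Hypotheses (Q_le : forall x, `|Q x| <= `|x|) (Q_perp_le : forall x, `|x - Q x| <= `|x|).
Hypotheses (c_gt0 : 0 < c) (c_le : forall x, M x -> c * `|x| <= `|x - K T x|).
Hypothesis WP : forall b, M b -> M (W b) /\ W b - K T (W b) = b.

Variables (F : R -> X -> X) (m L : R).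
Hypothesis F_cont : forall u, continuous u -> continuous (fun s => F s (u s)).
Hypothesis F_le : forall s x, 0 <= s -> `|F s x| <= m.
Hypothesis F_lip : forall s x y, 0 <= s -> `|F s x - F s y| <= L * `|x - y|.

Let forcing (u : R -> X) s := F s (u s).
Let I u := integral ip 0 T (forcing u).
Let b u := conv ip K (forcing u) T.
Let w u := W (b u - Q (b u)).
Let B := T * (C * m).
(** Largest distance of an image path from its N-component: [C * (B / c)] bounds [K t (w u)], and
    [B] bounds the Duhamel integral. *)
Let rho1 := C * (B / c) + B.

Variables (sg eps delta R0 : R).
Hypotheses (sg1 : `|sg| = 1) (eps_gt0 : 0 < eps) (R0_ge1 : 1 <= R0).
Hypothesis eps_le : eps * (T * m) ^+ 2 <= delta.
Hypothesis LL : forall u v, continuous u -> N v -> R0 <= `|v| ->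
  (forall t, 0 <= t <= T -> `|u t - v| <= rho1) ->
  delta * `|v| <= sg * ip (I u) v.

Let v u := Q (u 0) - (sg * eps) *: Q (I u).
Let Phi u t := K (clamp T t) (v u + w u) + conv ip K (forcing u) (clamp T t).
Let rho := R0 + eps * (T * m).

(** The center [Q (u 0)] of the tube depends linearly on [u], which makes the set convex; [rho]
    leaves room above [R0] for one step of length at most [eps * (T * m)]. *)
Let E := [set u : R -> X | [/\ continuous u, `|Q (u 0)| <= rho &
  forall t, `|u t - Q (u 0)| <= rho1]].

Let T_ge0 : 0 <= T. Proof. exact: ltW. Qed.
Let C_ge0 : 0 <= C. Proof. exact: le_trans C_ge1. Qed.
Let m_ge0 : 0 <= m. Proof. by rewrite (le_trans _ (F_le 0 (lexx 0))). Qed.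
Let B_ge0 : 0 <= B. Proof. by rewrite !mulr_ge0. Qed.
Let K_le' t : t <= T -> forall s x, 0 <= s -> s <= t -> `|K s x| <= C * `|x|.
Proof. by move=> tT s x s0 st; apply: K_le => //; exact: le_trans tT. Qed.
Let QD x y : Q (x + y) = Q x + Q y.
Proof.
have -> : x + y = x - (-1) *: y by rewrite scaleN1r opprK.
by rewrite QB QZ scaleN1r opprK.
Qed.

Lemma conv_forcing_le u t : continuous u -> 0 <= t -> t <= T ->
  `|conv ip K (forcing u) t| <= B.
Proof.
move=> cu t0 tT; rewrite (le_trans (conv_le ipP KC0 (F_cont cu) t0 (K_le' tT) C_ge0 (m := m) _))//.
  by move=> s s0; exact: F_le.
by rewrite ler_wpM2r// mulr_ge0.
Qed.

Lemma I_le u : continuous u -> `|I u| <= T * m.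
Proof.
move=> cu; have := @integral_le _ _ ip ipP 0 T _ m (F_cont cu) T_ge0.
by rewrite subr0; apply => s /andP[s0 _]; exact: F_le.
Qed.

Lemma wP u : M (w u) /\ w u - K T (w u) = b u - Q (b u).
Proof. exact/WP/Q_perp. Qed.

Lemma w_le u : continuous u -> `|w u| <= B / c.
Proof.
move=> cu; have [Mw wE] := wP u; rewrite ler_pdivlMr// mulrC (le_trans (c_le Mw))//.
by rewrite wE (le_trans (Q_perp_le _))// conv_forcing_le.
Qed.

Lemma Q_v u : Q (v u) = v u.
Proof. by apply: Q_id; rewrite /v /N /= (sgB KC0)// (sgZ KC0)// !Q_fix. Qed.

Lemma v_fix u : N (v u). Proof. by rewrite -(Q_v u). Qed.

Lemma Phi_split u t : Phi u t = v u + (K (clamp T t) (w u) + conv ip K (forcing u) (clamp T t)).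
Proof.
by rewrite /Phi (sg_add KC0) ?clamp_ge0// K_fix ?clamp_ge0 ?addrA//; exact: v_fix.
Qed.

Lemma Phi_v_le u t : continuous u -> `|Phi u t - v u| <= rho1.
Proof.
move=> cu; rewrite Phi_split addrAC subrr add0r (le_trans (ler_normD _ _))// lerD//.
  rewrite (le_trans (K_le _ _ _)) ?clamp_ge0 ?clamp_le// ler_wpM2l//; exact: w_le.
by apply: conv_forcing_le; rewrite ?clamp_ge0 ?clamp_le.
Qed.

Lemma Q_Phi0 u : continuous u -> Q (Phi u 0) = v u.
Proof.
move=> cu; rewrite Phi_split clamp_id// (conv0 ipP KC0 (F_cont cu)) addr0 (sg0 KC0).
by rewrite QD Q_v Q0 ?addr0//; exact: (wP u).1.
Qed.

(** Below [R0] the step is too short to leave the ball. Above it, with [q = Q (u 0)], expanding the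
    square changes [|q| ^+ 2] by at most [- 2 * eps * delta * |q| + eps * delta], which is negative
    or zero because [1 <= R0 <= |q|]. *)
Lemma v_le u : E u -> `|v u| <= rho.
Proof.
move=> [cu u0 ul].
have Ig : `|(sg * eps) *: Q (I u)| <= eps * (T * m).
  rewrite normrZ normrM sg1 mul1r gtr0_norm// ler_pM2l// (le_trans (Q_le _))//.
  exact: I_le.
have [Qs|/ltW Ql] := leP `|Q (u 0)| R0.
  by rewrite (le_trans (ler_normB _ _))// lerD.
apply: le_trans _ u0; rewrite -(@ler_pXn2r _ 2)// ?nnegrE//.
have h := LL cu (Q_fix (u 0)) Ql (fun t _ => ul t).
have hQ : ip (Q (I u)) (Q (u 0)) = ip (I u) (Q (u 0)).
  apply/eqP; rewrite eq_sym -subr_eq0 -(ipBl ipP); apply/eqP.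
  exact: (Q_perp (I u) (Q_fix (u 0))).
rewrite /v -scaleNr (normD_sqr ipP) (ipZr ipP) (ipC ipP) hQ scaleNr normrN.
have h2 : `|(sg * eps) *: Q (I u)| ^+ 2 <= eps * (eps * (T * m) ^+ 2).
  rewrite mulrA -expr2 -exprMn ler_pXn2r// nnegrE// !mulr_ge0// ltW//.
have h3 : eps * (eps * (T * m) ^+ 2) <= eps * delta by rewrite ler_pM2l.
have d0 : 0 <= delta.
  by apply: le_trans eps_le; rewrite mulr_ge0 ?exprn_ge0 ?mulr_ge0 ?(ltW eps_gt0).
have h4 : delta * 1 <= delta * `|Q (u 0)|.
  by rewrite ler_wpM2l// (le_trans R0_ge1).
have h5 : eps * delta <= eps * (sg * ip (I u) (Q (u 0))).
  by rewrite ler_pM2l// (le_trans _ h)// -[leLHS]mulr1.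
have h6 : 0 <= eps * delta by rewrite mulr_ge0 ?(ltW eps_gt0).
rewrite -addrA gerDl.
have -> : 2 * (- (sg * eps) * ip (I u) (Q (u 0))) = - 2 * (eps * (sg * ip (I u) (Q (u 0)))) by ring.
lra.
Qed.

Lemma conv_forcing_lip u u' e : continuous u -> continuous u' -> (forall t, `|u t - u' t| <= e) ->
  forall t, 0 <= t -> t <= T ->
  `|conv ip K (forcing u) t - conv ip K (forcing u') t| <= T * (C * (`|L| * e)).
Proof.
move=> cu cu' ue t t0 tT; have e0 : 0 <= e by exact: le_trans (ue 0).
rewrite (convB ipP KC0 (F_cont cu) (F_cont cu') t0).
rewrite (le_trans (conv_le ipP KC0 _ t0 (K_le' tT) C_ge0 (m := `|L| * e) _))//.
- by move=> s; apply: cvgB; [exact: (F_cont cu)|exact: (F_cont cu')].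
- move=> s s0; rewrite (le_trans (F_lip _ _ s0))// (le_trans (ler_wpM2r _ (ler_norm L)))//.
  by rewrite ler_wpM2l.
- by rewrite ler_wpM2r// !mulr_ge0.
Qed.

Lemma Phi_lip : exists La, forall u u' e, continuous u -> continuous u' ->
  (forall t, `|u t - u' t| <= e) -> forall t, `|Phi u t - Phi u' t| <= La * e.
Proof.
exists ((1 + eps * (T * `|L|)) + (C * ((T * (C * `|L|)) / c) + T * (C * `|L|))).
move=> u u' e cu cu' ue t; have e0 : 0 <= e by exact: le_trans (ue 0).
have t0 := clamp_ge0 T_ge0 t; have tT := clamp_le T t.
have cl := conv_forcing_lip cu cu' ue.
rewrite !Phi_split; set k := clamp T t in t0 tT *.
have -> : v u + (K k (w u) + conv ip K (forcing u) k) -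
    (v u' + (K k (w u') + conv ip K (forcing u') k)) =
   (v u - v u') + (K k (w u - w u') + (conv ip K (forcing u) k - conv ip K (forcing u') k)).
  by rewrite (sgB KC0)// !opprD addrACA; congr (_ + _); rewrite addrACA.
rewrite (mulrDl (1 + _)) (mulrDl (C * _)).
rewrite (le_trans (ler_normD _ _))//; apply: lerD; last first.
  rewrite (le_trans (ler_normD _ _))//; apply: lerD; last first.
    by rewrite (le_trans (cl _ t0 tT))// -!mulrA.
  rewrite (le_trans (K_le _ t0 tT))// -mulrA ler_wpM2l//.
  have [Mw wE] := wP u; have [Mw' wE'] := wP u'.
  rewrite mulrAC ler_pdivlMr// mulrC (le_trans (c_le _))//.
    by move=> z Nz; rewrite (ipBl ipP) Mw// Mw'// subr0.
  rewrite (sgB KC0)// opprB.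
  have -> : w u - w u' + (K T (w u') - K T (w u)) = (b u - Q (b u)) - (b u' - Q (b u')).
    by rewrite -wE -wE' opprB addrACA [RHS]addrACA; congr (_ + _); rewrite addrC.
  have -> : b u - Q (b u) - (b u' - Q (b u')) = (b u - b u') - Q (b u - b u').
    by rewrite QB !opprB addrACA [RHS]addrACA; congr (_ + _); rewrite addrC.
  by rewrite (le_trans (Q_perp_le _))// (le_trans (cl _ T_ge0 (lexx T)))// -!mulrA.
have -> : v u - v u' = Q (u 0 - u' 0) - (sg * eps) *: Q (I u - I u').
  rewrite /v !QB scalerBr !opprB addrACA [RHS]addrACA; congr (_ + _).
  by rewrite addrC.
rewrite (mulrDl 1) mul1r (le_trans (ler_normB _ _))//; apply: lerD.
  by rewrite (le_trans (Q_le _)).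
rewrite normrZ normrM sg1 mul1r gtr0_norm// -mulrA ler_pM2l// (le_trans (Q_le _))//.
rewrite /I -(integralB ipP (F_cont cu) (F_cont cu') T_ge0).
have := @integral_le _ _ ip ipP 0 T (fun s => F s (u s) - F s (u' s)) (`|L| * e) _ T_ge0.
rewrite subr0 -mulrA; apply.
  by move=> s; apply: cvgB; [exact: (F_cont cu)|exact: (F_cont cu')].
move=> s /andP[s0 _]; rewrite (le_trans (F_lip _ _ s0))//.
by rewrite (le_trans (ler_wpM2r _ (ler_norm L)))// ler_wpM2l.
Qed.

Let Y := [set z : X | exists (g : R -> X) (t : R), [/\ continuous g, forall s, 0 <= s -> `|g s| <= m,
    0 <= t <= T & z = conv ip K g t]].

Let Y_tb : totally_bounded Y.
Proof. exact: conv_totally_bounded. Qed.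

Let conv_Y u t : continuous u -> 0 <= t -> t <= T -> Y (conv ip K (forcing u) t).
Proof.
move=> cu t0 tT; exists (forcing u), t; split => //; [exact: F_cont| |by rewrite t0].
by move=> s s0; exact: F_le.
Qed.

Let ball_bounded r : bounded_set [set x : X | `|x| <= r].
Proof.
by exists r; split; [exact: num_real|move=> z rz x /= xr; exact: le_trans xr (ltW rz)].
Qed.

Let W0 := [set z | exists2 u : R -> X, continuous u & z = w u].

(** Since [W] comes from a choice, compactness is read off the equation it solves:
    [w u = K T (w u) + (b u - Q (b u))], where both terms range over totally bounded sets. *)
Lemma W0_tb : totally_bounded W0.
Proof.
have t1 := K_compact (ball_bounded (B / c)) T_gt0.
have t2 : totally_bounded ((fun z => z - Q z) @` Y).
  apply: (@totally_bounded_image _ _ _ _ 1) => // x y.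
  rewrite mul1r (_ : x - Q x - (y - Q y) = (x - y) - Q (x - y)) ?Q_perp_le//.
  by rewrite QB !opprB addrACA [RHS]addrACA; congr (_ + _); rewrite addrC.
apply: totally_bounded_subset (totally_bounded_add t1 t2) => _ [u cu ->].
exists (K T (w u)); first by exists (w u) => //; exact: w_le.
exists (b u - Q (b u)); first by exists (b u) => //; exact: conv_Y.
by rewrite -(wP u).2 subrKC.
Qed.

(** Semigroup law and [convD] reduce the increment to the action of [K (s - t)] near time 0, which
    is uniform in [u] on the totally bounded sets [W0] and [Y]; the N-component is constant in
    time. *)
Lemma Phi_equicontinuous e : 0 < e -> exists2 d, 0 < d & forall u s t, continuous u ->
  0 <= s -> s <= T -> 0 <= t -> t <= T -> `|s - t| <= d -> `|Phi u s - Phi u t| <= e.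
Proof.
move=> e0; have [r r0 hr] := exists_small (C + (1 + C * m)) e0.
have [d1 d10 hd1] := sg_unif_near0 KC0 W0_tb r0.
have [d2 d20 hd2] := sg_unif_near0 KC0 Y_tb r0.
exists (Num.min r (Num.min d1 d2)); first by rewrite !lt_min r0 d10.
move=> u s t cu; wlog st : s t / t <= s.
  move=> H s0 sT t0 tT sd; have [/H|/ltW st] := leP t s; first exact.
  by rewrite distrC; apply: H => //; rewrite distrC.
move=> s0 sT t0 tT; rewrite !le_min ger0_norm ?subr_ge0// => /and3P[sr sd1 sd2].
have h0 : 0 <= s - t by rewrite subr_ge0.
have hT : s - t <= T by rewrite (le_trans _ sT)// gerBl.
rewrite !Phi_split !clamp_id// opprD addrACA subrr add0r opprD addrACA.
have -> : conv ip K (forcing u) s = K (s - t) (conv ip K (forcing u) t) +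
    conv ip K (fun z => forcing u (t + z)) (s - t).
  by rewrite -(convD ipP KC0 (F_cont cu) t0 h0) subrKC.
have h1 : `|K s (w u) - K t (w u)| <= C * r.
  rewrite (le_trans (sg_dist KC0 _ K_le s0 sT t0 tT))// ler_wpM2l//.
  by rewrite ger0_norm//; apply: hd1 => //; exists u.
have h2 : `|K (s - t) (conv ip K (forcing u) t) - conv ip K (forcing u) t| <= r.
  by apply: hd2 => //; exact: conv_Y.
have h3 : `|conv ip K (fun z => forcing u (t + z)) (s - t)| <= r * (C * m).
  have cF := continuous_shift (t := t) (F_cont cu).
  rewrite (le_trans (conv_le ipP KC0 cF h0 (K_le' hT) C_ge0 (m := m) _))//.
    by move=> z z0; apply: F_le; rewrite addr_ge0.
  by rewrite ler_wpM2r// mulr_ge0.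
rewrite (le_trans (ler_normD _ _))// (le_trans _ (ltW hr))// mulrDl lerD// addrAC.
rewrite (le_trans (ler_normD _ _))// mulrDl mul1r lerD//.
by rewrite [leRHS]mulrC.
Qed.

Lemma Phi_continuous u : continuous u -> continuous (Phi u).
Proof.
move=> cu s; apply/cvgrPdist_le => e e0; have [d d0 hd] := Phi_equicontinuous e0.
near=> t.
have -> : Phi u s = Phi u (clamp T s) by rewrite /Phi clampK.
have -> : Phi u t = Phi u (clamp T t) by rewrite /Phi clampK.
apply: hd; rewrite ?clamp_ge0 ?clamp_le// (le_trans (clamp_dist _ _ _))// ltW//.
Unshelve. all: by end_near. Qed.

Lemma Phi_E u : E u -> E (Phi u).
Proof.
move=> Eu; have [cu _ _] := Eu; split; first exact: Phi_continuous.
  by rewrite Q_Phi0// v_le.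
by move=> t; rewrite Q_Phi0//; exact: Phi_v_le.
Qed.

Lemma Phi_nets e : 0 < e -> exists k (y : nat -> R -> X), (forall i, (i < k)%N -> E (y i)) /\
  forall u, E u -> exists2 i, (i < k)%N & forall t, `|Phi u t - y i t| <= e.
Proof.
move=> e0.
(* The first summand holds [v u], which is bounded by [rho] and fixed by [K T]; the others hold the
   orbit of [w u] and the Duhamel integral. *)
pose V := [set z : X | exists2 x, [set K T x | x in [set x | `|x| <= rho]] x & exists2 y,
  [set z | exists2 x, [set z | exists2 x, W0 x & exists2 t, 0 <= t <= T & z = K t x] x &
     exists2 y, Y y & z = x + y] y & z = x + y].
have V_tb : totally_bounded V.
  apply: totally_bounded_add; first exact: K_compact (ball_bounded rho) T_gt0.
  apply: totally_bounded_add; last exact: Y_tb.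
  exact: sg_orbit_totally_bounded W0_tb T_ge0.
have [||d d0|k [y [yE hy]]] := @ascoli_nets _ _ _ T_ge0 (Phi @` E) V _ _ V_tb _ e e0.
- by move=> _ t [u Eu <-]; rewrite /Phi clampK.
- move=> _ t [u Eu <-]; have [cu _ _] := Eu; rewrite Phi_split.
  have t0 := clamp_ge0 T_ge0 t; have tT := clamp_le T t.
  exists (v u); first by exists (v u); [exact: v_le|exact: v_fix].
  eexists; last by []; exists (K (clamp T t) (w u)).
    exists (w u); first by exists u.
    by exists (clamp T t) => //; rewrite t0.
  by eexists; last by []; exact: conv_Y.
- have [d' d'0 hd] := Phi_equicontinuous d0; exists d' => // _ s t [u [cu _ _] <-].
  exact: hd.
- exists k, y; split => [i /yE[u Eu <-]|u Eu]; first exact: Phi_E.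
  by apply: hy; exists u.
Qed.

Lemma E_convex n (y : nat -> R -> X) (a : nat -> R) : (forall i, (i < n)%N -> E (y i)) ->
  (forall i, 0 <= a i) -> \sum_(i < n) a i = 1 -> E (fun t => \sum_(i < n) a i *: y i t).
Proof.
move=> Ey a0 a1.
have Qsum k : Q (\sum_(i < k) a i *: y i 0) = \sum_(i < k) a i *: Q (y i 0).
  elim: k => [|k IH]; last by rewrite !big_ord_recr /= QD QZ IH.
  by rewrite !big_ord0 -{1}(subrr 0) QB subrr.
have avg (z : nat -> X) r : (forall i, (i < n)%N -> `|z i| <= r) ->
    `|\sum_(i < n) a i *: z i| <= r.
  move=> zr; rewrite (le_trans (ler_norm_sum _ _ _))// -[leRHS]mul1r -a1 mulr_suml.
  by apply: ler_sum => i _; rewrite normrZ ger0_norm// ler_wpM2l// zr.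
split.
- have : forall k, (k <= n)%N -> continuous (fun t => \sum_(i < k) a i *: y i t).
    elim=> [|k IH] kn.
      rewrite (_ : (fun _ => _) = fun=> 0) => [s|]; first exact: cvg_cst.
      by apply/funext => s; rewrite big_ord0.
    rewrite (_ : (fun _ => _) = fun t => \sum_(i < k) a i *: y i t + a k *: y k t).
      move=> s; apply: cvgD; first exact: IH (ltnW kn) s.
      by apply: cvgZr; have [cy _ _] := Ey k kn; exact: cy.
    by apply/funext => s; rewrite big_ord_recr.
  by apply.
- by rewrite Qsum; apply: (avg (fun i => Q (y i 0))) => i /Ey[].
- move=> t; rewrite Qsum -sumrB; under eq_bigr do rewrite -scalerBr.
  by apply: (avg (fun i => y i t - Q (y i 0))) => i /Ey[].
Qed.

(** Approximate fixed points suffice: their images have a uniformly convergent subsequence, whose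
    limit is also that of the paths themselves, and the Lipschitz bound on [Phi] makes it exact. *)
Lemma exists_fixed_path : exists2 u, continuous u & forall t, u t = Phi u t.
Proof.
have rho0 : 0 <= rho by rewrite addr_ge0// ?(le_trans _ R0_ge1)// mulr_ge0 ?(ltW eps_gt0)// mulr_ge0.
have rho10 : 0 <= rho1 by rewrite addr_ge0// mulr_ge0// divr_ge0// ltW.
have Q00 : Q 0 = 0 by rewrite -{1}(subrr 0) QB subrr.
have E0 : E (fun=> 0).
  split=> [s||t]; [exact: cvg_cst|by rewrite Q00 normr0|by rewrite Q00 subr0 normr0].
have [La hLa] := Phi_lip.
have E_bnd u : E u -> exists M, forall t, `|u t| <= M.
  move=> [_ u0 ut]; exists (rho1 + rho) => t.
  by rewrite -(subrK (Q (u 0)) (u t)) (le_trans (ler_normD _ _))// lerD.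
have approx e : 0 < e -> exists2 u, E u & forall t, `|u t - Phi u t| <= e.
  apply: (@schauder_approx _ _ _ E Phi La) => //.
  - by exists (fun=> 0).
  - exact: E_convex.
  - by move=> u u' r [cu _ _] [cu' _ _]; exact: hLa.
  - exact: Phi_nets.
have /choice[u hu] n : exists u, E u /\ forall t, `|u t - Phi u t| <= n.+1%:R^-1.
  by have [|u Eu uP] := approx n.+1%:R^-1; [rewrite invr_gt0|exists u].
pose d (f g : R -> X) e := forall t, `|f t - g t| <= e.
have netE : finite_nets d (Phi @` E).
  move=> e /Phi_nets[k [y [_ hy]]]; exists k, y => _ [z Ez <-]; exact: hy.
have [||phi [phin hphi]] := finite_nets_cauchy (x := fun n => Phi (u n)) _ netE.
- move=> f g h e fh gh t; rewrite -(subrK (h t) (f t)) -addrA mulr_natl mulr2n.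
  by rewrite (le_trans (ler_normD _ _))// lerD// distrC.
- by move=> n; exists (u n) => //; exact: (hu n).1.
have /choice[l hl] t : exists l : X, Phi (u (phi n)) t @[n --> \oo] --> l.
  apply: cauchy_seq_cvg => e e0; have [k hk] := exp2V_small e0; exists k => n kn.
  exact: le_trans (hphi _ _ kn t) hk.
have Pl n t : `|Phi (u (phi n)) t - l t| <= 2^-1 ^+ n.
  rewrite -subr_le0; apply: (@le0_eps _ _ 1) => r r0; rewrite mul1r.
  have /cvgn_distP/(_ r r0)[k /(_ (maxn n k) (leq_maxr _ _)) hk] := hl t.
  rewrite lerBlDl -(subrK (Phi (u (phi (maxn n k))) t) (Phi (u (phi n)) t)) -addrA.
  by rewrite (le_trans (ler_normD _ _))// lerD// ?hphi ?leq_maxl// distrC.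
have ul e : 0 < e -> exists n, d (u (phi n)) l e /\ d (Phi (u (phi n))) l e.
  move=> e0; have e2 : 0 < e / 2 by rewrite divr_gt0.
  have [n1 hn1] := exp2V_small e2; have [n2 _ hn2] := near_infty_natSinv_lt (PosNum e2).
  pose n := maxn n1 n2.
  have h1 t : `|Phi (u (phi n)) t - l t| <= e / 2.
    rewrite (le_trans (Pl n t))// (le_trans _ hn1)// ler_wiXn2l//.
      by rewrite invf_le1// ler1n.
    exact: leq_maxl.
  exists n; split => t; last by rewrite (le_trans (h1 t))// ler_pdivrMr// ler_pMr// ler1n.
  rewrite -(subrK (Phi (u (phi n)) t) (u _ t)) -addrA (splitr e).
  rewrite (le_trans (ler_normD _ _))// lerD//.
  rewrite (le_trans ((hu (phi n)).2 t))// ltW//; apply: hn2 => /=.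
  by rewrite (leq_trans _ (phin n))// leq_maxr.
have cl : continuous l.
  move=> s; apply/cvgrPdist_le => e e0; have e3 : 0 < e / 3 by rewrite divr_gt0.
  have [n [hn _]] := ul _ e3; have [[cu _ _] _] := hu (phi n).
  have /cvgrPdist_le/(_ _ e3) := cu s; apply: filterS => t st.
  have -> : l s - l t = (l s - u (phi n) s) + (u (phi n) s - u (phi n) t) + (u (phi n) t - l t).
    by rewrite !addrA !subrK.
  rewrite (_ : e = e / 3 + e / 3 + e / 3); last by field.
  by rewrite (le_trans (ler_normD _ _))// lerD// (le_trans (ler_normD _ _))// lerD// distrC.
exists l => // t; apply/eqP; rewrite -subr_eq0 -normr_le0.
apply: (@le0_eps _ _ (1 + La)) => e e0; have [n [h1 h2]] := ul e e0.
have [[cu _ _] _] := hu (phi n).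
rewrite -(subrK (Phi (u (phi n)) t) (l t)) -addrA (le_trans (ler_normD _ _))//.
rewrite mulrDl mul1r lerD//; first by rewrite distrC.
exact: hLa.
Qed.

(** Comparing N-components at time 0 and using that [sg * eps] is nonzero gives [Q (I u) = 0], hence
    [Q (b u) = 0]; the equation for [w u] then reads as [u T = u 0]. *)
Lemma exists_periodic_path : exists u, [/\ continuous u, u T = u 0 &
  forall t, 0 <= t -> t <= T -> u t = K t (u 0) + conv ip K (forcing u) t].
Proof.
have [u cu uP] := exists_fixed_path; exists u.
have u0 : u 0 = v u + w u.
  by rewrite uP /Phi clamp_id// (conv0 ipP KC0 (F_cont cu)) addr0 (sg0 KC0).
have uE t : 0 <= t -> t <= T -> u t = K t (u 0) + conv ip K (forcing u) t.
  by move=> t0 tT; rewrite {1}uP /Phi clamp_id// -u0.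
split => //; have [Mw wE] := wP u.
have QI0 : Q (I u) = 0.
  have : Q (u 0) = v u by rewrite {1}uP Q_Phi0.
  move=> /eqP; rewrite /v eq_sym subr_eq addrC -subr_eq subrr eq_sym scaler_eq0 mulf_eq0.
  rewrite (gt_eqF eps_gt0) orbF -normr_eq0 sg1 oner_eq0 /=.
  by move=> /eqP.
have Mb : M (b u).
  move=> z Nz.
  (* Under the integral, [K (T - s)] does not change the pairing with [z] in [N]. *)
  have -> : ip (b u) z = ip (I u) z.
    rewrite /b /conv /I (integralE ipP _ T_ge0); last exact: sgp_continuous (F_cont cu).
    rewrite (integralE ipP (F_cont cu) T_ge0); apply: eq_Rintegral => s /set_mem.
    by rewrite /= in_itv /= => /andP[s0 sT]; rewrite /sgp K_ip// max0_ge0.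
  by have := Q_perp (I u) Nz; rewrite QI0 subr0.
rewrite {1}uE// u0 (sg_add KC0)// (K_fix (v_fix u))// -/(b u) -addrA.
by rewrite -[b u]subr0 -(Q0 Mb) -wE subrKC.
Qed.

End fixed_point_map.

(** * Periodic extension to all times *)

Section periodic_extension.
Variables (R : realType) (T : R).
Hypothesis T_gt0 : 0 < T.

Definition wrap (t : R) := t - (Num.floor (t / T))%:~R * T.

Lemma wrap_itv t : 0 <= wrap t /\ wrap t < T.
Proof.
rewrite /wrap subr_ge0 ltrBlDr -ler_pdivlMr// floor_le; split => //.
rewrite -[X in X + _]mul1r -mulrDl -ltr_pdivrMr// addrC -[1]/(1%:~R) -intrD.
exact: floorD1_gt.
Qed.

Lemma wrap_id t : 0 <= t -> t < T -> wrap t = t.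
Proof.
move=> t0 tT; rewrite /wrap (@floor_def _ _ 0) ?mul0r ?subr0//.
by rewrite divr_ge0 ?(ltW T_gt0)//= ltr_pdivrMr// mul1r.
Qed.

Lemma wrapDT t : wrap (t + T) = wrap t.
Proof.
rewrite /wrap mulrDl divff ?gt_eqF// -[1]/(1%:~R) floorDrz ?intr_int// intrKfloor.
by rewrite intrD mulrDl mul1r opprD addrACA subrr addr0.
Qed.

Lemma wrap_continuous (X : normedModType R) (u : R -> X) : continuous u -> u T = u 0 ->
  continuous (u \o wrap).
Proof.
move=> cu uT.
have key e : 0 < e -> exists2 d, 0 < d & forall s t, s <= t -> t - s < d ->
    `|u (wrap s) - u (wrap t)| <= e.
  move=> e0; have [d d0 hd] := unif_continuous_segment 0 T cu (divr_gt0 e0 (ltr0Sn _ 1)).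
  exists (Num.min d T); first by rewrite lt_min d0.
  move=> s t st; rewrite lt_min => /andP[std stT].
  have [s0 sT] := wrap_itv s; have [t0 tT] := wrap_itv t.
  have ee : e / 2 <= e by rewrite ler_pdivrMr// ler_pMr// ler1n.
  (* Times less than [T] apart lie in the same period or in consecutive ones; in the second case the
     comparison goes through the common value [u T = u 0], at the cost of [e / 2] on each side. *)
  have [kk|kk] : Num.floor (t / T) = Num.floor (s / T) \/
      Num.floor (t / T) = Num.floor (s / T) + 1.
    have le1 : Num.floor (s / T) <= Num.floor (t / T).
      by apply: le_floor; rewrite ler_pM2r// invr_gt0.
    have lt2 : Num.floor (t / T) < Num.floor (s / T) + 1 + 1.
      rewrite floor_lt_int [ltRHS]intrD (@le_lt_trans _ _ (s / T + 1))//.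
        have TT : T / T = 1 by rewrite divff ?gt_eqF.
        by rewrite -[X in _ + X]TT -mulrDl ler_pM2r ?invr_gt0// -lerBlDl ltW.
      by rewrite ltrD2r floorD1_gt.
    have [le2|lt1] := leP (Num.floor (t / T)) (Num.floor (s / T)).
      by left; apply/le_anti; rewrite le2.
    by right; apply/le_anti; rewrite -ltzD1 lt2 -lezD1 in lt1 *.
  - rewrite (le_trans _ ee)//; apply: hd; first by rewrite t0 ltW.
    have -> : wrap s - wrap t = s - t by rewrite /wrap kk; ring.
    by rewrite distrC ger0_norm ?subr_ge0// ltW.
  - have E : (T - wrap s) + wrap t = t - s.
      rewrite /wrap kk intrD; ring.
    rewrite -(subrK (u T) (u (wrap s))) {2}uT -addrA (splitr e) (le_trans (ler_normD _ _))// lerD//.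
      rewrite distrC; apply: hd; first by rewrite s0 ltW.
      by rewrite ger0_norm ?subr_ge0 ?(ltW sT)// (le_trans _ (ltW std))// -E lerDl.
    rewrite distrC; apply: hd; first by rewrite lexx ltW.
    by rewrite subr0 ger0_norm// (le_trans _ (ltW std))// -E lerDr subr_ge0 ltW.
move=> s; apply/cvgrPdist_le => e e0; have [d d0 hd] := key e e0.
near=> t.
have st : `|s - t| < d by near: t; exact: (nbhsx_ballx s d d0).
have [lst|/ltW lts] := leP s t.
  by apply: hd => //; rewrite (le_lt_trans (ler_norm _))// distrC.
by rewrite distrC; apply: hd => //; rewrite (le_lt_trans (ler_norm _)).
Unshelve. all: by end_near. Qed.

End periodic_extension.

Section extension.
Variables (R : realType) (X : completeNormedModType R) (ip : X -> X -> R).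
Hypothesis ipP : is_inner ip.
Variables (K : R -> X -> X) (F : R -> X -> X) (T : R).
Hypotheses (KC0 : C0_semigroup K) (T_gt0 : 0 < T).
Hypothesis F_cont : forall u : R -> X, continuous u -> continuous (fun s => F s (u s)).
Hypothesis F_per : forall (s : R) x, 0 <= s -> F (s + T) x = F s x.

Lemma periodic_extension (u : R -> X) : continuous u -> u T = u 0 ->
  (forall t, 0 <= t -> t <= T -> u t = K t (u 0) + conv ip K (fun s => F s (u s)) t) ->
  exists U : R -> X, [/\ continuous U, forall t, U (t + T) = U t &
    forall t, 0 <= t -> U t = K t (U 0) + conv ip K (fun s => F s (U s)) t].
Proof.
move=> cu uT uE; pose U := u \o wrap T.
have cU : continuous U by exact: wrap_continuous.
have Uper t : U (t + T) = U t by rewrite /U /= wrapDT.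
have Uu t : 0 <= t -> t <= T -> U t = u t.
  move=> t0; rewrite le_eqVlt => /predU1P[->|tT]; last by rewrite /U /= wrap_id.
  by rewrite -[X in U X]add0r Uper /U /= wrap_id.
exists U; split => //.
have T0 : 0 <= T by exact: ltW.
have U0 : U 0 = u 0 by exact: Uu.
suff H k : forall t, 0 <= t -> t <= k.+1%:R * T ->
    U t = K t (U 0) + conv ip K (fun s => F s (U s)) t.
  move=> t t0; apply: (H (Num.truncn (t / T))) => //.
  by rewrite -ler_pdivrMr// ltW// truncnS_gt.
elim: k => [|k IH] t t0.
  rewrite mul1r => tT; rewrite Uu// U0 uE//; congr (_ + _).
  by apply: conv_ext => s /andP[s0 st]; rewrite Uu// (le_trans st).
move=> tk; have [tT|/ltW Tt] := leP t (k.+1%:R * T); first exact: IH.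
have {}Tt : T <= t by rewrite (le_trans _ Tt)// ler_peMl// ler1n.
have tT0 : 0 <= t - T by rewrite subr_ge0.
have tTk : t - T <= k.+1%:R * T.
  by rewrite lerBlDr (le_trans tk)// -[X in _ <= _ + X]mul1r -mulrDl natr1.
have -> : U t = U (t - T) by rewrite -(Uper (t - T)) subrK.
(* Splitting at [T] and using periodicity, the first period returns to [U T = U 0], and the
   induction hypothesis at [t - T] does the rest. *)
have -> : conv ip K (fun s => F s (U s)) t = K (t - T) (conv ip K (fun s => F s (U s)) T) +
    conv ip K (fun s => F s (U s)) (t - T).
  rewrite -[in LHS](subrKC T t) (convD ipP KC0 (F_cont cU) T0 tT0); congr (_ + _).
  by apply: conv_ext => s /andP[s0 _]; rewrite [T + s]addrC F_per// Uper.
rewrite -[X in K X _](subrK T t) (sgD KC0)// addrA -(sg_add KC0)// -IH//; last first.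
  by rewrite ler_peMl// ler1n.
by rewrite (Uu T)// uT -U0 -IH//.
Qed.

End extension.

(** The lower bound is assumed for every [rho] because the radius actually used depends on [C] and
    on the inverse of I - K(T), found only inside the proof. *)
Theorem periodic_solution_exists (R : realType) (X : completeNormedModType R)
    (ip : X -> X -> R) (K F : R -> X -> X) (T m L sg : R) :
  is_inner ip -> C0_semigroup K -> 0 < T ->
  (forall (B : set X) (t : R), bounded_set B -> 0 < t -> totally_bounded (K t @` B)) ->
  (forall v (t : R), K T v = v -> 0 <= t -> K t v = v) ->
  (forall v (t : R) x, K T v = v -> 0 <= t -> ip (K t x) v = ip x v) ->
  (forall u : R -> X, continuous u -> continuous (fun s => F s (u s))) ->
  (forall (s : R) x, 0 <= s -> `|F s x| <= m) ->
  (forall (s : R) x y, 0 <= s -> `|F s x - F s y| <= L * `|x - y|) ->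
  (forall (s : R) x, 0 <= s -> F (s + T) x = F s x) ->
  `|sg| = 1 ->
  (forall rho : R, exists R0 delta : R, 0 < delta /\ forall (u : R -> X) v,
    continuous u -> K T v = v -> R0 <= `|v| ->
    (forall t, 0 <= t <= T -> `|u t - v| <= rho) ->
    delta * `|v| <= sg * \int[@lebesgue_measure R]_(s in `[0, T]) ip (F s (u s)) v) ->
  exists U : R -> X, [/\ continuous U, forall t, U (t + T) = U t &
    forall t, 0 <= t -> U t = K t (U 0) + conv ip K (fun s => F s (U s)) t].
Proof.
move=> ipP KC0 T_gt0 Kc Kfix Kip F_cont F_le F_lip F_per sg1 LL.
have T0 := ltW T_gt0.
have [C C1 hC] := sg_bound KC0 T; have C0 : 0 <= C by exact: le_trans C1.
have GB x y : K T (x - y) = K T x - K T y by exact: sgB.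
have GZ a x : K T (a *: x) = a *: K T x by exact: sgZ.
have GC x : `|K T x| <= C * `|x| by exact: hC.
have Gc B : bounded_set B -> totally_bounded (K T @` B) by move=> bB; exact: Kc.
have GN v x : K T v = v -> ip (K T x) v = ip x v by move=> Nv; exact: Kip.
have [c c0 hc] := perp_bounded_below ipP GB GZ C0 GC Gc.
have surj b := perp_surjective ipP GB GZ C0 GC Gc GN (b := b).
pose Q := proj ipP GB GZ C0 GC Gc.
have /choice[W hW] b : exists w, (forall v, K T v = v -> ip b v = 0) ->
    (forall v, K T v = v -> ip w v = 0) /\ w - K T w = b.
  have [Mb|nMb] := pselect (forall v, K T v = v -> ip b v = 0); last by exists 0.
  by have [w hw] := surj b Mb; exists w.
have [R0 [delta [delta0 hLL]]] := LL (C * (T * (C * m) / c) + T * (C * m)).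
(* The step size will be [delta / ((T * m) ^+ 2 + 1)], so that [eps * (T * m) ^+ 2 <= delta]; adding
   1 covers [m = 0]. *)
have g0 : 0 < (T * m) ^+ 2 + 1 by rewrite ltr_wpDl ?sqr_ge0.
have [|||||u [cu uT uE]] := @exists_periodic_path _ _ _ ipP K T C KC0 T_gt0 C1 hC Kc Kfix Kip
  Q W c (proj_fix ipP GB GZ C0 GC Gc) (proj_perp ipP GB GZ C0 GC Gc)
  (projB ipP GB GZ C0 GC Gc) (projZ ipP GB GZ C0 GC Gc) (proj_id ipP GB GZ C0 GC Gc)
  _ (norm_proj_le ipP GB GZ C0 GC Gc) (norm_proj_perp_le ipP GB GZ C0 GC Gc)
  c0 hc hW F m L F_cont F_le F_lip sg (delta / ((T * m) ^+ 2 + 1)) delta (Num.max R0 1)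
  sg1 _ _ _ _.
- move=> x Mx; apply: proj_unique; last by rewrite subr0.
  by rewrite /= (sg00 KC0).
- by rewrite divr_gt0.
- by rewrite le_max lexx orbT.
- by rewrite mulrAC ler_pdivrMr// ler_pM2l// lerDl.
- move=> u v cu Nv; rewrite ge_max => /andP[R0v _] uv.
  by rewrite (integralE ipP (F_cont _ cu) T0); exact: hLL.
- exact: periodic_extension cu uT uE.
Qed.

(** * The Hilbert space L2 *)

Section L2_inner.
Context d (T : measurableType d) (R : realType).
Variable mu : {measure set T -> \bar R}.
Local Notation L2 := (LspaceType2 mu).
Implicit Types u v w : L2.

Lemma L2_Lfun u : (u : T -> R) \in Lfun mu 2%:E.
Proof. exact: Lspace_Lfun_subproof. Qed.

Lemma L2_measurable u : measurable_fun setT (u : T -> R).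
Proof. exact: (measurable_funP (Lrepr u)). Qed.

Lemma L2_integrable_mul u v : mu.-integrable setT (fun x => (u x * v x)%:E).
Proof. exact/Lfun1_integrable/(Lfun2_mul_Lfun1 (L2_Lfun u) (L2_Lfun v)). Qed.

Lemma L2_norm_sqr u : ((`|u| ^+ 2)%:E = \int[mu]_x ((u x) ^+ 2)%:E)%E.
Proof.
have uoo : ('N[mu]_2%:E[EFin \o (u : T -> R)] < +oo)%E.
  exact: Lebesgue_finite.
have N0 := Lnorm_ge0 mu 2%:E (EFin \o (u : T -> R)).
have -> : `|u| = fine ('N[mu]_2%:E[EFin \o (u : T -> R)])%E by [].
have := @poweR_Lnorm _ _ _ mu (EFin \o (u : T -> R)) 2 ltac:(by []).
rewrite -{1}(fineK (_ : 'N[mu]_2%:E[EFin \o (u : T -> R)] \is a fin_num)%E); last first.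
  by rewrite ge0_fin_numE.
rewrite poweR_EFin powR_mulrn ?fine_ge0// => ->.
by apply: eq_integral => x _; rewrite /= powR_mulrn// real_normK ?num_real.
Qed.

Lemma inner_is_inner : is_inner (@inner _ _ _ mu).
Proof.
split.
- by move=> u v; apply: eq_Rintegral => x _; rewrite mulrC.
- move=> u v w; rewrite /inner -RintegralD//; try exact: L2_integrable_mul.
  congr fine; apply: ae_eq_integral => //.
  + exact: measurable_int (L2_integrable_mul (u + v) w).
  + exact: measurable_int (integrableD measurableT (L2_integrable_mul u w) (L2_integrable_mul v w)).
  + by apply: filterS (Lspace_addE u v) => x /= h _; rewrite h// mulrDl.
- move=> a u v; rewrite /inner -RintegralZl//; try exact: L2_integrable_mul.
  congr fine; apply: ae_eq_integral => //.
  + exact: measurable_int (L2_integrable_mul (a *: u) v).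
  + exact: measurable_int (integrableZl measurableT a (L2_integrable_mul u v)).
  + by apply: filterS (Lspace_scaleE a u) => x /= h _; rewrite h// mulrA.
- move=> u; rewrite /inner /Rintegral; apply: EFin_inj; rewrite L2_norm_sqr fineK//.
  exact: (integrable_fin_num measurableT (L2_integrable_mul u u)).
Qed.

Lemma L2_class (g : T -> R) : measurable_fun setT g ->
  (\int[mu]_x ((g x) ^+ 2)%:E < +oo)%E -> exists v : L2, (v : T -> R) = g %[ae mu].
Proof.
move=> mg goo.
have gL : g \in Lfun mu 2%:E.
  rewrite inE; apply/andP; split; rewrite inE; first exact: mg.
  rewrite /= /finite_norm (@lty_poweRy _ _ 2)// poweR_Lnorm//.
  apply: le_lt_trans goo; rewrite le_eqVlt; apply/orP; left; apply/eqP.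
  by apply: eq_integral => x _; rewrite /= powR_mulrn// real_normK ?num_real.
exists (Lclass (Lfun_Sub (lee1n 2) gL)); exact: LclassE.
Qed.

Lemma L2_norm_sqr_ae u (g : T -> R) : measurable_fun setT g -> (u : T -> R) = g %[ae mu] ->
  ((`|u| ^+ 2)%:E = \int[mu]_x ((g x) ^+ 2)%:E)%E.
Proof.
move=> mg ug; rewrite L2_norm_sqr; apply: ae_eq_integral => //.
- by apply/measurable_EFinP/measurable_funX; exact: L2_measurable.
- exact/measurable_EFinP/measurable_funX.
- by apply: filterS ug => x /= h _; rewrite h.
Qed.

Lemma L2_subE u v : ((u - v : L2) : T -> R) = (fun x => u x - v x) %[ae mu].
Proof.
apply: filterS2 (Lspace_addE u (- v)) (Lspace_oppE v) => x h1 h2 _.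
by rewrite [LHS]h1// h2.
Qed.

(** [G] is the sum of [4 ^+ k * (h k x) ^+ 2]: the k-th integral is at most [4 ^+ k * 16^-1 ^+ k],
    so the sum is integrable, hence finite almost everywhere, and it dominates each of its terms. *)
Lemma L2_fast_ae (h : nat -> L2) : (forall k, `|h k| <= 4^-1 ^+ k) ->
  exists G : T -> R, [/\ measurable_fun setT G, (forall x, 0 <= G x),
    (\int[mu]_x (G x)%:E < +oo)%E &
    \forall x \ae mu, forall k, (h k x) ^+ 2 <= 4^-1 ^+ k * G x].
Proof.
move=> hk.
pose g k x := (4 ^+ k * (h k x) ^+ 2)%:E : \bar R.
have g0 k x : (0 <= g k x)%E by rewrite lee_fin mulr_ge0 ?sqr_ge0// exprn_ge0.
have mg k : measurable_fun setT (g k).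
  apply/measurable_EFinP; apply: measurable_funM => //.
  by apply: measurable_funX; exact: L2_measurable.
pose S x := (\sum_(0 <= k <oo) g k x)%E.
have mS : measurable_fun setT S by apply: ge0_emeasurable_sum => // k x _ _; exact: g0.
have S0 x : (0 <= S x)%E by apply: nneseries_ge0 => *; exact: g0.
have ig k : (\int[mu]_x g k x <= (4^-1 ^+ k)%:E)%E.
  rewrite /g; under eq_integral do rewrite EFinM.
  rewrite ge0_integralZl_EFin ?exprn_ge0//; last 2 first.
  - by move=> x _; rewrite lee_fin sqr_ge0.
  - by apply/measurable_EFinP/measurable_funX; exact: L2_measurable.
  rewrite -L2_norm_sqr -EFinM lee_fin.
  have hk2 : `|h k| ^+ 2 <= (4^-1 ^+ k) ^+ 2.
    by rewrite ler_pXn2r// nnegrE// exprn_ge0.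
  have p4 : 0 < (4 : R) ^+ k by rewrite exprn_gt0.
  rewrite (le_trans (ler_wpM2l (ltW p4) hk2))// exprVn expr2 mulrA divff ?gt_eqF//.
  by rewrite mul1r.
have iS : (\int[mu]_x S x < +oo)%E.
  rewrite (integral_nneseries mu measurableT mg (fun n x _ => g0 n x)).
  apply: (@le_lt_trans _ _ (\sum_(0 <= k <oo) (4^-1 ^+ k)%:E)%E).
    apply: lee_nneseries => k *; last exact: ig.
    by apply: integral_ge0 => x _; exact: g0.
  apply: (@le_lt_trans _ _ 2%:E); last exact: ltry.
  apply: lime_le; first by apply: is_cvg_nneseries => *; rewrite lee_fin exprn_ge0.
  apply: nearW => n; rewrite sumEFin lee_fin.
  suff : \sum_(0 <= k < n) 4^-1 ^+ k <= 2 - 2 * 4^-1 ^+ n :> R.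
    by move=> /le_trans; apply; rewrite gerBl mulr_ge0 ?exprn_ge0.
  elim: n => [|n IH]; first by rewrite big_geq// expr0 mulr1 subrr.
  rewrite big_nat_recr//= (le_trans (lerD IH (lexx _)))//.
  have : 0 <= 4^-1 ^+ n :> R by rewrite exprn_ge0.
  by rewrite exprS; lra.
exists (fine \o S); split.
- exact: measurableT_comp.
- by move=> x; rewrite /= fine_ge0.
- apply: le_lt_trans iS; apply: ge0_le_integral => //.
  + by move=> x _; rewrite lee_fin fine_ge0.
  + by apply/measurable_EFinP; exact: measurableT_comp.
  + by move=> x _; rewrite /=; case: (S x) (S0 x) => //= *; rewrite ?leey ?lexx.
- have iSi : mu.-integrable setT S.
    apply/integrableP; split => //.
    by under eq_integral do rewrite gee0_abs//.
  have := integrable_ae measurableT iSi; apply: filterS => x Sx k.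
  have {}Sx := Sx Logic.I.
  have : (g k x <= S x)%E.
    apply: (@le_trans _ _ (\sum_(0 <= i < k.+1) g i x)%E).
      by rewrite big_nat_recr//= leeDr// sume_ge0.
    by apply: nneseries_lim_ge => *; exact: g0.
  rewrite -(fineK Sx) lee_fin /= => le.
  by rewrite exprVn -ler_pdivrMl ?invrK// invr_gt0 exprn_gt0.
Qed.

End L2_inner.

(** * Completeness of L2 *)

Section L2_complete.
Context d (T : measurableType d) (R : realType).
Variable mu : {measure set T -> \bar R}.
Local Notation L2 := (LspaceType2 mu).

Lemma geometric_telescope (s : R) (x : nat -> R) :
  (forall k, `|x k.+1 - x k| <= 2^-1 ^+ k * s) ->
  forall n m, (n <= m)%N -> `|x m - x n| <= 2 * 2^-1 ^+ n * s.
Proof.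
move=> hx n m nm; have s0 : 0 <= s.
  by have := hx 0%N; rewrite mul1r; apply: le_trans.
suff H k : `|x (n + k)%N - x n| <= (2 * 2^-1 ^+ n - 2 * 2^-1 ^+ (n + k)) * s.
  rewrite -(subnKC nm) (le_trans (H _))// ler_wpM2r// gerBl mulr_ge0// exprn_ge0//.
elim: k => [|k IH]; first by rewrite addn0 !subrr normr0 mul0r.
rewrite addnS -(subrK (x (n + k)%N) (x _)) -addrA (le_trans (ler_normD _ _))//.
rewrite (le_trans (lerD (hx _) IH))// -mulrDl ler_wpM2r//.
by rewrite exprS mulrA mulfV// mul1r; lra.
Qed.

Lemma L2_fast_cvg (u : nat -> L2) : (forall n, `|u n.+1 - u n| <= 4^-1 ^+ n) ->
  exists l : L2, exists2 C : R, 0 <= C & forall n, `|u n - l| <= C * 2^-1 ^+ n.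
Proof.
move=> hu; have [G [mG G0 Goo GP]] := L2_fast_ae hu.
have : \forall x \ae mu, forall k, `|u k.+1 x - u k x| <= 2^-1 ^+ k * Num.sqrt (G x).
  have sub : \forall x \ae mu, forall k, (u k.+1 - u k : L2) x = u k.+1 x - u k x.
    by apply/ae_foralln => k; apply: filterS (L2_subE (u k.+1) (u k)) => x; apply.
  apply: filterS2 sub GP => x sx Gx k; rewrite -sx.
  rewrite -(@ler_pXn2r _ 2)// ?nnegrE ?mulr_ge0 ?exprn_ge0 ?sqrtr_ge0//.
  rewrite real_normK ?num_real// (le_trans (Gx k))// exprMn sqr_sqrtr//.
  have -> : (2^-1 ^+ k) ^+ 2 = 4^-1 ^+ k :> R by rewrite -exprM mulnC exprM; congr (_ ^+ k); field.
  exact: lexx.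
move=> [N [mN N0 NP]].
(* Cutting off the null set makes the sequence converge at every point, so that its limit is
   measurable. *)
pose f n x := u n x * \1_(~` N) x.
have mf n : measurable_fun setT (f n).
  apply: measurable_funM; first exact: L2_measurable.
  by apply: measurable_indic; exact: measurableC.
have fN n x : N x -> f n x = 0 by move=> Nx; rewrite /f indicE memNset ?mulr0//; apply.
have fE n x : ~ N x -> f n x = u n x by move=> nNx; rewrite /f indicE mem_set ?mulr1.
have fcauchy x : forall n m, (n <= m)%N -> `|f m x - f n x| <= 2 * 2^-1 ^+ n * Num.sqrt (G x).
  apply: (@geometric_telescope _ (f ^~ x)) => k; have [Nx|nNx] := pselect (N x).
    by rewrite !fN// subrr normr0 mulr_ge0// ?exprn_ge0// sqrtr_ge0.
  rewrite !fE//; have : ~ ~ (forall k, `|u k.+1 x - u k x| <= 2^-1 ^+ k * Num.sqrt (G x)).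
    by move=> h; apply: nNx; exact: NP.
  by move=> /contrapT.
have /choice[g hg] x : exists l : R, f n x @[n --> \oo] --> l.
  apply: (@cauchy_seq_cvg R R^o) => e e0.
  have [r r0 hr] := exists_small (2 * Num.sqrt (G x)) e0.
  have [n hn] := exp2V_small r0; exists n => m nm; rewrite distrC.
  rewrite (le_trans (fcauchy x n m nm))// (le_trans _ (ltW hr))// mulrAC ler_wpM2l//.
have mg : measurable_fun setT g by apply: (measurable_fun_cvg mf) => x _; exact: hg.
have fg n x : `|f n x - g x| <= 2 * 2^-1 ^+ n * Num.sqrt (G x).
  rewrite -subr_le0; apply: (@le0_eps _ _ 1) => r r0; rewrite mul1r.
  have /(@cvgn_distP R R^o)/(_ r r0)[k /(_ (maxn n k) (leq_maxr _ _)) hk] := hg x.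
  rewrite lerBlDl -(subrK (f (maxn n k) x) (f n x)) -addrA.
  rewrite (le_trans (ler_normD _ _))// lerD//; last by rewrite distrC.
  by rewrite distrC; apply: fcauchy; exact: leq_maxl.
have uf n : (u n : T -> R) = f n %[ae mu].
  exists N; split => // x /= h; apply: contrapT => nNx; apply: h => _.
  by rewrite fE.
have fg2 n : (\int[mu]_x ((f n x - g x) ^+ 2)%:E <=
    ((2 * 2^-1 ^+ n) ^+ 2)%:E * \int[mu]_x (G x)%:E)%E.
  rewrite -ge0_integralZl_EFin ?sqr_ge0//; last 2 first.
  - by move=> x _; rewrite lee_fin.
  - exact/measurable_EFinP.
  apply: ge0_integral_le => x _; first by rewrite lee_fin sqr_ge0.
  rewrite -EFinM lee_fin -[(_ - _) ^+ 2]real_normK ?num_real//.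
  rewrite -[X in _ <= _ * X](sqr_sqrtr (G0 x)) -exprMn ler_pXn2r// nnegrE//.
have IG : (0 <= \int[mu]_x (G x)%:E)%E by apply: integral_ge0 => x _; rewrite lee_fin.
(* Only differences from [g] are known to be square integrable, by comparison with [G]; the limit is
   thus built as [u 0 - v]. *)
have [v hv] : exists v : L2, (v : T -> R) = (fun x => f 0%N x - g x) %[ae mu].
  apply: L2_class; first exact: measurable_funB.
  by rewrite (le_lt_trans (fg2 0%N))// lte_mul_pinfty ?lee_fin ?sqr_ge0.
exists (u 0%N - v), (2 * Num.sqrt (fine (\int[mu]_x (G x)%:E))).
  by rewrite mulr_ge0// sqrtr_ge0.
move=> n; have wE : ((u n - (u 0%N - v) : L2) : T -> R) = (fun x => f n x - g x) %[ae mu].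
  have := L2_subE (u n) (u 0%N - v); have := L2_subE (u 0%N) v.
  apply: filterS3 (filterI hv (filterI (uf 0%N) (uf n))) => x /= [e1 [e2 e3]] e4 e5 _.
  by rewrite [LHS]e5// e4// e1// e2// e3// subKr.
rewrite -(@ler_pXn2r _ 2)// ?nnegrE ?mulr_ge0 ?exprn_ge0 ?sqrtr_ge0//.
rewrite -lee_fin (L2_norm_sqr_ae _ wE); last exact: measurable_funB.
rewrite (le_trans (fg2 n))// -(fineK (_ : \int[mu]_x (G x)%:E \is a fin_num)%E); last first.
  by rewrite ge0_fin_numE.
rewrite -EFinM lee_fin exprMn [leRHS]exprMn exprMn sqr_sqrtr ?fine_ge0//.
by rewrite mulrAC.
by rewrite fineK // ge0_fin_numE.
Qed.

Lemma L2_cauchy_cvg (F : set_system L2) : ProperFilter F -> cauchy F -> cvg F.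
Proof.
move=> FF /cauchyP cF.
have e0 n : 0 < 4^-1 ^+ n / 2 :> R by rewrite divr_gt0// exprn_gt0.
have /choice[u hu] n : exists u, F (ball u (4^-1 ^+ n / 2)) by exact: cF.
have close n m : (n <= m)%N -> `|u m - u n| <= 4^-1 ^+ n.
  move=> nm; have [w [wm wn]] := filter_ex (filterI (hu m) (hu n)).
  rewrite -ball_normE /ball_ /= in wm wn.
  rewrite -(subrK w (u m)) -addrA (le_trans (ler_normD _ _))// [leRHS]splitr.
  rewrite lerD//; last by rewrite distrC ltW.
  rewrite (le_trans (ltW wm))// ler_pM2r// ler_wiXn2l//.
  by rewrite invf_le1// ler1n.
have [l [C C0 hl]] := L2_fast_cvg (fun n => close n n.+1 (leqnSn n)).
apply/cvg_ex; exists l; apply/cvg_ballP => e e_gt0.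
have e2 : 0 < e / 2 by rewrite divr_gt0.
have [r r0 hr] := exists_small (C + 1) e2; have [n hn] := exp2V_small r0.
have := hu n; apply: filterS => w; rewrite -!ball_normE /ball_ /= => uw.
rewrite -(subrK (u n) l) -addrA (splitr e) (le_lt_trans (ler_normD _ _))//.
have h1 : `|l - u n| <= C * r by rewrite distrC (le_trans (hl n))// ler_wpM2l.
have h2 : `|u n - w| < r.
  rewrite (lt_le_trans uw)// (le_trans _ hn)// ler_pdivrMr// (@le_trans _ _ (2^-1 ^+ n))//.
    by rewrite lerXn2r// ?nnegrE// lef_pV2// ?posrE// ler_nat.
  by rewrite ler_pMr// ?exprn_gt0// ler1n.
by rewrite mulrDl mul1r in hr; lra.
Qed.

HB.instance Definition _ :=
  Uniform_isComplete.Build (LspaceType mu (lee1n 2)) L2_cauchy_cvg.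

End L2_complete.

(** * Nemytskii operators *)

Lemma within_continuous_ball (R : realType) (V : pseudoMetricType R) (W : normedModType R)
    (A : set V) (g : V -> W) x : {within A, continuous g} -> A x -> forall e, 0 < e ->
  exists2 d, 0 < d & forall y, A y -> ball x d y -> `|g x - g y| <= e.
Proof.
move=> cg Ax e e0; have /cvgrPdist_le/(_ e e0) := cg x.
rewrite /nbhs /= -nbhs_subspace_in// => /nbhs_ballP[d /= d0 hd].
by exists d => // y Ay xy; apply: hd.
Qed.

Section omega.
Variables (R : realType) (n : nat) (Omega : set 'rV[R]_n) (oOmega : open Omega).
Local Notation mu := (lebesgue_on oOmega).
Local Notation X := (borel_rV R n).

Lemma lebesgue_on_ae : {ae mu, forall x, Omega x}.
Proof.
exists (~` Omega : set X); split => //.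
  by apply: measurableC; exact: open_measurable_rV.
by rewrite /lebesgue_on /= /mrestr setICl measure0.
Qed.

Lemma lebesgue_on_finite : bounded_set Omega -> (mu setT < +oo)%E.
Proof.
move=> [M [_ hM]]; pose B := `|M| + 1.
have MB : M < B by rewrite (le_lt_trans (ler_norm M))// ltrDl.
rewrite /lebesgue_on /= /mrestr setTI.
pose A (i : 'I_n) : set (measurableTypeR R) := `[- B, B]%classic.
apply: (@le_lt_trans _ _ (lebesgue_measure_rV [set x : 'rV[R]_n | forall i, A i (x ord0 i)])).
  apply: le_measure.
  - by apply/mem_set; exact: open_measurable_rV.
  - apply/mem_set.
    rewrite (_ : [set x | _] = \bigcap_(i in [set: 'I_n])
        ~` ((fun x : 'rV[R]_n => x ord0 i) @^-1` ~` `[- B, B]%classic)); last first.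
      apply/seteqP; split => x h i; first by move=> _ nh; exact: nh (h i).
      by apply: contrapT => nh; exact: (h i Logic.I).
    apply: fin_bigcap_measurable; first exact: finite_finset.
    move=> i _; apply: measurableC; apply: open_measurable_rV.
    apply: open_comp; first by move=> x _; exact: coord_continuous.
    by rewrite openC; exact: itv_closed.
  - move=> x /= Ox i; rewrite /A /= in_itv /= -ler_norml.
    have := hM _ MB _ Ox; apply: le_trans.
    rewrite [leRHS]mx_normrE.
    exact: (@le_bigmax _ _ _ _ (fun i : 'I_1 * 'I_n => `|x i.1 i.2|) (ord0, i)).
rewrite lebesgue_measure_rV_box//.
have : (\prod_(i < n) lebesgue_measure (A i) \is a fin_num)%E.
  apply: (big_ind (fun x => x \is a fin_num)) => //.
  - by move=> x y; exact: fin_numM.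
  - move=> i _; rewrite /A lebesgue_measure_itv /=; case: ifP => //.
by rewrite ltey; case: (\prod_(_ < _) _)%E.
by move=> i; exact: measurable_itv.
Qed.

(** An epsilon-delta form, obtained by freezing variables in continuity on a product domain. *)
Definition ball_continuous_on (g : 'rV[R]_n -> R) := forall x, Omega x -> forall e, 0 < e ->
  exists2 d, 0 < d & forall y, Omega y -> ball x d y -> `|g x - g y| <= e.

Lemma measurable_within_Omega (g : 'rV[R]_n -> R) :
  ball_continuous_on g -> measurable_fun setT (g \_ Omega : X -> R).
Proof.
move=> cg; have mO : measurable (Omega : set X) by exact: open_measurable_rV.
apply/(measurable_restrictT _ mO).
move=> _; apply: (measurability _ (RGenOInfty.measurableE R)) => //.
move=> /= _ [_ [a ->] <-]; apply: open_measurable_rV.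
rewrite openE => x [Ox /=]; rewrite in_itv /= andbT => ax.
have ga : 0 < (g x - a) / 2 by rewrite divr_gt0 ?subr_gt0.
have [d d0 hd] := cg _ Ox _ ga.
have /nbhs_ballP[r /= r0 hr] : nbhs x Omega by exact: open_nbhs_nbhs.
apply/nbhs_ballP; exists (Num.min d r); first by rewrite /= lt_min d0.
move=> y; rewrite -ball_normE /ball_ /= lt_min => /andP[xd xr].
have Oy : Omega y by apply: hr; rewrite -ball_normE.
split => //=; rewrite in_itv /= andbT.
have := hd y Oy; rewrite -ball_normE => /(_ xd); rewrite ler_norml => /andP[_]; rewrite ler_pdivlMr//.
by move: ax ga; lra.
Qed.

(* Approximating [u] by its roundings to multiples of [k.+1%:R^-1] reduces the
   joint measurability of Caratheodory functions to countably many frozen values. *)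
Lemma measurable_caratheodory (g : 'rV[R]_n -> R -> R) (u : X -> R) :
  measurable_fun setT u ->
  (forall y, ball_continuous_on (g ^~ y)) ->
  (forall x, Omega x -> continuous (g x)) ->
  measurable_fun setT ((fun x => g x (u x)) \_ Omega : X -> R).
Proof.
move=> mu_ cg1 cg2.
pose q k (x : X) := Num.floor (k.+1%:R * u x).
pose h k (x : X) := ((fun x => g x ((q k x)%:~R / k.+1%:R)) \_ Omega) x.
apply: (@measurable_fun_cvg _ _ _ setT h) => [k|x _].
  move=> _ B mB; rewrite setTI.
  have -> : h k @^-1` B = \bigcup_(j in [set: int])
      ((q k @^-1` [set j]) `&` (((fun x => g x (j%:~R / k.+1%:R)) \_ Omega : X -> R) @^-1` B)).
    apply/seteqP; split => [x Bx|x [j _ [/= qj]]].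
      by exists (q k x) => //; split.
    by rewrite /h !patchE qj.
  apply: countable_bigcupT_measurable => // j; apply: measurableI.
    have -> : q k @^-1` [set j] = (fun x => k.+1%:R * u x) @^-1` `[j%:~R, (j + 1)%:~R[%classic.
      apply/seteqP; split => x /=; rewrite /q in_itv /=.
        by move=> <-; exact: floor_itv.
      exact: floor_def.
    rewrite -[X in measurable X]setTI.
    have mk : measurable_fun setT (fun x => k.+1%:R * u x) by exact: measurable_funM.
    by apply: mk => //; exact: measurable_itv.
  rewrite -[X in measurable X]setTI.
  exact: (measurable_within_Omega (cg1 _)).
rewrite [X in _ --> X]patchE.
rewrite (_ : h ^~ x = fun k =>
    if x \in Omega then g x ((q k x)%:~R / k.+1%:R) else point); last first.
  by apply/funext => k; rewrite /h patchE.
case: ifPn => [/set_mem Ox|_]; last exact: cvg_cst.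
apply: continuous_cvg; first exact: cg2.
apply/cvgrPdist_le => e e0.
have := near_infty_natSinv_lt (PosNum e0); apply: filterS => k /= ke.
rewrite (le_trans _ (ltW ke))//.
have /andP[h1 h2] := floor_itv (k.+1%:R * u x); rewrite -/(q k x) in h1 h2.
rewrite intrD in h2.
have k0 : 0 < k.+1%:R :> R by [].
have lo : (q k x)%:~R / k.+1%:R <= u x by rewrite ler_pdivrMr// mulrC.
rewrite ger0_norm ?subr_ge0// lerBlDl -[X in _ <= _ + X]mul1r -mulrDl.
by rewrite ler_pdivlMr// mulrC ltW.
Qed.

End omega.

Lemma dominated_convergence_Rintegral d (T : measurableType d) (R : realType)
    (mu : {measure set T -> \bar R}) (D : set T) (f_ : nat -> T -> R) (f g : T -> R) :
  measurable D -> (forall k, measurable_fun D (f_ k)) -> measurable_fun D f ->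
  (\forall x \ae mu, D x -> f_ k x @[k --> \oo] --> f x) ->
  mu.-integrable D (EFin \o g) -> (\forall x \ae mu, forall k, D x -> `|f_ k x| <= g x) ->
  \int[mu]_(x in D) f_ k x @[k --> \oo] --> \int[mu]_(x in D) f x.
Proof.
move=> mD mf_ mf f_f ig fg.
have [|||||fi _] := @dominated_convergence _ _ _ mu D mD (fun k => EFin \o f_ k) (EFin \o f)
  (EFin \o g).
- by move=> k; exact/measurable_EFinP.
- exact/measurable_EFinP.
- by apply: filterS f_f => x h Dx; apply: cvg_EFin; [exact: nearW | exact: h].
- by [].
- by apply: filterS fg => x h k Dx; rewrite lee_fin; exact: h.
rewrite -(fineK (integrable_fin_num mD fi)) => /fine_cvgP[_]; exact.
Qed.

Section nemytskii.
Variables (R : realType) (n : nat) (Omega : set 'rV[R]_n) (oOmega : open Omega).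
Hypothesis bOmega : bounded_set Omega.
Local Notation mu := (lebesgue_on oOmega).
Local Notation X := (borel_rV R n).
Local Notation L2 := (L2_on oOmega).
Variables (f : R -> 'rV[R]_n -> R -> R) (m L : R).
Hypothesis f_continuous : {within [set z : R * 'rV[R]_n * R | 0 <= z.1.1 /\ Omega z.1.2],
  continuous (fun z : R * 'rV[R]_n * R => f z.1.1 z.1.2 z.2)}.
Hypothesis f_bounded : forall (t : R) x y, 0 <= t -> Omega x -> `|f t x y| <= m.
Hypothesis f_lipschitz : forall (t : R) x y1 y2, 0 <= t -> Omega x ->
  `|f t x y1 - f t x y2| <= L * `|y1 - y2|.

Lemma f_joint t x y : 0 <= t -> Omega x -> forall e, 0 < e ->
  exists2 d, 0 < d & forall s x' y', 0 <= s -> Omega x' ->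
   `|t - s| < d -> ball x d x' -> `|y - y'| < d -> `|f t x y - f s x' y'| <= e.
Proof.
move=> t0 Ox e e0.
have [d d0 hd] := within_continuous_ball f_continuous (x := (t, x, y)) (conj t0 Ox) e0.
exists d => // s x' y' s0 Ox' ts xx yy; exact: (hd (s, x', y')).
Qed.

Lemma f_section t y : 0 <= t -> ball_continuous_on Omega ((f t) ^~ y).
Proof.
move=> t0 x Ox e e0; have [d d0 hd] := f_joint y t0 Ox e0.
exists d => // z Oz zd.
by apply: hd; rewrite ?subrr ?normr0.
Qed.

Lemma f_continuous_y t x : 0 <= t -> Omega x -> continuous (f t x).
Proof.
move=> t0 Ox y; apply/cvgrPdist_le => e e0; have [d d0 hd] := f_joint y t0 Ox e0.
apply/nbhs_ballP; exists d => // z zd.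
by apply: hd; rewrite ?subrr ?normr0//; exact: ballxx.
Qed.

(** Nothing is known about [f] outside [Omega]; extension by 0 gives a function measurable and
    bounded everywhere that represents the same class. *)
Definition nem_fun t (u : X -> R) : X -> R := (fun x => f t x (u x)) \_ Omega.

Lemma nem_fun_in t u x : Omega x -> nem_fun t u x = f t x (u x).
Proof. by move=> Ox; rewrite /nem_fun patchE mem_set. Qed.

Lemma nem_fun_out t u x : ~ Omega x -> nem_fun t u x = 0.
Proof. by move=> Ox; rewrite /nem_fun patchE memNset. Qed.

Lemma measurable_nem_fun t (u : L2) : 0 <= t -> measurable_fun setT (nem_fun t u).
Proof.
move=> t0; apply: measurable_caratheodory => //.
- exact: L2_measurable.
- by move=> y; exact: f_section.
- by move=> x Ox; exact: f_continuous_y.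
Qed.

Let m_le t u x : 0 <= t -> `|nem_fun t u x| <= `|m|.
Proof.
move=> t0; have [Ox|nOx] := pselect (Omega x); last by rewrite nem_fun_out// normr0.
by rewrite nem_fun_in// (le_trans (f_bounded _ t0 Ox))// ler_norm.
Qed.

Lemma integrable_sqr_nem t (u : L2) : 0 <= t ->
  (\int[mu]_x ((nem_fun t u x) ^+ 2)%:E <= (m ^+ 2)%:E * mu setT)%E.
Proof.
move=> t0; rewrite -integral_cst//; apply: ge0_integral_le => x _.
  by rewrite lee_fin sqr_ge0.
rewrite lee_fin -[leLHS]real_normK ?num_real// -[m ^+ 2]real_normK ?num_real//.
by rewrite ler_pXn2r// ?nnegrE// m_le.
Qed.

Lemma nemE t (u : L2) : 0 <= t -> (nemytskii f t u : X -> R) = nem_fun t u %[ae mu].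
Proof.
move=> t0; have [|v hv] := @L2_class _ _ _ mu _ (measurable_nem_fun u t0).
  rewrite (le_lt_trans (integrable_sqr_nem u t0))// lte_mul_pinfty ?lee_fin ?sqr_ge0//.
  exact: lebesgue_on_finite.
have -> : nemytskii f t u = v; last by [].
apply: L2_ofE; apply: filterS2 hv (lebesgue_on_ae oOmega) => x h Ox _.
by rewrite h// nem_fun_in.
Qed.

Let mass := fine (mu setT).
Let massE : (mass%:E = mu setT)%E.
Proof. by rewrite fineK// ge0_fin_numE// lebesgue_on_finite. Qed.

Lemma norm_nem_le t (u : L2) : 0 <= t -> `|nemytskii f t u| <= `|m| * Num.sqrt mass.
Proof.
move=> t0; rewrite -(@ler_pXn2r _ 2)// ?nnegrE ?mulr_ge0 ?sqrtr_ge0//.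
rewrite -lee_fin (L2_norm_sqr_ae (measurable_nem_fun u t0) (nemE u t0)).
rewrite (le_trans (integrable_sqr_nem u t0))// -massE -EFinM lee_fin.
by rewrite exprMn real_normK ?num_real// sqr_sqrtr// fine_ge0.
Qed.

Lemma nem_sub_ae t s (u v : L2) : 0 <= t -> 0 <= s ->
  ((nemytskii f t u - nemytskii f s v : L2) : X -> R) =
  (fun x => nem_fun t u x - nem_fun s v x) %[ae mu].
Proof.
move=> t0 s0; apply: filterS3 (L2_subE (nemytskii f t u) (nemytskii f s v)) (nemE u t0) (nemE v s0).
by move=> x e1 e2 e3 _; rewrite [LHS]e1// e2// e3.
Qed.

Lemma nem_lipschitz t (u v : L2) : 0 <= t ->
  `|nemytskii f t u - nemytskii f t v| <= `|L| * `|u - v|.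
Proof.
move=> t0; rewrite -(@ler_pXn2r _ 2)// ?nnegrE ?mulr_ge0//.
rewrite -lee_fin (L2_norm_sqr_ae _ (nem_sub_ae u v t0 t0)); last first.
  by apply: measurable_funB; exact: measurable_nem_fun.
rewrite exprMn EFinM.
rewrite (L2_norm_sqr_ae _ (L2_subE u v)); last first.
  by apply: measurable_funB; exact: L2_measurable.
rewrite -ge0_integralZl_EFin ?sqr_ge0//; last 2 first.
- by move=> x _; rewrite lee_fin sqr_ge0.
- by apply/measurable_EFinP/measurable_funX/measurable_funB; exact: L2_measurable.
apply: ge0_integral_le => x _; first by rewrite lee_fin sqr_ge0.
rewrite -EFinM lee_fin -exprMn -[leLHS]real_normK ?num_real// -[leRHS]real_normK ?num_real//.
rewrite ler_pXn2r// ?nnegrE// normrM normr_id.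
have [Ox|nOx] := pselect (Omega x); last by rewrite !nem_fun_out// subrr normr0 mulr_ge0.
rewrite !nem_fun_in// (le_trans (f_lipschitz _ _ t0 Ox))// ler_wpM2r// ler_norm.
by [].
Qed.

Lemma nem_seq_continuous (t : nat -> R) (s : R) (u : L2) : (forall k, 0 <= t k) -> 0 <= s ->
  t k @[k --> \oo] --> s -> nemytskii f (t k) u @[k --> \oo] --> nemytskii f s u.
Proof.
move=> tk s0 ts.
pose g k x := (nem_fun (t k) u x - nem_fun s u x) ^+ 2.
have mg k : measurable_fun setT (g k).
  by apply/measurable_funX/measurable_funB; exact: measurable_nem_fun.
have normE k : `|nemytskii f (t k) u - nemytskii f s u| ^+ 2 = \int[mu]_x g k x.
  rewrite /Rintegral -(L2_norm_sqr_ae _ (nem_sub_ae u u (tk k) s0))//.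
  by apply: measurable_funB; exact: measurable_nem_fun.
have H : \int[mu]_x g k x @[k --> \oo] --> \int[mu]_x (0 : R).
  apply: (@dominated_convergence_Rintegral _ _ _ mu setT g (cst 0) (cst (4 * m ^+ 2))) => //.
  - apply: aeW => x _; have [Ox|nOx] := pselect (Omega x); last first.
      rewrite /g; under eq_fun do rewrite !nem_fun_out// subrr expr0n.
      exact: cvg_cst.
    apply/cvgrPdist_le => e e0.
    (* A difference bounded by both 1 and [e] has its square bounded by [e]. *)
    have e1 : 0 < Num.min 1 e by rewrite lt_min ltr01.
    have [d d0 hd] := f_joint (u x) s0 Ox e1.
    have /cvgrPdist_lt/(_ d d0) := ts; apply: filterS => k kd.
    have := hd (t k) x (u x) (tk k) Ox kd (ballxx _ d0).
    rewrite subrr normr0 => /(_ d0).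
    rewrite /g !nem_fun_in// sub0r normrN normrX distrC le_min => /andP[h1 h2].
    rewrite expr2 (le_trans _ h2)//.
    by rewrite ler_piMl.
  - apply/integrableP; split; first exact/measurable_EFinP/measurable_cst.
    rewrite (eq_integral (cst (4 * m ^+ 2)%:E)); last first.
      by move=> x _ /=; rewrite ger0_norm// mulr_ge0// sqr_ge0.
    by rewrite integral_cst// -massE -EFinM ltry.
  - apply: aeW => x k _; rewrite /g ger0_norm ?sqr_ge0//.
    have := m_le u x (tk k); have := m_le u x s0.
    rewrite -(real_normK (num_real (_ - _))) -(real_normK (num_real m)) => h1 h2.
    rewrite (_ : 4 * _ = (2 * `|m|) ^+ 2); last by ring.
    rewrite ler_pXn2r// ?nnegrE ?mulr_ge0// (le_trans (ler_normB _ _))//.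
    by move: h1 h2; lra.
rewrite Rintegral_cst// mul0r in H.
apply/cvgrPdist_lt => e e0.
have e2 : 0 < e ^+ 2 by rewrite exprn_gt0.
have /cvgr0_norm_lt/(_ _ e2) := H; apply: filterS => k.
rewrite -normE ger0_norm ?sqr_ge0// distrC ltr_pXn2r// nnegrE//; exact: ltW.
Qed.

End nemytskii.

(** * The Landesman-Lazer estimate *)

Lemma mulr_cvg_pinfty (R : realType) (r q : nat -> R) (z : R) :
  (forall k, 4 ^+ k <= r k) -> q k @[k --> \oo] --> z -> 0 < z ->
  r k * q k @[k --> \oo] --> +oo.
Proof.
move=> r4 qz z0; apply/cvgryPge => M.
have z2 : z / 2 < z by rewrite ltr_pdivrMr// ltr_pMr// ltr1n.
have z20 : 0 < z / 2 by rewrite divr_gt0.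
apply: filterS2 (nbhs_infty_ger (M / (z / 2))) (cvgr_ge _ qz _ z2) => k kM qk.
have r0 : 0 <= r k by rewrite (le_trans _ (r4 k))// exprn_ge0.
rewrite (@le_trans _ _ (k%:R * (z / 2)))//; first by rewrite -ler_pdivrMr.
apply: ler_pM => //; first exact: ltW.
rewrite (le_trans _ (r4 k))// -natrX ler_nat; exact/ltnW/ltn_expl.
Qed.

Section ratio.
Context d (T : measurableType d) (R : realType).
Variable mu : {measure set T -> \bar R}.
Local Notation L2 := (LspaceType2 mu).

(** Writing [w k = r k * (z + C * h k)] with [h k] of norm at most [4^-1 ^+ k], [L2_fast_ae] sends
    [h k] to 0 almost everywhere, so [w k] follows the sign of [z] with factor [r k]. *)
Lemma L2_ratio_diverge (w : nat -> L2) (r : nat -> R) (z : L2) C : 0 < C ->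
  (forall k, 4 ^+ k <= r k) ->
  (forall k, `|(r k)^-1 *: w k - z| <= C * 4^-1 ^+ k) ->
  \forall x \ae mu, (0 < z x -> w k x @[k --> \oo] --> +oo) /\
                    (z x < 0 -> w k x @[k --> \oo] --> -oo).
Proof.
move=> C0 r4 hw.
have r0 k : 0 < r k by rewrite (lt_le_trans _ (r4 k))// exprn_gt0.
pose h k : L2 := C^-1 *: ((r k)^-1 *: w k - z).
have [k|G [_ _ _ hG]] := @L2_fast_ae _ _ _ mu h.
  by rewrite normrZ gtr0_norm ?invr_gt0// ler_pdivrMl.
have hE : \forall x \ae mu, forall k, h k x = C^-1 * ((r k)^-1 * w k x - z x).
  apply/ae_foralln => k.
  apply: filterS3 (Lspace_scaleE C^-1 ((r k)^-1 *: w k - z)) (L2_subE ((r k)^-1 *: w k) z)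
    (Lspace_scaleE (r k)^-1 (w k)) => x e1 e2 e3.
  by rewrite [LHS]e1// e2// e3.
apply: filterS2 hE hG => x hE hG.
have wE k : w k x = r k * (z x + C * h k x).
  by rewrite hE; field; rewrite !gt_eqF.
have h0 : z x + C * h k x @[k --> \oo] --> z x.
  rewrite -[X in _ --> X]addr0 -(mulr0 C); apply: cvgD; first exact: cvg_cst.
  apply: cvgMr.
  apply/cvgr0Pnorm_lt => e e0.
  have e2 : 0 < e ^+ 2 by rewrite exprn_gt0.
  have : G x * 4^-1 ^+ k @[k --> \oo] --> G x * 0.
    by apply: cvgMr; apply: cvg_expr; rewrite ger0_norm ?invr_ge0// invf_lt1// ltr1n.
  rewrite mulr0 => /cvgr0_norm_lt/(_ _ e2); apply: filterS => k ke.
  rewrite -(@ltr_pXn2r _ 2)// ?nnegrE; [|exact: ltW].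
  rewrite real_normK ?num_real//.
  by rewrite (le_lt_trans (hG k))// mulrC (le_lt_trans (ler_norm _)).
split=> z0.
  by under eq_fun do rewrite wE; exact: mulr_cvg_pinfty h0 z0.
apply/cvgNry.
rewrite (_ : - _ = fun k => r k * - (z x + C * h k x)); last first.
  by apply/funext => k; rewrite mulrN -wE.
by apply: (mulr_cvg_pinfty r4 (cvgN h0)); rewrite oppr_gt0.
Qed.

Lemma L2_parts (z : L2) : exists zp zm : L2,
  [/\ (zp : T -> R) = (fun x => Num.max (z x) 0) %[ae mu],
      (zm : T -> R) = (fun x => Num.min (z x) 0) %[ae mu] & z = zp + zm].
Proof.
have mz := L2_measurable z.
have zoo : (\int[mu]_x ((z x) ^+ 2)%:E < +oo)%E by rewrite -L2_norm_sqr ltry.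
have [||zp hp] := @L2_class _ _ _ mu (fun x => Num.max (z x) 0).
- exact: measurable_maxr.
- apply: le_lt_trans zoo; apply: ge0_integral_le => x _; first by rewrite lee_fin sqr_ge0.
  by rewrite lee_fin; case: (ltP (z x) 0) => _; rewrite ?expr0n ?sqr_ge0.
have [||zm hm] := @L2_class _ _ _ mu (fun x => Num.min (z x) 0).
- exact: measurable_minr.
- apply: le_lt_trans zoo; apply: ge0_integral_le => x _; first by rewrite lee_fin sqr_ge0.
  by rewrite lee_fin; case: (ltP (z x) 0) => _; rewrite ?expr0n ?sqr_ge0.
exists zp, zm; split => //; apply/Lspace_eqP.
apply: filterS3 hp hm (Lspace_addE zp zm) => x e1 e2 e3 _.
by rewrite e3// e1// e2// addr_max_min addr0.
Qed.

End ratio.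

Section landesman_lazer.
Variables (R : realType) (n : nat) (Omega : set 'rV[R]_n) (oOmega : open Omega).
Hypothesis bOmega : bounded_set Omega.
Local Notation mu := (lebesgue_on oOmega).
Local Notation leb := (@lebesgue_measure R).
Local Notation X := (borel_rV R n).
Local Notation L2 := (L2_on oOmega).
Variables (f : R -> 'rV[R]_n -> R -> R) (m L : R).
Hypothesis f_continuous : {within [set z : R * 'rV[R]_n * R | 0 <= z.1.1 /\ Omega z.1.2],
  continuous (fun z : R * 'rV[R]_n * R => f z.1.1 z.1.2 z.2)}.
Hypothesis f_bounded : forall (t : R) x y, 0 <= t -> Omega x -> `|f t x y| <= m.
Hypothesis f_lipschitz : forall (t : R) x y1 y2, 0 <= t -> Omega x ->
  `|f t x y1 - f t x y2| <= L * `|y1 - y2|.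

(** Freezing time at 0 on the negative side makes the superposition continuous on the whole line. *)
Let F s (u : L2) := nemytskii f (Num.max s 0) u.

Let FE s u : 0 <= s -> F s u = nemytskii f s u.
Proof. by move=> s0; rewrite /F max_l. Qed.

Lemma nem_path_continuous (u : R -> L2) : continuous u -> continuous (fun s => F s (u s)).
Proof.
move=> cu s.
(* Continuity in time comes from dominated convergence, hence along sequences; a failure at [s]
   would provide a bad sequence tending to [s]. *)
have cF (x : L2) : F r x @[r --> s] --> F s x.
  apply/cvgrPdist_le => e e0; apply: contrapT => nH.
  have /choice[t ht] k : exists t, `|s - t| < k.+1%:R^-1 /\ e < `|F s x - F t x|.
    apply: contrapT => nk; apply: nH.
    apply/nbhs_ballP; exists k.+1%:R^-1 => //= t st.
    by rewrite leNgt; apply/negP => et; apply: nk; exists t.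
  have ts : Num.max (t k) 0 @[k --> \oo] --> Num.max s 0.
    apply/cvgrPdist_lt => d d0; have := near_infty_natSinv_lt (PosNum d0).
    apply: filterS => k kd; apply: le_lt_trans (lt_trans (ht k).1 kd).
    exact: dist_max0.
  have := nem_seq_continuous bOmega f_continuous f_bounded (u := x)
    (fun k => max0_ge0 (t k)) (max0_ge0 s) ts.
  move=> /cvgrPdist_le/(_ e e0)[k _ /(_ k (leqnn k))].
  by rewrite leNgt => /negP; apply; exact: (ht k).2.
apply/cvgrPdist_le => e e0.
have e2 : 0 < e / 2 by rewrite divr_gt0.
have d0 : 0 < e / 2 / (`|L| + 1) by rewrite divr_gt0// ltr_wpDl.
have /cvgrPdist_le/(_ _ e2) := cF (u s); have /cvgrPdist_le/(_ _ d0) := cu s.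
apply: filterS2 => r ur Fr.
rewrite -(subrK (F r (u s)) (F s (u s))) -addrA (le_trans (ler_normD _ _))// (splitr e) lerD//.
rewrite (le_trans (nem_lipschitz bOmega f_continuous f_bounded f_lipschitz _ _ (max0_ge0 r)))//.
rewrite (le_trans (ler_wpM2l (normr_ge0 _) ur))//.
by rewrite mulrA ler_pdivrMr ?ltr_wpDl// mulrC ler_wpM2l ?lerDl// ltW.
Qed.

Let measurable_in (h : 'rV[R]_n -> R) (p : L2) : ball_continuous_on Omega h ->
  measurable_fun setT (fun x : X => (h \_ Omega) x * p x).
Proof.
move=> ch; apply: measurable_funM; last exact: L2_measurable.
exact: measurable_within_Omega.
Qed.

Lemma inner_nem (s : R) (u p : L2) : 0 <= s ->
  inner (nemytskii f s u) p = \int[mu]_x (nem_fun Omega f s u x * p x).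
Proof.
move=> s0; congr fine; apply: ae_eq_integral => //.
- by apply/measurable_EFinP/measurable_funM; exact: L2_measurable.
- apply/measurable_EFinP/measurable_funM; last exact: L2_measurable.
  exact: measurable_nem_fun.
- by apply: filterS (nemE bOmega f_continuous f_bounded u s0) => x /= h _; rewrite h.
Qed.

(** Convergence is asked only where [p] is nonzero: nothing can be said where the limit direction
    vanishes, and such points do not contribute to the pairing. *)
Lemma inner_nem_cvg (s : R) (w : nat -> L2) (p : L2) (h : 'rV[R]_n -> R) :
  0 <= s -> ball_continuous_on Omega h ->
  (\forall x \ae mu, Omega x -> p x != 0 -> f s x (w k x) @[k --> \oo] --> h x) ->
  inner (nemytskii f s (w k)) p @[k --> \oo] --> \int[mu]_x ((h \_ Omega) x * p x).
Proof.
move=> s0 ch wh; under eq_fun do rewrite inner_nem//.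
apply: (@dominated_convergence_Rintegral _ _ _ mu setT _ _ (fun x => `|m| * `|p x|)) => //.
- move=> k; apply: measurable_funM; last exact: L2_measurable.
  exact: measurable_nem_fun.
- exact: measurable_in.
- apply: (@filterS _ _ (ae_filter_ringOfSetsType mu)) wh => x hx _.
  have [Ox|nOx] := pselect (Omega x); last first.
    under eq_fun do rewrite nem_fun_out// mul0r.
    by rewrite patchE memNset// mul0r; exact: cvg_cst.
  have [p0|pn0] := eqVneq (p x) 0.
    by under eq_fun do rewrite p0 mulr0; rewrite p0 mulr0; exact: cvg_cst.
  rewrite patchE mem_set//; apply: cvgMl; under eq_fun do rewrite nem_fun_in//.
  exact: hx.
- apply: (@integrableZl _ _ _ mu _ measurableT `|m| (fun x => `|(p x)%:E|%E)).
  have : (p : X -> R) \in Lfun mu 1.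
    apply: Lfun_subset12; last exact: L2_Lfun.
    by rewrite ge0_fin_numE// lebesgue_on_finite.
  by move=> /Lfun1_integrable/integrable_norm.
- apply: aeW => x k _; rewrite normrM ler_wpM2r//.
  have [Ox|nOx] := pselect (Omega x); last by rewrite nem_fun_out// normr0.
  by rewrite nem_fun_in// (le_trans (f_bounded _ s0 Ox))// ler_norm.
Qed.

Lemma Rintegral_lebesgue_on (G : X -> R) :
  \int[mu]_x (G \_ Omega) x = \int[@lebesgue_measure_rV R n]_(x in Omega) G x.
Proof.
rewrite -Rintegral_mkcond; congr fine; apply: eq_measure_integral => A mA AO.
by rewrite /lebesgue_on /= /mrestr (setIidl AO).
Qed.

Variables (T : R) (T_gt0 : 0 < T).

Definition limit_pairing (g : R -> 'rV[R]_n -> R) (p : L2) (s : R) :=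
  \int[mu]_x ((g s \_ Omega) x * p x).

Lemma limit_pairingE (g : R -> 'rV[R]_n -> R) (q : X -> R) (p : L2) (s : R) :
  ball_continuous_on Omega (g s) -> measurable_fun setT q -> (p : X -> R) = q %[ae mu] ->
  limit_pairing g p s = \int[@lebesgue_measure_rV R n]_(x in Omega) (g s x * q x).
Proof.
move=> cg mq pq; rewrite -Rintegral_lebesgue_on; congr fine; apply: ae_eq_integral => //.
- by apply/measurable_EFinP; exact: measurable_in.
- apply/measurable_EFinP.
  rewrite (_ : _ \_ _ = fun x => (g s \_ Omega) x * q x); last first.
    by apply/funext => x; rewrite !patchE; case: ifPn => // _; rewrite mul0r.
  by apply: measurable_funM => //; exact: measurable_within_Omega.
- apply: filterS pq => x /= h _; rewrite h// !patchE; case: ifPn => // _.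
  by rewrite mul0r.
Qed.

Lemma limit_pairing_pos (g : R -> 'rV[R]_n -> R) (z p : L2) (s : R) :
  ball_continuous_on Omega (g s) ->
  (p : X -> R) = (fun x => Num.max (z x) 0) %[ae mu] ->
  limit_pairing g p s =
  \int[@lebesgue_measure_rV R n]_(x in Omega `&` [set x | 0 < z x]) (g s x * z x).
Proof.
move=> cg /(limit_pairingE cg) ->; last exact: measurable_maxr (L2_measurable z) _.
rewrite [LHS]Rintegral_mkcond [RHS]Rintegral_mkcond.
congr fine; apply: eq_integral => x _; congr EFin; rewrite !patchE in_setI.
case: ifPn => //= xO; case: ifPn => [/set_mem/= z0|/negP z0]; first by rewrite max_l// ltW.
rewrite max_r ?mulr0// leNgt; apply/negP => z0'; apply: z0; exact/mem_set.
Qed.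

Lemma limit_pairing_neg (g : R -> 'rV[R]_n -> R) (z p : L2) (s : R) :
  ball_continuous_on Omega (g s) ->
  (p : X -> R) = (fun x => Num.min (z x) 0) %[ae mu] ->
  limit_pairing g p s =
  \int[@lebesgue_measure_rV R n]_(x in Omega `&` [set x | z x < 0]) (g s x * z x).
Proof.
move=> cg /(limit_pairingE cg) ->; last exact: measurable_minr (L2_measurable z) _.
rewrite [LHS]Rintegral_mkcond [RHS]Rintegral_mkcond.
congr fine; apply: eq_integral => x _; congr EFin; rewrite !patchE in_setI.
case: ifPn => //= xO; case: ifPn => [/set_mem/= z0|/negP z0]; first by rewrite min_l// ltW.
rewrite min_r ?mulr0// leNgt; apply/negP => z0'; apply: z0; exact/mem_set.
Qed.

Let M := `|m| * Num.sqrt (fine (mu setT)).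

Let norm_F s u : `|F s u| <= M.
Proof. exact: norm_nem_le (max0_ge0 s). Qed.

Let ipP := inner_is_inner mu.

Let continuous_inner_F (u : R -> L2) p : continuous u ->
  continuous (fun s => inner (F s (u s)) p).
Proof. by move=> cu; apply: (continuous_ip ipP); exact: nem_path_continuous. Qed.

Let measurable_segment (g : R -> R) : continuous g -> measurable_fun `[0, T] (g : _ -> _).
Proof. by move=> cg; apply: measurable_funTS; exact: continuous_measurable_fun. Qed.

(** Measurability in [s] is obtained by exhibiting the pairing as a pointwise limit of continuous
    functions, bounded by [M * |p|]. *)
Let pairing_integrable (g : R -> 'rV[R]_n -> R) (p : L2) (w : nat -> L2) :
  (forall s, 0 <= s -> inner (nemytskii f s (w k)) p @[k --> \oo] --> limit_pairing g p s) ->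
  leb.-integrable `[0, T] (EFin \o limit_pairing g p).
Proof.
move=> wp.
have cw k : continuous (fun s => inner (F s (w k)) p).
  by apply: continuous_inner_F => s; exact: cvg_cst.
have wF s : `[0, T]%classic s -> inner (F s (w k)) p @[k --> \oo] --> limit_pairing g p s.
  by rewrite /= in_itv /= => /andP[s0 _]; under eq_fun do rewrite FE//; exact: wp.
have [||||||h _ _] := @dominated_convergence _ _ _ leb `[0, T]%classic _
  (fun k s => (inner (F s (w k)) p)%:E) (EFin \o limit_pairing g p) (cst (M * `|p|)%:E);
  last exact: h.
- by [].
- by move=> k; apply/measurable_EFinP; exact: measurable_segment.
- apply/measurable_EFinP.
  apply: (@measurable_fun_cvg _ _ _ _ (fun k s => inner (F s (w k)) p)) => [k|//].
  exact: measurable_segment.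
- by apply: aeW => s hs; apply: cvg_EFin; [exact: nearW|exact: wF].
- by apply: (@continuous_integrable _ (cst _)) => s; exact: cvg_cst.
- apply: aeW => s k _; rewrite /= lee_fin (le_trans (cauchy_schwarz ipP _ _))//.
  by rewrite ler_wpM2r.
Qed.

Variables (fp fm : R -> 'rV[R]_n -> R).
Hypothesis fp_continuous : {within [set z : R * 'rV[R]_n | 0 <= z.1 /\ Omega z.2],
  continuous (fun z : R * 'rV[R]_n => fp z.1 z.2)}.
Hypothesis fm_continuous : {within [set z : R * 'rV[R]_n | 0 <= z.1 /\ Omega z.2],
  continuous (fun z : R * 'rV[R]_n => fm z.1 z.2)}.
Hypothesis fp_lim : forall (t : R) x, 0 <= t -> Omega x -> f t x y @[y --> +oo] --> fp t x.
Hypothesis fm_lim : forall (t : R) x, 0 <= t -> Omega x -> f t x y @[y --> -oo] --> fm t x.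

Let continuous_section (g : R -> 'rV[R]_n -> R) s :
  {within [set z : R * 'rV[R]_n | 0 <= z.1 /\ Omega z.2],
    continuous (fun z : R * 'rV[R]_n => g z.1 z.2)} ->
  0 <= s -> ball_continuous_on Omega (g s).
Proof.
move=> cg s0 x Ox e e0.
have [d d0 hd] := within_continuous_ball cg (x := (s, x)) (conj s0 Ox) e0.
exists d => // y Oy xy; apply: (hd (s, y)); split => //; exact: ballxx.
Qed.

(** Pairing separately with the positive and negative parts isolates the regions where [w k] tends
    to [+oo] and to [-oo]. *)
Let pairing_cvg (z zp zm : L2) (r : nat -> R) (w : nat -> L2) C s : 0 < C -> 0 <= s ->
  (zp : X -> R) = (fun x => Num.max (z x) 0) %[ae mu] ->
  (zm : X -> R) = (fun x => Num.min (z x) 0) %[ae mu] ->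
  (forall k, 4 ^+ k <= r k) ->
  (forall k, `|(r k)^-1 *: w k - z| <= C * 4^-1 ^+ k) ->
  inner (nemytskii f s (w k)) zp @[k --> \oo] --> limit_pairing fp zp s /\
  inner (nemytskii f s (w k)) zm @[k --> \oo] --> limit_pairing fm zm s.
Proof.
move=> C0 s0 hp hm r4 hw; have div := L2_ratio_diverge C0 r4 hw.
split; apply: inner_nem_cvg => //; try exact: continuous_section.
- apply: filterS2 div hp => x [h _] zpx Ox; rewrite zpx// => z0.
  have zx : 0 < z x by rewrite ltNge; apply: contra z0 => zx; rewrite max_r.
  exact: cvg_comp (h zx) (fp_lim s0 Ox).
- apply: filterS2 div hm => x [_ h] zpx Ox; rewrite zpx// => z0.
  have zx : z x < 0 by rewrite ltNge; apply: contra z0 => zx; rewrite min_r.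
  exact: cvg_comp (h zx) (fm_lim s0 Ox).
Qed.

(* Rescaled counterexamples converge, along a subsequence, to a normalized element [l] of
   the eigenspace; the geometric rate makes the convergence hold almost everywhere. *)
Lemma landesman_lazer_bound (G : L2 -> L2) (C sg : R) :
  (forall x y, G (x - y) = G x - G y) -> (forall a x, G (a *: x) = a *: G x) ->
  0 <= C -> (forall x, `|G x| <= C * `|x|) ->
  (forall B, bounded_set B -> totally_bounded (G @` B)) ->
  (forall z : L2, G z = z -> `|z| = 1 -> 0 < sg * landesman_lazer_integral T fp fm z) ->
  forall rho : R, exists R0 delta : R, 0 < delta /\ forall (u : R -> L2) v,
    continuous u -> G v = v -> R0 <= `|v| ->
    (forall t, 0 <= t <= T -> `|u t - v| <= rho) ->
    delta * `|v| <= sg * \int[leb]_(s in `[0, T]) inner (F s (u s)) v.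
Proof.
move=> GB GZ C0 GC Gc LL rho; apply: contrapT => nH.
have T0 := ltW T_gt0.
have /choice[uv huv] k : exists p : (R -> L2) * L2, [/\ continuous p.1, G p.2 = p.2,
    4 ^+ k <= `|p.2|, forall t, 0 <= t <= T -> `|p.1 t - p.2| <= rho &
    sg * \int[leb]_(s in `[0, T]) inner (F s (p.1 s)) p.2 < k.+1%:R^-1 * `|p.2|].
  apply: contrapT => nk; apply: nH; exists (4 ^+ k), k.+1%:R^-1; split => // u v cu Gv v4 uv.
  by rewrite leNgt; apply/negP => lt; apply: nk; exists (u, v).
pose u k := (uv k).1; pose v k := (uv k).2.
have v4 k : 4 ^+ k <= `|v k| by case: (huv k).
have v0 k : 0 < `|v k| by rewrite (lt_le_trans _ (v4 k))// exprn_gt0.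
pose z k := `|v k|^-1 *: v k.
have Gz k : G (z k) = z k by rewrite /z GZ; case: (huv k) => _ ->.
have nz k : `|z k| = 1 by rewrite normrZ gtr0_norm ?invr_gt0// mulVf// gt_eqF.
have nz1 k : `|z k| <= 1 by rewrite nz.
have [phi [l [phi_ge Gl _ hphi]]] := fix_bounded_cvg GB C0 GC Gc Gz nz1.
(* Doubling the index improves the rate from [2^-1 ^+ k] to the [4^-1 ^+ k] required by
   [L2_ratio_diverge]. *)
pose psi k := phi (2 * k)%N.
have psi_ge k : (k <= psi k)%N by rewrite (leq_trans _ (phi_ge _))// leq_pmull.
have zl k : `|z (psi k) - l| <= 4^-1 ^+ k.
  rewrite (le_trans (hphi _))// exprM (_ : 2^-1 ^+ 2 = 4^-1)//.
  by rewrite exprVn -natrX.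
have zl_cvg : z (psi k) @[k --> \oo] --> l.
  apply/cvgrPdist_lt => e e0.
  have : (4^-1 : R) ^+ k @[k --> \oo] --> (0 : R).
    by apply: cvg_expr; rewrite ger0_norm ?invr_ge0// invf_lt1// ltr1n.
  move=> /cvgr0_norm_lt/(_ _ e0); apply: filterS => k; apply: le_lt_trans.
  by rewrite distrC (le_trans (zl k))// ler_norm.
have nl : `|l| = 1.
  rewrite -(cvg_lim (@Rhausdorff R) (cvg_norm zl_cvg)); under eq_fun do rewrite nz.
  exact: lim_cst.
have [zp [zm [hp hm lE]]] := L2_parts l.
pose r k := `|v (psi k)|.
have r4 k : 4 ^+ k <= r k by rewrite (le_trans _ (v4 _))// ler_weXn2l// ler1n.
have C1 : 0 < `|rho| + 1 by rewrite ltr_wpDl.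
have wl k s : 0 <= s <= T ->
    `|(r k)^-1 *: u (psi k) s - l| <= (`|rho| + 1) * 4^-1 ^+ k.
  move=> sT; rewrite -(subrK (z (psi k)) ((r k)^-1 *: _)) -addrA.
  rewrite (le_trans (ler_normD _ _))// mulrDl mul1r lerD//.
  rewrite -scalerBr normrZ gtr0_norm ?invr_gt0 ?v0// mulrC.
  apply: ler_pM => //; first by rewrite invr_ge0 normr_ge0.
    by case: (huv (psi k)) => _ _ _ /(_ _ sT) h _; apply: le_trans h (ler_norm _).
  by rewrite exprVn lef_pV2 ?posrE ?v0// exprn_gt0.
(* The multiples [4 ^+ k *: l] are a constant-in-time test sequence, used only for integrability of
   the limit pairings. *)
have kl k : `|(4 ^+ k)^-1 *: (4 ^+ k *: l) - l| <= 1 * 4^-1 ^+ k.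
  by rewrite scalerK ?expf_neq0// subrr normr0 mulr_ge0// exprn_ge0.
have ip_p : leb.-integrable `[0, T] (EFin \o limit_pairing fp zp).
  apply: (@pairing_integrable _ _ (fun k => 4 ^+ k *: l)) => s s0.
  exact: (pairing_cvg ltr01 s0 hp hm (fun k => lexx _) kl).1.
have ip_m : leb.-integrable `[0, T] (EFin \o limit_pairing fm zm).
  apply: (@pairing_integrable _ _ (fun k => 4 ^+ k *: l)) => s s0.
  exact: (pairing_cvg ltr01 s0 hp hm (fun k => lexx _) kl).2.
pose a k s := inner (F s (u (psi k) s)) (z (psi k)).
pose ell s := limit_pairing fp zp s + limit_pairing fm zm s.
have cu k : continuous (u k) by case: (huv k).
have a_ell s : 0 <= s <= T -> a k s @[k --> \oo] --> ell s.
  move=> sT; have /andP[s0 _] := sT.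
  have [hP hM] := pairing_cvg C1 s0 hp hm r4 (fun k => wl k s sT).
  rewrite -[ell s]addr0.
  (* Here [z (psi k)] is split into [zp + zm] and an error [z (psi k) - l]; the forcing is bounded
     by [M], so the error term vanishes in the limit. *)
  rewrite (_ : a ^~ s = fun k => (inner (nemytskii f s (u (psi k) s)) zp +
      inner (nemytskii f s (u (psi k) s)) zm) + inner (F s (u (psi k) s)) (z (psi k) - l)).
    apply: cvgD; first exact: cvgD.
    apply/cvgr0Pnorm_lt => e e0.
    have M1 : 0 < M + 1 by rewrite ltr_wpDl// (le_trans _ (norm_F 0 0)).
    have /cvgrPdist_lt/(_ _ (divr_gt0 e0 M1)) := zl_cvg; apply: filterS => k.
    rewrite ltr_pdivlMr// distrC; apply: le_lt_trans.
    rewrite (le_trans (cauchy_schwarz ipP _ _))// mulrC ler_wpM2l//.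
    by rewrite (le_trans (norm_F _ _))// lerDl.
  apply/funext => k; rewrite -FE// -(ipDr ipP) -lE -(ipDr ipP); congr inner.
  by rewrite addrC subrK.
have ia : \int[leb]_(s in `[0, T]) a k s @[k --> \oo] --> \int[leb]_(s in `[0, T]) ell s.
  apply: (@dominated_convergence_Rintegral _ _ _ leb _ _ _ (cst M)).
  - by [].
  - by move=> k; apply: measurable_segment; exact: continuous_inner_F.
  - apply: measurable_funD; apply/measurable_EFinP.
      exact: measurable_int ip_p.
    exact: measurable_int ip_m.
  - by apply: aeW => s; rewrite /= in_itv /=; exact: a_ell.
  - by apply: (@continuous_integrable _ (cst M)) => s; exact: cvg_cst.
  - apply: aeW => s k _; rewrite (le_trans (cauchy_schwarz ipP _ _))//.
    by rewrite nz mulr1.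
have ellE : \int[leb]_(s in `[0, T]) ell s = landesman_lazer_integral T fp fm l.
  rewrite /ell RintegralD//; congr (_ + _); apply: eq_Rintegral => s.
    rewrite inE /= in_itv /= => /andP[s0 _]; apply: limit_pairing_pos => //.
    exact: continuous_section.
  rewrite inE /= in_itv /= => /andP[s0 _]; apply: limit_pairing_neg => //.
  exact: continuous_section.
have pos := LL l Gl nl; rewrite -ellE in pos.
have sa : sg * \int[leb]_(s in `[0, T]) a k s @[k --> \oo] -->
    sg * \int[leb]_(s in `[0, T]) ell s by exact: cvgMr.
have half : 0 < (sg * \int[leb]_(s in `[0, T]) ell s) / 2 by rewrite divr_gt0.
have lt_half : (sg * \int[leb]_(s in `[0, T]) ell s) / 2 < sg * \int[leb]_(s in `[0, T]) ell s.
  by rewrite ltr_pdivrMr// ltr_pMr// ltr1n.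
have [k [k1 k2]] := filter_ex (filterI (cvgr_gt _ sa _ lt_half)
  (near_infty_natSinv_lt (PosNum half))).
(* The counterexample inequality divided by [|v (psi k)|]: it contradicts the lower bound by half of
   the positive limit. *)
have : sg * \int[leb]_(s in `[0, T]) a k s < (psi k).+1%:R^-1.
  have [_ _ _ _] := huv (psi k).
  rewrite -ltr_pdivrMr ?v0// -mulrA (_ : _ / _ = \int[leb]_(s in `[0, T]) a k s)//.
  rewrite mulrC -RintegralZl//; last first.
    by apply: continuous_integrable; apply: continuous_inner_F; exact: cu.
  by apply: eq_Rintegral => s _; rewrite /a /z (ipZr ipP).
apply/negP; rewrite -leNgt (le_trans _ (ltW k1))// (le_trans _ (ltW k2))//.
by rewrite lef_pV2 ?posrE// ler_nat ltnS.
Qed.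

End landesman_lazer.

(** * Existence of a periodic mild solution *)

Lemma eq_has_bochner_integral d (T : measurableType d) (R : realType) (X : normedModType R)
    (mu : {measure set T -> \bar R}) (D : set T) (g h : T -> X) v :
  (forall x, D x -> g x = h x) -> has_bochner_integral mu D g v -> has_bochner_integral mu D h v.
Proof.
move=> gh [s [h1 h2 h3 h4]]; exists s; split => //.
- by apply: filterS h2 => x hx Dx; rewrite -gh//; exact: hx.
- rewrite (_ : (fun k => _) = fun k => \int[mu]_(x in D) `|g x - simple_fun (s k) x|%:E)%E//.
  by apply/funext => k; apply: eq_integral => x /set_mem Dx; rewrite gh.
Qed.

Theorem theorem4p1 (R : realType) (n : nat) (n_ge1 : (1 <= n)%N)
  (Omega : set 'rV[R]_n) (oOmega : open Omega) (bOmega : bounded_set Omega)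
  (T : R) (T_gt0 : 0 < T)
  (f : R -> 'rV[R]_n -> R -> R)
  (f_continuous : {within [set z : R * 'rV[R]_n * R | 0 <= z.1.1 /\ Omega z.1.2],
     continuous (fun z : R * 'rV[R]_n * R => f z.1.1 z.1.2 z.2)})
  (f_bounded : exists2 m : R, 0 < m &
     forall (t : R) x y, 0 <= t -> Omega x -> `|f t x y| <= m)
  (f_lipschitz : exists2 L : R, 0 < L &
     forall (t : R) x y1 y2, 0 <= t -> Omega x ->
       `|f t x y1 - f t x y2| <= L * `|y1 - y2|)
  (f_periodic : forall (t : R) x y, 0 <= t -> Omega x -> f t x y = f (t + T) x y)
  (fp fm : R -> 'rV[R]_n -> R)
  (fp_continuous : {within [set z : R * 'rV[R]_n | 0 <= z.1 /\ Omega z.2],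
     continuous (fun z : R * 'rV[R]_n => fp z.1 z.2)})
  (fm_continuous : {within [set z : R * 'rV[R]_n | 0 <= z.1 /\ Omega z.2],
     continuous (fun z : R * 'rV[R]_n => fm z.1 z.2)})
  (fp_lim : forall (t : R) x, 0 <= t -> Omega x -> f t x y @[y --> +oo] --> fp t x)
  (fm_lim : forall (t : R) x, 0 <= t -> Omega x -> f t x y @[y --> -oo] --> fm t x)
  (A : operator (L2_on oOmega)) (A_linear : linear_operator A)
  (S : R -> L2_on oOmega -> L2_on oOmega)
  (S_C0 : C0_semigroup S) (S_compact : compact_semigroup S)
  (A_generates : generates (opp_op A) S)
  (lambda : R) (lambda_eigenvalue : eigenvalue_op A lambda)
  (A3 : ker (sub_op A (scalar_op lambda)) =
          ker (sub_op (adjoint A) (scalar_op lambda)) /\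
        ker (sub_op (adjoint A) (scalar_op lambda)) =
          ker (sub_op (scalar_op 1)
                      (total_op (fun u => expR (lambda * T) *: S T u))))
  (landesman_lazer :
     (forall u, ker (sub_op (scalar_op lambda) A) u -> `|u| = 1 ->
        landesman_lazer_integral T fp fm u > 0) \/
     (forall u, ker (sub_op (scalar_op lambda) A) u -> `|u| = 1 ->
        landesman_lazer_integral T fp fm u < 0)) :
  exists u : R -> L2_on oOmega,
    mild_solution S lambda (nemytskii f) u /\
    forall t : R, 0 <= t -> u t = u (t + T).
Proof.
have [m _ f_le] := f_bounded; have [L _ f_lip] := f_lipschitz.
pose K t x := expR (lambda * t) *: S t x.
have KC0 : C0_semigroup K := expR_semigroup lambda S_C0.
pose ip := @inner _ _ _ (lebesgue_on oOmega).
have ipP : is_inner ip := inner_is_inner (lebesgue_on oOmega).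
pose F (s : R) (x : L2_on oOmega) := nemytskii f (Num.max s 0) x.
have T0 := ltW T_gt0.
have [A3a A3b] := A3.
(* (A3) puts a fixed vector of [K T] into both eigenspaces: that of [A] makes it fixed by every
   [K t], that of the adjoint makes pairings with it invariant. *)
have fix_ker v : K T v = v -> ker (sub_op A (scalar_op lambda)) v.
  by move=> Kv; rewrite A3a A3b; split => //=; rewrite scale1r -/(K T v) Kv subrr.
have fix_adj v : K T v = v -> ker (sub_op (adjoint A) (scalar_op lambda)) v.
  by move=> /fix_ker; rewrite A3a.
have Kc (B : set (L2_on oOmega)) t : bounded_set B -> 0 < t -> totally_bounded (K t @` B).
  move=> bB t0; have := precompact_totally_bounded (S_compact B t bB t0).
  move=> /(totally_bounded_image (f := fun x => expR (lambda * t) *: x) (c := expR (lambda * t))).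
  rewrite image_comp; apply => x y.
  by rewrite -scalerBr normrZ ger0_norm// expR_ge0.
have Kfix v t : K T v = v -> 0 <= t -> K t v = v.
  move=> /fix_ker[[Av _] /eqP]; rewrite /= subr_eq0 => /eqP Alv t0.
  exact: (eigenvector_fixed S_C0 A_generates Av Alv).
have Kip v t x : K T v = v -> 0 <= t -> ip (K t x) v = ip x v.
  move=> /fix_adj[[[w hw] _] /eqP]; rewrite /= subr_eq0 => /eqP Alv t0.
  apply: (adjoint_eigenvector_fixed ipP S_C0 A_generates) => // u Au.
  (* Membership in the domain of the adjoint supplies a witness, so the chosen value does satisfy
     the adjoint relation. *)
  by rewrite -Alv; exact: (xgetPex 0 (ex_intro _ w hw)) u Au.
have F_cont := nem_path_continuous (oOmega := oOmega) bOmega f_continuous f_le f_lip.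
have F_per s x : 0 <= s -> F (s + T) x = F s x.
  move=> s0; rewrite /F !max_l ?addr_ge0//.
  apply/Lspace_eqP.
  have sT0 : 0 <= s + T by rewrite addr_ge0.
  have h1 := nemE bOmega f_continuous f_le x sT0.
  have h2 := nemE bOmega f_continuous f_le x s0.
  apply: filterS2 h1 h2 => y e1 e2 _; rewrite e1// e2//.
  have [Oy|nOy] := pselect (Omega y); last by rewrite !nem_fun_out.
  by rewrite !nem_fun_in// -f_periodic.
(* The sign merges the two alternatives of the Landesman-Lazer condition. *)
have [sg sg1 LL] : exists2 sg : R, `|sg| = 1 & forall z, K T z = z -> `|z| = 1 ->
    0 < sg * landesman_lazer_integral T fp fm z.
  have ker_fix z : K T z = z -> ker (sub_op (scalar_op lambda) A) z.
    move=> /fix_ker[[Az _] /eqP]; rewrite /= subr_eq0 => /eqP Alz.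
    by split => //=; rewrite Alz subrr.
  case: landesman_lazer => h.
    by exists 1; [rewrite normr1 | move=> z Kz z1; rewrite mul1r h//; exact: ker_fix].
  exists (-1); first by rewrite normrN1.
  by move=> z Kz z1; rewrite mulN1r oppr_gt0 h//; exact: ker_fix.
have [C C1 hC] := sg_bound KC0 T.
have LLb := landesman_lazer_bound bOmega f_continuous f_le f_lip T_gt0 fp_continuous fm_continuous
  fp_lim fm_lim (G := K T) (C := C) (sg := sg)
  (fun x y => sgB KC0 x y T0) (fun a x => sgZ KC0 a x T0) (le_trans ler01 C1)
  (fun x => hC T x T0 (lexx T)) (fun B bB => Kc B T bB T_gt0) LL.
have [U [cU UT UE]] := periodic_solution_exists ipP KC0 T_gt0 Kc Kfix Kip F_cont
  (fun s x _ => norm_nem_le bOmega f_continuous f_le x (max0_ge0 s))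
  (fun s x y _ => nem_lipschitz bOmega f_continuous f_le f_lip x y (max0_ge0 s))
  F_per sg1 LLb.
exists U; split; last by move=> t _; rewrite UT.
split; first exact: continuous_subspaceT.
move=> t t0; exists (conv ip K (fun s => F s (U s)) t); last exact: UE.
(* On [[0, t]] the truncations of time in [F] and in [sgp] are inactive, so the integrand is the one
   of the mild solution. *)
apply: eq_has_bochner_integral (has_bochner_integral_continuous ipP
  (sgp_continuous KC0 (c := t) (F_cont U cU)) t0).
move=> s; rewrite /= in_itv /= => /andP[s0 st].
by rewrite /sgp !max_l// subr_ge0.
Qed.
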